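(* Let $n$ be a positive integer and let $\mathcal{D}(n)$ be the space of Delzant polytopes in $\mathbb{R}^n$. (1) $\mathcal{D}(n)$ is path-connected. (2) $\mathcal{D}(n)$ is not locally compact, but it is dense in $\mathcal{C}_p(n)$. Hence, its completion is the same as that of $\mathcal{C}_p(n)$, namely $\mathcal{C}_p(n)\cup\{0\}$ for $\delta^V$ and $\mathcal{C}(n)$ for $\delta^H$.
   Context: A Delzant polytope in $\mathbb{R}^n$ is a full-dimensional polytope $P\subset\mathbb{R}^n$ such that every vertex lies in exactly $n$ edges, all edge directions are rational, and at each vertex the $n$ primitive integer vectors along the edges form a basis of $\mathbb{Z}^n$. $\mathcal{D}(n)$ is the set of all of them. $\mathcal{C}(n)$ is the set of all convex bodies (nonempty compact convex sets) in $\mathbb{R}^n$, and $\mathcal{C}_p(n)$ the subset of proper ones, i.e. those with nonempty interior. The symmetric difference distance and the Hausdorff distance are $$\delta^V(P,Q)=\mathrm{Vol}(P\setminus Q)+\mathrm{Vol}(Q\setminus P),\qquad \delta^H(P,Q)=\max\Big\{\max_{x\in P}\mathrm{dist}(x,Q),\max_{y\in Q}\mathrm{dist}(y,P)\Big\},$$ where $\mathrm{dist}(x,Q)=\min_{y\in Q}\|x-y\|$. On $\mathcal{C}_p(n)$ both are metrics and they induce the same topology; $\mathcal{D}(n)\subset\mathcal{C}_p(n)$ carries this topology. In $\mathcal{C}_p(n)\cup\{0\}$, the point $0$ denotes the class of all non-proper convex bodies, with $\delta^V(P,0)=\mathrm{Vol}(P)$; $\mathcal{C}(n)$ carries $\d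elta^H$.
   Formalization: That D(n) is not locally compact is stated only for n ≥ 2: for n = 1 it is false, since D(1) consists of all intervals [a,b] with a < b and is homeomorphic to an open half-plane, which is locally compact. *)

(* Defs.v *)
From HB Require Import structures.
From mathcomp Require Import all_boot all_order all_algebra.
From mathcomp Require Import all_classical all_reals all_analysis.
From mathcomp Require Import ring lra.

Set Implicit Arguments.
Unset Strict Implicit.
Unset Printing Implicit Defensive.

Import Order.TTheory GRing.Theory Num.Theory.
Import numFieldNormedType.Exports.

Local Open Scope classical_set_scope.
Local Open Scope ring_scope.

Section lebesgue_measure_Rn.
Context {R : realType}.

Notation mR := (measurableTypeR R).
Local Open Scope ereal_scope.

(* Lebesgue measure on R^n, as the n-fold product of the one on R. *)
Fixpoint lebesgue_tuple (n : nat) : set (n.-tuple mR) -> \bar R :=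
  match n with
  | 0 => \d_ [tuple]
  | m.+1 => pushforward (lebesgue_measure \x @lebesgue_tuple m)
                        (fun p => cons_tuple p.1 p.2)
  end.
Arguments lebesgue_tuple : clear implicits.

Section step.
Context (l : {sigma_finite_measure set mR -> \bar R}).
Context n (mu : {sigma_finite_measure set (n.-tuple mR) -> \bar R}).

Let cons (p : mR * n.-tuple mR) : n.+1.-tuple mR := cons_tuple p.1 p.2.

Let mcons : measurable_fun setT cons.
Proof. exact: measurable_cons. Qed.

Let uncons (t : n.+1.-tuple mR) : mR * n.-tuple mR := (thead t, [tuple of behead t]).

Let muncons : measurable_fun setT uncons.
Proof.
apply/measurable_fun_pairP; split; first exact: measurable_tnth.
exact: measurable_behead.
Qed.

Let consK : cancel cons uncons.
Proof. by case=> x t; congr pair; apply: val_inj. Qed.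

Let unconsK : cancel uncons cons.
Proof. by move=> t; rewrite [t in RHS]tuple_eta; apply: val_inj. Qed.

Let step := pushforward (l \x mu) cons.

Let step0 : step set0 = 0. Proof. exact: measure0. Qed.

Let step_ge0 A : 0 <= step A. Proof. exact: measure_ge0. Qed.

Let step_sigma_additive : semi_sigma_additive step.
Proof. exact: measure_semi_sigma_additive. Qed.

HB.instance Definition _ := isMeasure.Build _ _ _ step
  step0 step_ge0 step_sigma_additive.

Let step_sigma_finite : sigma_finite setT step.
Proof.
have /sigma_finiteP[F [TF ndF Foo]] := sigma_finiteT l.
have /sigma_finiteP[G [TG ndG Goo]] := sigma_finiteT mu.
exists (fun k => uncons @^-1` (F k `*` G k)) => [|k].
  rewrite -preimage_bigcup (_ : \bigcup_k _ = setT) ?preimage_setT//.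
  rewrite -subTset => -[x y] _.
  have [i _ Fix] : (\bigcup_i F i) x by rewrite -TF.
  have [j _ Gjy] : (\bigcup_i G i) y by rewrite -TG.
  exists (maxn i j) => //; split => /=.
  - by move: x Fix; exact/subsetPset/ndF/leq_maxl.
  - by move: y Gjy; exact/subsetPset/ndG/leq_maxr.
have [mF Fk] := Foo k; have [mG Gk] := Goo k; split.
  rewrite -[X in measurable X]setTI; apply: muncons => //.
  exact: measurableX.
rewrite /step /pushforward -comp_preimage (_ : uncons \o cons = id).
  by rewrite preimage_id product_measure1E// lte_mul_pinfty// ge0_fin_numE.
exact/funext/consK.
Qed.

HB.instance Definition _ := Measure_isSigmaFinite.Build _ _ _ step
  step_sigma_finite.

Lemma lebesgue_step : exists nu : {sigma_finite_measure set (n.+1.-tuple mR) -> \bar R},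
  pushforward (l \x mu) (fun p => cons_tuple p.1 p.2) = nu.
Proof. by exists step. Qed.

End step.

Lemma lebesgue_tuple_ex n :
  exists mu : {sigma_finite_measure set (n.-tuple mR) -> \bar R},
    lebesgue_tuple n = mu.
Proof.
elim: n => [|n [mu IHmu]]; first by exists \d_ [tuple].
by have [nu nuE] := lebesgue_step lebesgue_measure mu; exists nu; rewrite /= IHmu.
Qed.

Section instances.
Variable n : nat.

Let leb0 : lebesgue_tuple n set0 = 0.
Proof. by have [mu ->] := lebesgue_tuple_ex n. Qed.

Let leb_ge0 A : 0 <= lebesgue_tuple n A.
Proof. by have [mu ->] := lebesgue_tuple_ex n. Qed.

Let leb_sigma_additive : semi_sigma_additive (lebesgue_tuple n).
Proof.
have [mu ->] := lebesgue_tuple_ex n; exact: measure_semi_sigma_additive.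
Qed.

HB.instance Definition _ := isMeasure.Build _ _ _ (lebesgue_tuple n)
  leb0 leb_ge0 leb_sigma_additive.

Let leb_sigma_finite : sigma_finite setT (lebesgue_tuple n).
Proof. by have [mu ->] := lebesgue_tuple_ex n; exact: sigma_finiteT. Qed.

HB.instance Definition _ := Measure_isSigmaFinite.Build _ _ _ (lebesgue_tuple n)
  leb_sigma_finite.

End instances.

Lemma measurable_box n (A : 'I_n -> set mR) : (forall i, measurable (A i)) ->
  measurable [set t : n.-tuple mR | forall i, A i (tnth t i)].
Proof.
move=> mA.
rewrite (_ : [set _ | _] = \bigcap_(i in [set: 'I_n]) (@tnth n mR ^~ i @^-1` A i)).
  apply: fin_bigcap_measurable => // i _.
  by rewrite -[X in measurable X]setTI; exact: measurable_tnth.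
by apply/seteqP; split => t /= tA i; [move=> _|]; exact: tA.
Qed.

Lemma lebesgue_tuple_box n (A : 'I_n -> set mR) : (forall i, measurable (A i)) ->
  lebesgue_tuple n [set t | forall i, A i (tnth t i)] =
  \prod_(i < n) lebesgue_measure (A i).
Proof.
elim: n A => [|n IHn] A mA.
  by rewrite big_ord0 /= diracE mem_set// => -[].
rewrite big_ord_recl -IHn//= -product_measure1E//; last first.
  exact: (@measurable_box n (fun i => A (lift ord0 i))).
rewrite /pushforward; apply: congr1; apply/seteqP; split => -[x t] /=.
  by move=> tA; split => [|i]; [have := tA ord0|have := tA (lift ord0 i); rewrite tnthS].
move=> [xA tA] i; case: (unliftP ord0 i) => [j ->|->//].
by rewrite tnthS; exact: tA.
Qed.

Lemma measurable_rV_open n (U : set 'rV[R]_n) : open U ->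
  measurable [set t : n.-tuple mR | U (\row_i tnth t i)].
Proof.
move=> oU.
pose box (c : 'rV[rat]_n * nat) : set (n.-tuple mR) :=
  [set t | forall i,
    (`](ratr (c.1 ord0 i) - c.2.+1%:R^-1)%R, (ratr (c.1 ord0 i) + c.2.+1%:R^-1)%R[%classic : set mR) (tnth t i)].
pose D := [set c | box c `<=` [set t | U (\row_i tnth t i)]].
have mbox c : measurable (box c).
  by apply: (@measurable_box n (fun i => [set` Interval _ _])) => i; exact: measurable_itv.
suff -> : [set t | U (\row_i tnth t i)] = \bigcup_(c in D) box c.
  rewrite bigcup_mkcond; apply: countable_bigcupT_measurable => // c.
  by case: ifP.
apply/seteqP; split => t /=; last by move=> [c /= sub ct]; exact: sub.
move=> Ut; have /nbhs_ballP[e/= e0 eU] : nbhs (\row_i tnth t i : 'rV[R]_n) U.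
  exact: open_nbhs_nbhs.
have e20 : (0 < e / 2)%R by rewrite divr_gt0.
have [k ke] : exists k : nat, (k.+1%:R^-1 < e / 2)%R.
  near \oo => k; exists k; near: k.
  exact: (near_infty_natSinv_lt (PosNum e20)).
have /choice[c cP] (i : 'I_n) :
    exists q : rat, (ratr q \in `](tnth t i - k.+1%:R^-1)%R, (tnth t i + k.+1%:R^-1)%R[).
  apply: rat_in_itvoo; rewrite ltrBlDr -addrA ltrDl addr_gt0//.
have ct : box (\row_i c i, k) t.
  move=> i /=; rewrite mxE in_itv/=; have := cP i; rewrite in_itv/= => /andP[tc ct].
  by rewrite ltrBlDr ct -ltrBlDr tc.
exists (\row_i c i, k) => //= s sbox; apply: eU; split => // i j.
rewrite !mxE /ball/= (le_lt_trans (ler_distD (ratr (c j)) _ _))// [ltRHS](splitr e).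
have dlt (u : n.-tuple mR) : box (\row_i c i, k) u -> (`|ratr (c j) - (tnth u j : R)| < e / 2)%R.
  move=> ubox; rewrite distrC; apply: lt_trans ke; rewrite ltr_distl.
  by have := ubox j; rewrite /= mxE in_itv.
rewrite (distrC (tnth t j)); exact: (@ltrD R _ _ _ _ (dlt _ ct) (dlt _ sbox)).
Unshelve. all: by end_near. Qed.
End lebesgue_measure_Rn.

Section euclidean.
Context {R : realType} {n : nat}.
Implicit Types (x y z : 'rV[R]_n) (A B P Q : set 'rV[R]_n).

Definition dot x y : R := \sum_i x ord0 i * y ord0 i.

(* The library norm `|x| on 'rV[R]_n is the sup norm. *)
Definition enorm x : R := Num.sqrt (dot x x).

Definition vol A : \bar R :=
  lebesgue_tuple [set t : n.-tuple (measurableTypeR R) | A (\row_i tnth t i)].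

Definition convex_body : set (set 'rV[R]_n) :=
  [set A : set 'rV[R]_n | A !=set0 /\ compact A /\ convex_set A].

Definition proper_convex_body : set (set 'rV[R]_n) :=
  [set A : set 'rV[R]_n | convex_body A /\ A° !=set0].

Definition symm_diff_dist P Q : R := fine (vol (P `\` Q) + vol (Q `\` P)).

(* For nonempty compact sets these infima and suprema are attained. *)
Definition edist x Q : R := inf [set enorm (x - y) | y in Q].

Definition hausdorff_dist P Q : R :=
  Num.max (sup [set edist x Q | x in P]) (sup [set edist y P | y in Q]).

Lemma compact_closed_rV A : compact A -> closed A.
Proof. by apply: compact_closed; exact: norm_hausdorff. Qed.

Lemma measurable_compact A : compact A ->
  measurable [set t : n.-tuple (measurableTypeR R) | A (\row_i tnth t i)].
Proof.
move=> /compact_closed_rV cA.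
have /measurable_rV_open/measurableC : open (~` A) by exact: closed_openC.
by congr measurable; apply/seteqP; split => t /=; [move/contrapT|move=> ? []].
Qed.

Lemma compact_vol_fin A : compact A -> vol A \is a fin_num.
Proof.
move=> cA; have [M [Mr AM]] := compact_bounded cA.
have {}AM v : A v -> forall i, `|v ord0 i| <= M + 1.
  move=> Av i; apply: le_trans (AM (M + 1) _ v Av); last by rewrite ltrDl.
  by rewrite [leRHS]/Num.Def.normr /= mx_normrE; apply/bigmax_geP; right => /=; exists (ord0, i).
rewrite ge0_fin_numE ?measure_ge0//.
pose B (i : 'I_n) : set (measurableTypeR R) := `[- (M + 1), M + 1]%classic.
apply: (@le_lt_trans _ _ (lebesgue_tuple [set t | forall i, B i (tnth t i)])).
  apply: le_measure; rewrite ?inE; first exact: measurable_compact.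
    by apply: measurable_box => i; exact: measurable_itv.
  by move=> t /= /AM tM i; have := tM i; rewrite mxE /B /= in_itv/= ler_norml.
rewrite lebesgue_tuple_box => [|i]; last exact: measurable_itv.
rewrite -ge0_fin_numE; last by apply: prode_ge0 => i _; exact: measure_ge0.
apply: prode_fin_num => i _; rewrite /B lebesgue_measure_itv/=.
by case: ifP.
Qed.

Lemma ball_vol_gt0 x (e : R) A : 0 < e -> ball x e `<=` A ->
   measurable [set t : n.-tuple (measurableTypeR R) | A (\row_i tnth t i)] ->
  (0 < vol A)%E.
Proof.
move=> e0 xA mA.
pose B (i : 'I_n) : set (measurableTypeR R) := `](x ord0 i - e), (x ord0 i + e)[%classic.
apply: (@lt_le_trans _ _ (lebesgue_tuple [set t | forall i, B i (tnth t i)])).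
  rewrite lebesgue_tuple_box => [|i]; last exact: measurable_itv.
  apply: (@lt_le_trans _ _ (\prod_(i < n) (e + e)%:E)%E).
    by rewrite prodEFin lte_fin prodr_gt0// => i _; rewrite addr_gt0.
  rewrite (eq_bigr (fun i => lebesgue_measure (B i)))// => i _.
  rewrite /B lebesgue_measure_itv/= lte_fin ltrD2l gtrN// -EFinD; congr EFin; ring.
apply: le_measure; rewrite ?inE//.
  by apply: measurable_box => i; exact: measurable_itv.
move=> t /= tB; apply: xA; split => // i j; rewrite ord1 mxE.
by have := tB j; rewrite /B/= in_itv/= /ball/= distrC ltr_distl.
Qed.
End euclidean.

Section symm_diff_dist_theory.
Context {R : realType} {n : nat}.
Implicit Types (x y z : 'rV[R]_n) (A B P Q : set 'rV[R]_n).

Let tup A := [set t : n.-tuple (measurableTypeR R) | A (\row_i tnth t i)].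

Let mtupD P Q : compact P -> compact Q -> measurable (tup (P `\` Q)).
Proof.
by move=> cP cQ; apply: (@measurableD _ _ (tup P) (tup Q)); exact: measurable_compact.
Qed.

Let volD_fin P Q : compact P -> compact Q -> vol (P `\` Q) \is a fin_num.
Proof.
move=> cP cQ; rewrite ge0_fin_numE ?measure_ge0//.
apply: (@le_lt_trans _ _ (vol P)); last by rewrite ltey_eq compact_vol_fin.
apply: le_measure; rewrite ?inE; [exact: mtupD|exact: measurable_compact|].
by move=> t [].
Qed.

Lemma symm_diff_distxx P : symm_diff_dist P P = 0.
Proof.
by rewrite /symm_diff_dist setDv /vol [X in lebesgue_tuple X](_ : _ = set0) // measure0 adde0.
Qed.

Lemma symm_diff_distC P Q : symm_diff_dist P Q = symm_diff_dist Q P.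
Proof. by rewrite /symm_diff_dist addeC. Qed.

Lemma symm_diff_dist0 P : symm_diff_dist P set0 = fine (vol P).
Proof.
rewrite /symm_diff_dist setD0 set0D [X in (_ + X)%E](_ : _ = 0%E) ?adde0//.
Qed.

Lemma symm_diff_dist_triangle Q P S : compact P -> compact Q -> compact S ->
  symm_diff_dist P S <= symm_diff_dist P Q + symm_diff_dist Q S.
Proof.
move=> cP cQ cS.
have tri A B C : compact A -> compact B -> compact C ->
    (vol (A `\` C) <= vol (A `\` B) + vol (B `\` C))%E.
  move=> cA cB cC.
  apply: (@le_trans _ _ (lebesgue_tuple (tup (A `\` B) `|` tup (B `\` C)))).
    apply: le_measure; rewrite ?inE; [exact: mtupD| |].
      by apply: measurableU; exact: mtupD.
    move=> t [At Ct] /=; have [Bt|Bt] := pselect (B (\row_i tnth t i)).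
      by right; split.
    by left; split.
  by apply: measureU2; exact: mtupD.
rewrite -fineD ?fin_numD ?volD_fin// fine_le ?fin_numD ?volD_fin//.
by rewrite addeACA leeD ?tri// addeC tri.
Qed.

Lemma symm_diff_dist_subset P Q : proper_convex_body P -> proper_convex_body Q ->
  symm_diff_dist P Q = 0 -> P `<=` Q.
Proof.
move=> [[_ [cP convP]] [p /nbhs_ballP[r/= r0 prP]]] [[_ [cQ _]] _] PQ0.
have volPQ0 : vol (P `\` Q) = 0%E.
  move: PQ0; rewrite /symm_diff_dist fineD ?volD_fin// => /eqP.
  rewrite paddr_eq0 ?fine_ge0 ?measure_ge0// => /andP[/eqP PQ0 _].
  by rewrite -[LHS]fineK ?volD_fin// PQ0.
move=> x Px; apply: contrapT => Qx.
have /nbhs_ballP[e/= e0 xeQ] : nbhs x (~` Q).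
  apply: open_nbhs_nbhs; split => //.
  by apply: closed_openC; exact: compact_closed_rV.
pose d := `|p - x| + r + e.
have d0 : 0 < d by rewrite addr_gt0// ltr_wpDl.
pose t := e / d.
have t0 : 0 < t by rewrite divr_gt0.
have t1 : t <= 1 by rewrite ler_pdivrMr// mul1r lerDr addr_ge0// ltW.
have tr0 : 0 < t * r by rewrite mulr_gt0.
suff : (0 < vol (P `\` Q))%E by rewrite volPQ0 ltxx.
apply: (@ball_vol_gt0 _ _ (x + t *: (p - x)) (t * r)) => //; last exact: mtupD.
move=> y; rewrite mx_norm_ball /ball_/= => yz; split.
  pose w := p + t^-1 *: (y - (x + t *: (p - x))).
  have Pw : P w.
    apply: prP; rewrite mx_norm_ball /ball_/= opprD addNKr normrN normrZ.
    by rewrite gtr0_norm ?invr_gt0// mulrC ltr_pdivrMr// distrC [ltRHS]mulrC.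
  have := convP w x (Itv01 (ltW t0) t1); rewrite !inE => /(_ Pw Px).
  congr P; rewrite /conv/= /unstable.onem /w scalerDr scalerA divff ?gt_eqF// scale1r.
  by apply/rowP => i; rewrite !mxE; ring.
apply: xeQ; rewrite mx_norm_ball /ball_/= (le_lt_trans (ler_distD (x + t *: (p - x)) _ _))//.
rewrite opprD addNKr normrN normrZ gtr0_norm//.
have : t * `|p - x| + t * r + t * e = e by rewrite -!mulrDr mulfVK ?gt_eqF.
have : 0 < t * e by rewrite mulr_gt0.
move: yz; lra.
Qed.
End symm_diff_dist_theory.

Section hausdorff_dist_theory.
Context {R : realType} {n : nat}.
Implicit Types (x y z : 'rV[R]_n) (A B P Q S : set 'rV[R]_n).

Lemma dotC x y : dot x y = dot y x.
Proof. by apply: eq_bigr => i _; rewrite mulrC. Qed.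

Lemma dot_ge0 x : 0 <= dot x x.
Proof. by apply: sumr_ge0 => i _; rewrite -expr2 sqr_ge0. Qed.

Lemma dotD x y z : dot (x + y) z = dot x z + dot y z.
Proof. by rewrite -big_split; apply: eq_bigr => i _; rewrite mxE mulrDl. Qed.

Lemma dotZ (a : R) x y : dot (a *: x) y = a * dot x y.
Proof. by rewrite mulr_sumr; apply: eq_bigr => i _; rewrite mxE mulrA. Qed.

Lemma enorm_ge0 x : 0 <= enorm x.
Proof. exact: sqrtr_ge0. Qed.

Lemma enorm_sqr x : enorm x ^+ 2 = dot x x.
Proof. by rewrite sqr_sqrtr// dot_ge0. Qed.

Lemma enormN x : enorm (- x) = enorm x.
Proof. by congr Num.sqrt; apply: eq_bigr => i _; rewrite mxE mulrNN. Qed.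

Lemma enormB x y : enorm (x - y) = enorm (y - x).
Proof. by rewrite -enormN opprB. Qed.

Lemma enorm0 : enorm (0 : 'rV[R]_n) = 0.
Proof.
rewrite /enorm [dot _ _](_ : _ = 0) ?sqrtr0//.
by apply: big1 => i _; rewrite mxE mul0r.
Qed.

Lemma coord_le_enorm x i : `|x ord0 i| <= enorm x.
Proof.
rewrite -sqrtr_sqr ler_sqrt ?dot_ge0// /dot (bigD1 i)//= expr2 lerDl.
by apply: sumr_ge0 => j _; rewrite -expr2 sqr_ge0.
Qed.

Lemma dot_sqr_le x y : dot x y ^+ 2 <= dot x x * dot y y.
Proof.
have [y0|y0] := eqVneq (dot y y) 0.
  rewrite (_ : dot x y = 0) ?expr0n ?mulr_ge0 ?dot_ge0//.
  apply: big1 => i _; rewrite (_ : y ord0 i = 0) ?mulr0//; apply/eqP.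
  by rewrite -normr_eq0 eq_le normr_ge0 andbT -(sqrtr0 R) -y0 coord_le_enorm.
have yy0 : 0 < dot y y by rewrite lt_neqAle eq_sym y0 dot_ge0.
have := dot_ge0 (dot y y *: x + - dot x y *: y).
rewrite dotD !dotZ !(dotC _ (_ + _)) !dotD !dotZ (dotC y x).
move=> le0; rewrite -subr_ge0 -(pmulr_rge0 _ yy0); apply: le_trans le0 _.
by rewrite le_eqVlt; apply/orP; left; apply/eqP; ring.
Qed.

Lemma ler_enormD x y : enorm (x + y) <= enorm x + enorm y.
Proof.
rewrite -(@ler_pXn2r _ 2) ?nnegrE ?addr_ge0 ?enorm_ge0// enorm_sqr.
rewrite sqrrD !enorm_sqr dotD !(dotC _ (x + y)) !dotD (dotC y x).
have : dot x y <= enorm x * enorm y; last lra.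
rewrite (le_trans (ler_norm _))// -sqrtr_sqr -sqrtrM ?dot_ge0//.
by rewrite ler_sqrt ?dot_sqr_le// mulr_ge0 ?dot_ge0.
Qed.

Lemma ler_enorm_distD z x y : enorm (x - y) <= enorm (x - z) + enorm (z - y).
Proof. by rewrite (le_trans _ (ler_enormD _ _))// addrA subrK. Qed.

Let enorm_bounded A : compact A -> exists M, forall x, A x -> enorm x <= M.
Proof.
move=> cA; have [M [Mr AM]] := compact_bounded cA.
exists (Num.sqrt (\sum_(i < n) (M + 1) * (M + 1))) => x Ax.
have xM i : `|x ord0 i| <= M + 1.
  apply: le_trans (AM (M + 1) _ x Ax); last by rewrite ltrDl.
  by rewrite [leRHS]/Num.Def.normr /= mx_normrE; apply/bigmax_geP; right => /=; exists (ord0, i).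
rewrite ler_sqrt; last by apply: sumr_ge0 => i _; rewrite -expr2 sqr_ge0.
apply: ler_sum => i _; rewrite -!expr2 -real_normK ?num_real// ler_sqr ?nnegrE//.
by rewrite (le_trans _ (xM i)).
Qed.

Let lb0 x Q : lbound [set enorm (x - y) | y in Q] 0.
Proof. by move=> _ [y Qy <-]; exact: enorm_ge0. Qed.

Let edist_has_inf x Q : Q !=set0 -> has_inf [set enorm (x - y) | y in Q].
Proof.
by move=> [y Qy]; split; [exists (enorm (x - y)), y | exists 0; exact: lb0].
Qed.

Lemma edist_le x y Q : Q y -> edist x Q <= enorm (x - y).
Proof. by move=> Qy; apply: ge_inf; [exists 0; exact: lb0|exists y]. Qed.

Lemma edist_ge0 x Q : Q !=set0 -> 0 <= edist x Q.
Proof. by move=> [y Qy]; apply: lb_le_inf => //; exists (enorm (x - y)), y. Qed.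

Lemma edist_xx x Q : Q x -> edist x Q = 0.
Proof.
move=> Qx; apply/eqP; rewrite eq_le edist_ge0 ?andbT; last by exists x.
by rewrite (le_trans (edist_le _ Qx))// subrr enorm0.
Qed.

Let edist_ub P Q : P !=set0 -> Q !=set0 -> compact P ->
  has_sup [set edist x Q | x in P].
Proof.
move=> [x Px] [y Qy] /enorm_bounded[M PM]; split; first by exists (edist x Q), x.
exists (M + enorm y) => _ [z Pz <-]; rewrite (le_trans (edist_le _ Qy))//.
by rewrite (le_trans (ler_enormD _ _))// enormN lerD2r PM.
Qed.

Lemma edist_hausdorff x P Q : convex_body P -> convex_body Q -> P x ->
  edist x Q <= hausdorff_dist P Q.
Proof.
move=> [P0 [cP _]] [Q0 _] Px; rewrite /hausdorff_dist le_max.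
by rewrite (ub_le_sup (proj2 (edist_ub P0 Q0 cP)))//; exists x.
Qed.

Lemma hausdorff_distC P Q : hausdorff_dist P Q = hausdorff_dist Q P.
Proof. exact: maxC. Qed.

Lemma hausdorff_dist_le P Q (c : R) : P !=set0 -> Q !=set0 ->
  (forall x, P x -> edist x Q <= c) -> (forall y, Q y -> edist y P <= c) ->
  hausdorff_dist P Q <= c.
Proof.
move=> [x Px] [y Qy] Pc Qc; rewrite /hausdorff_dist ge_max; apply/andP; split.
  by apply: ge_sup => [|_ [z /Pc ? <-]//]; exists (edist x Q), x.
by apply: ge_sup => [|_ [z /Qc ? <-]//]; exists (edist y P), y.
Qed.

Lemma hausdorff_distxx P : convex_body P -> hausdorff_dist P P = 0.
Proof.
move=> bP; have [[x Px] _] := bP; apply/eqP; rewrite eq_le; apply/andP; split.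
  by apply: hausdorff_dist_le => [||y Py|y Py]; [exists x|exists x|rewrite edist_xx|rewrite edist_xx].
by rewrite -(edist_xx Px) edist_hausdorff.
Qed.

Lemma hausdorff_dist_subset P Q : convex_body P -> convex_body Q ->
  hausdorff_dist P Q = 0 -> P `<=` Q.
Proof.
move=> bP bQ PQ0 x Px; have [Q0 [/compact_closed_rV cQ _]] := bQ.
have xQ : edist x Q <= 0 by rewrite -PQ0 edist_hausdorff.
apply: cQ => U /nbhs_ballP[e/= e0 xeU].
have : inf [set enorm (x - y) | y in Q] < e by exact: le_lt_trans e0.
move=> /(inf_lt (proj1 (edist_has_inf x Q0)))[_ [y Qy <-] xye].
exists y; split => //; apply: xeU; split => // i j; rewrite ord1.
by apply: le_lt_trans xye; have := coord_le_enorm (x - y) j; rewrite !mxE.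
Qed.

Lemma hausdorff_dist_triangle Q P S :
  convex_body P -> convex_body Q -> convex_body S ->
  hausdorff_dist P S <= hausdorff_dist P Q + hausdorff_dist Q S.
Proof.
have tri A B C x : convex_body A -> convex_body B -> convex_body C -> A x ->
    edist x C <= hausdorff_dist A B + hausdorff_dist B C.
  move=> bA bB bC Ax; rewrite -lerBlDr (le_trans _ (edist_hausdorff bA bB Ax))//.
  have [[b Bb] _] := bB; apply: lb_le_inf; first by exists (enorm (x - b)), b.
  move=> _ [y By <-]; rewrite lerBlDr.
  rewrite (le_trans _ (lerD (lexx _) (edist_hausdorff bB bC By)))// -lerBlDl.
  have [[c Cc] _] := bC; apply: lb_le_inf; first by exists (enorm (y - c)), c.
  move=> _ [z Cz <-]; rewrite lerBlDl (le_trans (edist_le _ Cz))//.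
  exact: ler_enorm_distD.
move=> bP bQ bS; apply: hausdorff_dist_le; [by case: bP|by case: bS| |].
  by move=> x; exact: tri.
by move=> x Sx; rewrite addrC (hausdorff_distC P) (hausdorff_distC Q) tri.
Qed.

End hausdorff_dist_theory.

Section delzant.
Context {R : realType} {n : nat}.
Implicit Types (x v w : 'rV[R]_n) (u : 'rV[int]_n) (P F E : set 'rV[R]_n).

Definition polytope P := exists (m : nat) (p : 'I_m -> 'rV[R]_n),
  P = [set x | exists a : 'I_m -> R,
    [/\ forall i, 0 <= a i, \sum_i a i = 1 & x = \sum_i a i *: p i]].

Definition face P F := F !=set0 /\ exists c : 'rV[R]_n,
  F = [set x | P x /\ forall y, P y -> dot c y <= dot c x].

Definition segment v w : set 'rV[R]_n :=
  [set (1 - t) *: v + t *: w | t in `[0, 1]%classic].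

Definition vertex P v := face P [set v].

(* The faces of dimension one of a polytope are its faces that are
   nondegenerate segments; P itself qualifies when n = 1 (take c = 0). *)
Definition edge P E := face P E /\ exists v w, v != w /\ E = segment v w.

Definition int_vect u : 'rV[R]_n := map_mx intr u.

Definition rational_direction E := exists2 u, u != 0 &
  forall x y, E x -> E y -> exists t : R, y - x = t *: int_vect u.

Definition primitive u := (\big[gcdn/0]_(i < n) `|u ord0 i|)%N = 1%N.

Definition primitive_edge_vector P v u :=
  primitive u /\ exists2 t : R, 0 < t & edge P (segment v (v + t *: int_vect u)).

(* The rows of M form a basis of Z^n. *)
Definition Z_basis (M : 'M[int]_n) :=
  forall z : 'rV[int]_n, exists! c : 'rV[int]_n, z = c *m M.

Definition delzant P :=
  [/\ polytope P, P° !=set0,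
      forall v, vertex P v -> ([set E | edge P E /\ E v] #= `I_n)%card,
      forall E, edge P E -> rational_direction E &
      forall v, vertex P v -> exists2 M : 'M[int]_n, Z_basis M &
        [set u | primitive_edge_vector P v u] = [set row i M | i in setT]].

End delzant.

Section bodies.
Variables (R : realType) (n : nat).

(* C(n) with the Hausdorff distance. *)
Definition bodies : Type := set_type (@convex_body R n).

HB.instance Definition _ := Choice.copy bodies (set_type (@convex_body R n)).

Definition bodies_dist (P Q : bodies) : R := hausdorff_dist (\val P) (\val Q).

Let bodiesP (P : bodies) : convex_body (\val P). Proof. exact: set_valP. Qed.

Let dHxx P : bodies_dist P P = 0. Proof. exact: hausdorff_distxx. Qed.

Let dHC P Q : bodies_dist P Q = bodies_dist Q P. Proof. exact: hausdorff_distC. Qed.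

Let dH_positivity P Q : bodies_dist P Q = 0 -> P = Q.
Proof.
move=> PQ0; apply/val_inj/seteqP; split; apply: hausdorff_dist_subset => //.
by rewrite hausdorff_distC.
Qed.

Let dH_triangle Q P S : bodies_dist P S <= bodies_dist P Q + bodies_dist Q S.
Proof. exact: hausdorff_dist_triangle. Qed.

HB.instance Definition _ :=
  isMetric.Build R bodies dHxx dH_positivity dHC dH_triangle.

Lemma bodies_mdistE (P Q : bodies) :
  mdist P Q = hausdorff_dist (\val P) (\val Q) :> R.
Proof. by []. Qed.

(* C_p(n) with one extra point None, which stands for the class 0 of all
   non-proper bodies, under the symmetric difference distance. *)
Definition proper_bodies0 : Type := option (set_type (@proper_convex_body R n)).

HB.instance Definition _ :=
  Choice.copy proper_bodies0 (option (set_type (@proper_convex_body R n))).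

Definition proper_bodies0_dist (p q : proper_bodies0) : R :=
  match p, q with
  | Some P, Some Q => symm_diff_dist (\val P) (\val Q)
  | Some P, None | None, Some P => fine (vol (\val P))
  | None, None => 0
  end.

Let carrier (p : proper_bodies0) : set 'rV[R]_n :=
  if p is Some P then \val P else set0.

Let dVE p q : proper_bodies0_dist p q = symm_diff_dist (carrier p) (carrier q).
Proof.
case: p q => [P|] [Q|] //=.
- by rewrite symm_diff_dist0.
- by rewrite symm_diff_distC symm_diff_dist0.
- by rewrite symm_diff_distxx.
Qed.

Let carrier_compact p : compact (carrier p).
Proof. by case: p => [P|]; [have [[_ []]] := set_valP P|exact: compact0]. Qed.

Let dVxx p : proper_bodies0_dist p p = 0. Proof. by rewrite dVE symm_diff_distxx. Qed.

Let dVC p q : proper_bodies0_dist p q = proper_bodies0_dist q p. Proof. by rewrite !dVE symm_diff_distC. Qed.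

Let dV_positivity p q : proper_bodies0_dist p q = 0 -> p = q.
Proof.
have vol_neq0 (P : set_type (@proper_convex_body R n)) : fine (vol (\val P)) != 0.
  have [[_ [cP _]] [x /nbhs_ballP[e/= e0 xeP]]] := set_valP P.
  rewrite gt_eqF// fine_gt0// (ball_vol_gt0 e0 xeP) ?ltey_eq ?compact_vol_fin//.
  exact: measurable_compact.
case: p q => [P|] [Q|] //=; last 2 first.
- by move/eqP; rewrite (negbTE (vol_neq0 P)).
- by move/eqP; rewrite (negbTE (vol_neq0 Q)).
move=> PQ0; congr Some; apply/val_inj/seteqP.
by split; apply: symm_diff_dist_subset; rewrite // 1?symm_diff_distC//; exact: set_valP.
Qed.

Let dV_triangle q p r : proper_bodies0_dist p r <= proper_bodies0_dist p q + proper_bodies0_dist q r.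
Proof. by rewrite !dVE symm_diff_dist_triangle. Qed.

HB.instance Definition _ :=
  isMetric.Build R proper_bodies0 dVxx dV_positivity dVC dV_triangle.

Lemma proper_bodies0_mdistE (p q : proper_bodies0) :
  mdist p q = proper_bodies0_dist p q.
Proof. by []. Qed.

(* D(n) and C_p(n) as subsets of the two metric spaces above; as types they carry
   the subspace topology. *)
Definition proper_H : set bodies := [set P | proper_convex_body (\val P)].
Definition delzant_H : set bodies := [set P | delzant (\val P)].
Definition proper_V : set proper_bodies0 := range Some.
Definition delzant_V : set proper_bodies0 := Some @` [set P | delzant (\val P)].

End bodies.
Arguments proper_H : clear implicits.
Arguments delzant_H : clear implicits.
Arguments proper_V : clear implicits.
Arguments delzant_V : clear implicits.

Definition path_connected (R : realType) (T : topologicalType) :=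
  forall x y : T, exists gamma : R -> T,
    [/\ {within `[0, 1], continuous gamma}, gamma 0 = x & gamma 1 = y].

Definition locally_compact_space (T : topologicalType) := locally_compact [set: T].

Definition complete_space (T : uniformType) :=
  forall F : set_system T, ProperFilter F -> cauchy F -> exists x : T, F --> x.

(* Y is a completion of its subset A, taken with the restricted metric: Y is
   complete and the (isometric) inclusion of A has dense image. *)
Definition is_completion_of (R : realType) (Y : metricType R) (A : set Y) :=
  complete_space Y /\ dense A.

(* Main.v *)
Require Import Defs.
From HB Require Import structures.
From mathcomp Require Import all_boot all_order all_algebra.
From mathcomp Require Import all_classical all_reals all_analysis.
From mathcomp Require Import measurable_realfun.
From mathcomp Require Import ring lra zify.

Set Implicit Arguments.
Unset Strict Implicit.
Unset Printing Implicit Defensive.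

Import Order.TTheory GRing.Theory Num.Theory.
Import numFieldNormedType.Exports.

Local Open Scope classical_set_scope.
Local Open Scope ring_scope.

(** The heart of the matter is a supply of Delzant polytopes with prescribed fine
    normal fans. Start with the fan of a cube, which is smooth, and subdivide it only
    at sums [u + u'] of two rays of a common cone. This keeps the fan smooth, and it
    amounts to cutting off a face of codimension two of the polytope carrying the fan.
    For an integer vector [a], choosing each time a pair with [a u > 0 > a u'] and
    [a u - a u'] maximal makes the procedure stop with a fan all of whose cones lie on
    one side of the hyperplane orthogonal to [a]. Treating finitely many hyperplanes
    one after the other gives [fan_resolution]. If [D] carries such a fan and [K] is a
    convex body whose normal fan is coarser, the Minkowski sum [K + D] carries the same
    fan as [D] ([fan_polytopeD]), and polytopes that carry a smooth fan are Delzant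
    ([fan_delzant]).

    Density: a convex body is close to the hull [Q] of finitely many rational points;
    if the fan of [D] resolves the differences of these points, then [Q + e D] is
    Delzant for all [e > 0] ([delzant_dense]). Path-connectedness: for Delzant [P] and
    [Q] let the fan of [D] resolve the edge directions of both. A polytope is the
    intersection of the cones generated by the edges at its vertices
    ([edges_minimum]), so the normal fans of [P] and [Q] are coarser than that of [D],
    and [(1 - t) P + t Q + t (1 - t) D] is a path of Delzant polytopes from [P] to
    [Q] ([delzant_path]).

    These constructions are continuous for the Hausdorff distance. Near a proper body
    a small Hausdorff distance forces a small symmetric difference, because each of
    two close bodies lies in a small dilation of the other about a common interior
    point ([symm_diff_dist_close]); this uses the effect of homotheties on the Lebesgue
    measure. So both topologies are covered.

    The Hausdorff space is complete by a compactness argument applied to shrinking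
    thickenings ([hausdorff_fast_limit]). For the symmetric difference distance, the
    limit of a fast Cauchy sequence is the closure of the union of the intersections
    of its tails, unless all these intersections are null, in which case the limit is
    the additional point ([volume_fast_limit]). This needs that convex sets of positive
    volume have interior points, that they are bounded when their volume is finite,
    and that taking the closure does not change their volume.

    Finally, in dimension at least two a slightly sheared cube with an irrational edge
    direction is not Delzant, although by density it is a limit of Delzant polytopes.
    Hence no neighbourhood of the cube in the space of Delzant polytopes is compact
    ([metric_not_locally_compact], [non_delzant_near]). *)

(** * Scalar products of real and of integer vectors *)

Section pairings.
Context {R : realType} {n : nat}.
Implicit Types (x y z : 'rV[R]_n) (u w : 'rV[int]_n).

Lemma dotDr x y z : dot x (y + z) = dot x y + dot x z.
Proof. by rewrite dotC dotD !(dotC _ x). Qed.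

Lemma dotZr (a : R) x y : dot x (a *: y) = a * dot x y.
Proof. by rewrite dotC dotZ dotC. Qed.

Lemma dotN x y : dot (- x) y = - dot x y.
Proof. by rewrite -scaleN1r dotZ mulN1r. Qed.

Lemma dotNr x y : dot x (- y) = - dot x y.
Proof. by rewrite dotC dotN dotC. Qed.

Lemma dotBr x y z : dot x (y - z) = dot x y - dot x z.
Proof. by rewrite dotDr dotNr. Qed.

Lemma dotBl x y z : dot (x - y) z = dot x z - dot y z.
Proof. by rewrite dotD dotN. Qed.

Lemma dot0l x : dot 0 x = 0.
Proof. by rewrite -(scale0r x) dotZ mul0r. Qed.

Lemma dot0r x : dot x 0 = 0.
Proof. by rewrite dotC dot0l. Qed.

Lemma dot_suml (I : finType) (P : pred I) (f : I -> 'rV[R]_n) x :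
  dot (\sum_(i | P i) f i) x = \sum_(i | P i) dot (f i) x.
Proof.
elim/big_rec2: _ => [|i y1 y2 _ IH]; first exact: dot0l.
by rewrite dotD IH.
Qed.

Lemma dot_sumr (I : finType) (P : pred I) (f : I -> 'rV[R]_n) x :
  dot x (\sum_(i | P i) f i) = \sum_(i | P i) dot x (f i).
Proof. by rewrite dotC dot_suml; apply: eq_bigr => i _; rewrite dotC. Qed.

Lemma dot_eq0 x : dot x x = 0 -> x = 0.
Proof.
move=> xx; apply/rowP => i; apply/eqP; rewrite mxE -normr_eq0 eq_le normr_ge0 andbT.
by rewrite -(sqrtr0 R) -xx coord_le_enorm.
Qed.

Definition zdot u w : int := \sum_i u ord0 i * w ord0 i.

Lemma zdotC u w : zdot u w = zdot w u.
Proof. by apply: eq_bigr => i _; rewrite mulrC. Qed.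

Lemma zdotDl u u' w : zdot (u + u') w = zdot u w + zdot u' w.
Proof. by rewrite -big_split; apply: eq_bigr => i _; rewrite mxE mulrDl. Qed.

Lemma zdotDr u w w' : zdot u (w + w') = zdot u w + zdot u w'.
Proof. by rewrite zdotC zdotDl !(zdotC u). Qed.

Lemma zdotNl u w : zdot (- u) w = - zdot u w.
Proof. by rewrite /zdot -sumrN; apply: eq_bigr => i _; rewrite mxE mulNr. Qed.

Lemma zdotNr u w : zdot u (- w) = - zdot u w.
Proof. by rewrite zdotC zdotNl zdotC. Qed.

Lemma zdotBr u w w' : zdot u (w - w') = zdot u w - zdot u w'.
Proof. by rewrite zdotDr zdotNr. Qed.

Lemma zdotZl (a : int) u w : zdot (a *: u) w = a * zdot u w.
Proof. by rewrite /zdot mulr_sumr; apply: eq_bigr => i _; rewrite mxE mulrA. Qed.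

Lemma zdotZr (a : int) u w : zdot u (a *: w) = a * zdot u w.
Proof. by rewrite zdotC zdotZl zdotC. Qed.

Lemma zdot_delta u i : zdot u (delta_mx ord0 i) = u ord0 i.
Proof.
rewrite /zdot (bigD1 i)//= mxE !eqxx mulr1 big1 ?addr0// => j ji.
by rewrite mxE (negbTE ji) andbF mulr0.
Qed.

Lemma int_vectD u w : int_vect (u + w) = int_vect u + int_vect w :> 'rV[R]_n.
Proof. exact: map_mxD. Qed.

Lemma int_vectN u : int_vect (- u) = - int_vect u :> 'rV[R]_n.
Proof. exact: map_mxN. Qed.

Lemma int_vectB u w : int_vect (u - w) = int_vect u - int_vect w :> 'rV[R]_n.
Proof. by rewrite int_vectD int_vectN. Qed.

Lemma int_vectZ (a : int) u : int_vect (a *: u) = a%:~R *: int_vect u :> 'rV[R]_n.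
Proof. exact: map_mxZ. Qed.

Lemma dot_int u w : dot (int_vect u) (int_vect w) = (zdot u w)%:~R :> R.
Proof. by rewrite /zdot rmorph_sum; apply: eq_bigr => i _; rewrite !mxE rmorphM. Qed.

End pairings.

(** * Smooth fans carried by polytopes, and their resolution *)

Section fans.
Context {R : realType} {n : nat}.
Local Notation iv u := (@int_vect R n u).

(** A complete smooth fan with a polytope carrying it, described cone by cone:
    [N s] lists the rays of the maximal cone [s] (inner facet normals), [E s] is the
    dual basis (edge directions), whose integrality is the smoothness of the cone,
    and [v s] is the vertex with normal cone [s]. The ray [N s i] attains its
    minimum over the vertices exactly at those whose cone contains it
    ([fan_min], [fan_eq]); [fan_adj] says that each wall of a cone is crossed into
    another cone. Several indices may describe the same cone. *)
Record fan_polytope (I : finType) (v : I -> 'rV[R]_n)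
    (N E : I -> 'I_n -> 'rV[int]_n) : Prop := FanPolytope {
  fan_nonempty : (0 < #|I|)%N;
  fan_dual : forall s i j, zdot (N s i) (E s j) = (i == j)%:R;
  fan_min : forall s t i, dot (iv (N s i)) (v s) <= dot (iv (N s i)) (v t);
  fan_eq : forall s t i, dot (iv (N s i)) (v t) = dot (iv (N s i)) (v s) ->
    exists j, N t j = N s i;
  fan_adj : forall s i, exists t,
    (forall j, j != i -> exists k, N t k = N s j) /\ forall k, N t k <> N s i }.

(** The points [q s] support a convex body whose normal fan is coarser than the fan
    [N]: on the whole cone [s] its support function is given by the point [q s]. For
    [q = v] this is [fan_min]. *)
Definition adapted (I : finType) (N : I -> 'I_n -> 'rV[int]_n) (q : I -> 'rV[R]_n) :=
  forall s t i, dot (iv (N s i)) (q s) <= dot (iv (N s i)) (q t).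

(** The hyperplane orthogonal to [a] does not cut the interior of any cone: the fan
    refines the decomposition of space that the hyperplane defines. *)
Definition resolved (I : finType) (N : I -> 'I_n -> 'rV[int]_n) (a : 'rV[int]_n) :=
  forall s, (forall i, 0 <= zdot a (N s i)) \/ (forall i, zdot a (N s i) <= 0).

(** Adding a body with a coarser normal fan (Minkowski sum) changes neither the fan
    nor its smoothness: strict inequalities come from [v], and weak ones add up. *)
Lemma fan_polytopeD I v N E q : @fan_polytope I v N E -> adapted N q ->
  fan_polytope (fun s => v s + q s) N E.
Proof.
case=> I0 NE vmin veq adj qmin; split=> // [s t i|s t i].
  by rewrite !dotDr lerD.
rewrite !dotDr => vq; apply: veq; have := vmin s t i; have := qmin s t i.
move: vq; lra.
Qed.

Lemma adaptedD I N q q' : @adapted I N q -> adapted N q' ->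
  adapted N (fun s => q s + q' s).
Proof. by move=> qN q'N s t i; rewrite !dotDr lerD. Qed.

Lemma adaptedZ I N q (a : R) : 0 <= a -> @adapted I N q ->
  adapted N (fun s => a *: q s).
Proof. by move=> a0 qN s t i; rewrite !dotZr ler_wpM2l. Qed.

Lemma fan_polytopeZ I v N E (a : R) : 0 < a -> @fan_polytope I v N E ->
  fan_polytope (fun s => a *: v s) N E.
Proof.
move=> a0 [I0 NE vmin veq adj]; split=> // [s t i|s t i].
  by rewrite !dotZr ler_pM2l.
by rewrite !dotZr => /(mulfI (lt0r_neq0 a0)); exact: veq.
Qed.

Lemma fan_inj I v N E : @fan_polytope I v N E -> forall s i j, N s i = N s j -> i = j.
Proof.
move=> FP s i j Nij; have := fan_dual FP s i j; rewrite Nij (fan_dual FP) eqxx.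
by case: (eqVneq i j).
Qed.

Lemma fan_dual_real I v N E : @fan_polytope I v N E ->
  forall s i j, dot (iv (N s i)) (iv (E s j)) = (i == j)%:R.
Proof. by move=> FP s i j; rewrite dot_int (fan_dual FP); case: (_ == _). Qed.

(** The unit cube, the starting point of the resolution: its cones are the orthants,
    indexed by the vertices of the cube. *)
Lemma cube_fan_polytope : exists N E,
  @fan_polytope {ffun 'I_n -> bool} (fun s => \row_k (s k)%:R) N E.
Proof.
pose N (s : {ffun 'I_n -> bool}) k : 'rV[int]_n := (-1) ^+ (s k) *: delta_mx ord0 k.
have ivN s k x : dot (iv (N s k)) x = (-1) ^+ (s k) * x ord0 k.
  rewrite /dot (bigD1 k)//= big1 ?addr0 => [|i /negbTE ik].
    by rewrite !mxE !eqxx mulr1; case: (s k) => /=.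
  by rewrite !mxE ik andbF mulr0 mul0r.
have Ninj s t i : (N t i = N s i) <-> t i = s i.
  split=> [|sti]; last by rewrite /N sti.
  move=> /rowP/(_ i); rewrite !mxE !eqxx !mulr1.
  by case: (t i) (s i) => [] [].
exists N, N; split.
- by apply/card_gt0P; exists [ffun=> true].
- move=> s i j; rewrite zdotZr zdot_delta !mxE eqxx /= eq_sym.
  by have [->|_] := eqVneq i j; rewrite ?mulr0// mulr1 -expr2 sqrr_sign.
- by move=> s t i; rewrite !ivN !mxE; case: (s i) (t i) => [] [] /=; lra.
- move=> s t i; rewrite !ivN !mxE => st; exists i; apply/Ninj; move: st.
  by case: (s i) (t i) => [] [] //=; lra.
- move=> s i; exists [ffun k => if k == i then ~~ s i else s k]; split=> [j ji|k].
    by exists j; apply/Ninj; rewrite ffunE (negbTE ji).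
  have [->|ki] := eqVneq k i; first by move/Ninj; rewrite ffunE eqxx; case: (s i).
  move=> /rowP/(_ k); rewrite !mxE !eqxx (negbTE ki) mulr1 mulr0.
  by case: (_ k).
Qed.

(** A strict inequality depending affinely on [e] persists for small [e]; finitely
    many can be preserved at once. The value of [e] is the inverse of a sum that
    dominates each ratio [|c j| / a j]. *)
Lemma small_perturbation (J : finType) (a c : J -> R) :
  exists2 e : R, 0 < e & forall j, 0 < a j -> 0 < a j + e * c j.
Proof.
pose S := \sum_j `|c j| / `|a j|.
have S0 : 0 <= S by apply: sumr_ge0 => j _; rewrite divr_ge0.
have S1 : 0 < 1 + S by rewrite ltr_pwDl.
exists (1 + S)^-1; first by rewrite invr_gt0.
move=> j aj.
have cS : `|c j| / a j <= S.
  rewrite /S (bigD1 j)//= (gtr0_norm aj) lerDl.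
  by apply: sumr_ge0 => k _; rewrite divr_ge0.
have : `|c j| < a j * (1 + S).
  by rewrite mulrC -ltr_pdivrMr// (le_lt_trans cS)// ltrDr.
rewrite -ltr_pdivrMr// => caj.
have : - c j / (1 + S) <= `|c j| / (1 + S).
  by rewrite ler_pM2r ?invr_gt0// -normrN ler_norm.
move: caj; rewrite mulNr (mulrC _^-1); lra.
Qed.

(** Star subdivision of a fan at the sum of two rays [u] and [u'] of a common cone. On
    polytopes this cuts off the face of codimension two where [u] and [u'] are
    minimal, by a hyperplane of normal [u + u'] at small depth. Each cone containing
    [u] and [u'] is split in two, by replacing one of them with [u + u']; the dual
    basis changes by an integral transvection, so the fan stays smooth. After the
    subdivision [u] and [u'] no longer lie in a common cone. *)
Lemma fan_blow_up (I : finType) v N E (s0 : I) (i0 j0 : 'I_n) :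
  @fan_polytope I v N E -> i0 != j0 ->
  let u := N s0 i0 in let u' := N s0 j0 in
  exists v' N' E', @fan_polytope (I * bool : finType)%type v' N' E' /\
  forall s', exists s,
    (forall k, (exists m, N' s' k = N s m) \/
       [/\ N' s' k = u + u', exists i, N s i = u & exists j, N s j = u']) /\
    ~ ((exists i, N' s' i = u) /\ (exists j, N' s' j = u')).
Proof.
move=> FP ij0 u u'; set w := u + u'.
have [I0 dual vmin veq adj] := FP.
have Ninj := fan_inj FP.
have uu' : u <> u' by move/Ninj/eqP; rewrite (negbTE ij0).
pose idx s f : option 'I_n := [pick i | N s i == f].
(* When the cone z.1 contains u and u', star z is the pair of the positions of
   the ray replaced by u + u' and of the ray that is kept; the boolean says which
   of u and u' is replaced. Other cones are merely duplicated. *)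
pose star (z : I * bool) : option ('I_n * 'I_n) :=
  match idx z.1 u, idx z.1 u' with
  | Some i, Some j => Some (if z.2 then (i, j) else (j, i)) | _, _ => None end.
have starS z p q : star z = Some (p, q) ->
    [/\ N z.1 p = (if z.2 then u else u'), N z.1 q = (if z.2 then u' else u) & p != q].
  rewrite /star /idx; case: pickP => // i /eqP Ni; case: pickP => // j /eqP Nj.
  have ij : i != j by apply/eqP => ij; move: Ni; rewrite ij Nj => /esym.
  by case: z.2 => -[<- <-]; split => //; rewrite eq_sym.
have starN z : star z = None -> (forall i, N z.1 i <> u) \/ (forall i, N z.1 i <> u').
  rewrite /star /idx; case: pickP => [i _|Nu _]; last first.
    by left => i /eqP; rewrite Nu.
  case: pickP => // Nu _; by right => j /eqP; rewrite Nu.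
have star_ex z : (exists i, N z.1 i = u) -> (exists j, N z.1 j = u') ->
    exists p q, star z = Some (p, q).
  move=> [i Ni] [j Nj]; case E1 : (star z) => [[p q]|]; first by exists p, q.
  by have [/(_ i)|/(_ j)] := starN _ E1.
have starw z p q : star z = Some (p, q) -> w = N z.1 p + N z.1 q.
  by case/starS=> -> -> _; rewrite /w; case: z.2 => //; rewrite addrC.
have starP z p q : star z = Some (p, q) ->
    (exists i, N z.1 i = u) /\ (exists j, N z.1 j = u').
  move=> /starS[Np Nq _]; case: z.2 Np Nq => Np Nq; split; by [exists p|exists q].
(* If u + u' were a ray of some cone t, the minimum of u + u' over the vertices
   would be attained at v t, hence so would those of u and u'; both would then be
   rays of t, and u + u' would depend linearly on two other rays of t. *)
have wnew t k : N t k <> w.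
  move=> Nk.
  have le1 := vmin t s0 k; rewrite Nk in le1.
  have le2 := vmin s0 t i0; have le3 := vmin s0 t j0.
  rewrite -/u -/u' in le2 le3.
  rewrite int_vectD !dotD in le1.
  have [i Ni] : exists i, N t i = u by apply: (veq s0); rewrite -/u; lra.
  have [j Nj] : exists j, N t j = u' by apply: (veq s0); rewrite -/u'; lra.
  have ij : i != j by apply/eqP => ij; apply: uu'; rewrite -Ni -Nj ij.
  have := dual t k i; rewrite Nk zdotDl -Ni -Nj !dual eqxx eq_sym (negbTE ij) addr0.
  have := dual t k j; rewrite Nk zdotDl -Ni -Nj !dual eqxx (negbTE ij) add0r.
  by case: (eqVneq k j) (eqVneq k i) => [->|_] [ji|_] //; rewrite ji eqxx in ij.
(* The depth e of the cut: small enough to keep all strict inequalities. *)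
have [e e0 [e1 e2]] : exists2 e : R, 0 < e &
    (forall s t i k, dot (iv (N s i)) (v s) < dot (iv (N s i)) (v t) ->
      dot (iv (N s i)) (v s) < dot (iv (N s i)) (v t + e *: iv (E t k))) /\
    (forall s t, dot (iv w) (v s) < dot (iv w) (v t) ->
      dot (iv w) (v s) + e < dot (iv w) (v t)).
  pose a (z : (I * I * 'I_n * 'I_n) + (I * I)) : R := match z with
    | inl z => dot (iv (N z.1.1.1 z.1.2)) (v z.1.1.2) - dot (iv (N z.1.1.1 z.1.2)) (v z.1.1.1)
    | inr z => dot (iv w) (v z.2) - dot (iv w) (v z.1) end.
  pose c (z : (I * I * 'I_n * 'I_n) + (I * I)) : R := match z with
    | inl z => dot (iv (N z.1.1.1 z.1.2)) (iv (E z.1.1.2 z.2))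
    | inr z => - 1 end.
  have [e e0 eP] := small_perturbation a c.
  exists e => //; split.
    move=> s t i k st; have := eP (inl (s, t, i, k)); rewrite /a /c /=.
    rewrite subr_gt0 => /(_ st); rewrite dotDr dotZr; lra.
  move=> s t st; have := eP (inr (s, t)); rewrite /a /c /= subr_gt0 => /(_ st); lra.
pose v' z := if star z is Some pq then v z.1 + e *: iv (E z.1 pq.1) else v z.1.
pose N' z k := if star z is Some pq then if k == pq.1 then w else N z.1 k else N z.1 k.
pose E' z k := if star z is Some pq then
  if k == pq.2 then E z.1 pq.2 - E z.1 pq.1 else E z.1 k else E z.1 k.
have dotNE := fan_dual_real FP.
have Esome z p q : star z = Some (p, q) ->
    [/\ v' z = v z.1 + e *: iv (E z.1 p), N' z p = w,
      forall k, k != p -> N' z k = N z.1 k, E' z q = E z.1 q - E z.1 p &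
      forall k, k != q -> E' z k = E z.1 k].
  move=> zE; rewrite /v' /N' /E' zE /=; split => //; rewrite ?eqxx// => k /negbTE -> //.
have Enone z : star z = None -> [/\ v' z = v z.1, N' z = N z.1 & E' z = E z.1].
  by move=> zE; rewrite /v' /N' /E' zE.
have old_ray_min z z' k : dot (iv (N z.1 k)) (v' z) = dot (iv (N z.1 k)) (v z.1) ->
    dot (iv (N z.1 k)) (v' z) <= dot (iv (N z.1 k)) (v' z') /\
    (dot (iv (N z.1 k)) (v' z') = dot (iv (N z.1 k)) (v' z) ->
      exists j, N' z' j = N z.1 k).
  move=> ->; case E1 : (star z') => [[p q]|]; last first.
    by have [-> -> _] := Enone _ E1; split; [exact: vmin|exact: veq].
  have [-> Np Nk _ _] := Esome _ _ _ E1.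
  have := vmin z.1 z'.1 k; rewrite le_eqVlt => /orP[/eqP mzE|lt1]; last first.
    have := e1 _ _ _ p lt1 => lt2; split; first exact: ltW.
    by move=> eq2; rewrite eq2 ltxx in lt2.
  have [j Nj] := veq z.1 z'.1 k (esym mzE).
  rewrite dotDr dotZr mzE -Nj dotNE; have [->|jp] := eqVneq j p; last first.
    by rewrite mulr0 addr0; split => // _; exists j; rewrite Nk.
  by rewrite mulr1; split; [rewrite lerDl ltW|move/eqP; rewrite -subr_eq0 addrAC subrr add0r gt_eqF].
have new_ray_min z z' p q : star z = Some (p, q) ->
    dot (iv w) (v' z) <= dot (iv w) (v' z') /\
    (dot (iv w) (v' z') = dot (iv w) (v' z) -> exists j, N' z' j = w).
  move=> zE; have [-> _ _ _ _] := Esome _ _ _ zE.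
  have wE z1 p1 q1 : star z1 = Some (p1, q1) ->
      dot (iv w) (v z1.1 + e *: iv (E z1.1 p1)) = dot (iv w) (v z1.1) + e.
    move=> z1E; rewrite dotDr dotZr {2}(starw _ _ _ z1E) int_vectD dotD !dotNE eqxx.
    by have [_ _] := starS _ _ _ z1E; rewrite eq_sym => /negbTE ->; rewrite addr0 mulr1.
  rewrite (wE _ _ _ zE).
  have [[i Ni] [j Nj]] := starP _ _ _ zE.
  have := vmin z.1 z'.1 i; have := vmin z.1 z'.1 j; rewrite Ni Nj => le1 le2.
  case E1 : (star z') => [[p1 q1]|].
    have [-> Np1 _ _ _] := Esome _ _ _ E1; rewrite (wE _ _ _ E1).
    have [[i1 Ni1] [j1 Nj1]] := starP _ _ _ E1.
    have := vmin z'.1 z.1 i1; have := vmin z'.1 z.1 j1; rewrite Ni1 Nj1 => le3 le4.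
    split; last by exists p1.
    rewrite lerD2r !int_vectD !dotD; lra.
  have [-> _ _] := Enone _ E1.
  have lt1 : dot (iv w) (v z.1) < dot (iv w) (v z'.1).
    rewrite int_vectD !dotD lt_neqAle lerD// andbT; apply/eqP => eq1.
    have [] := starN _ E1.
      have [i1 Ni1] : exists l, N z'.1 l = N z.1 i by apply: veq; rewrite Ni; lra.
      by move=> /(_ i1); rewrite Ni1 Ni.
    have [i1 Ni1] : exists l, N z'.1 l = N z.1 j by apply: veq; rewrite Nj; lra.
    by move=> /(_ i1); rewrite Ni1 Nj.
  have := e2 _ _ lt1 => lt2; split; first exact: ltW.
  by move=> eq2; rewrite eq2 ltxx in lt2.
have main z z' k : dot (iv (N' z k)) (v' z) <= dot (iv (N' z k)) (v' z') /\
    (dot (iv (N' z k)) (v' z') = dot (iv (N' z k)) (v' z) -> exists j, N' z' j = N' z k).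
  case E1 : (star z) => [[p q]|]; last first.
    have [vz Nz _] := Enone _ E1; rewrite Nz; apply: old_ray_min; rewrite vz//.
  have [vz Np Nk _ _] := Esome _ _ _ E1.
  have [->|kp] := eqVneq k p; first by rewrite Np; exact: new_ray_min E1.
  rewrite Nk//; apply: old_ray_min; rewrite vz dotDr dotZr dotNE (negbTE kp) mulr0 addr0//.
(* Across the facet of a ray k: the old neighbour serves, in the copy where the
   ray of the pair that it must keep survives; the two halves of a subdivided
   cone are neighbours of each other. *)
have adj' z k : exists t,
    (forall j, j != k -> exists l, N' t l = N' z j) /\ forall l, N' t l <> N' z k.
  have old b s f : f <> (if b then u else u') -> (exists l, N s l = f) ->
      exists l, N' (s, b) l = f.
    move=> fb [l Nl]; case E1 : (star (s, b)) => [[p q]|]; last first.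
      by have [_ -> _] := Enone _ E1; exists l.
    have [_ Np Nk _ _] := Esome _ _ _ E1; exists l; rewrite Nk//.
    by apply/eqP => lp; have [Np1 _ _] := starS _ _ _ E1; apply: fb; rewrite -Nl lp.
  have oldN b s f : f <> w -> (forall l, N s l <> f) -> forall l, N' (s, b) l <> f.
    move=> fw fN l; case E1 : (star (s, b)) => [[p q]|]; last first.
      by have [_ -> _] := Enone _ E1.
    have [_ Np Nk _ _] := Esome _ _ _ E1; have [->|lp] := eqVneq l p.
      by rewrite Np => /esym.
    by rewrite Nk.
  case E1 : (star z) => [[p q]|]; last first.
    have [_ -> _] := Enone _ E1.
    have [t [tk tN]] := adj z.1 k.
    have [/existsNP[b fb]|] := pselect (~ forall b : bool, exists j, N z.1 j = if b then u else u').
      exists (t, b); split; last by apply: oldN => //; exact: wnew.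
      move=> j jk; apply: old; last exact: tk.
      by move=> Njb; apply: fb; exists j.
    move=> /contrapT uz; exfalso.
    have [p [q]] := star_ex z (uz true) (uz false).
    by rewrite E1.
  have [_ Np Nk _ _] := Esome _ _ _ E1.
  have [Np1 Nq1 pq] := starS _ _ _ E1.
  have [kp|kp] := eqVneq k p.
    have [t [tk tN]] := adj z.1 p; exists (t, z.2); rewrite kp Np; split.
      move=> j jp; rewrite Nk//; apply: old; last exact: tk.
      by rewrite -Np1 => /Ninj /eqP; rewrite (negbTE jp).
    move=> l; case E2 : (star (t, z.2)) => [[p2 q2]|]; last first.
      by have [_ -> _] := Enone _ E2; exact: wnew.
    have [Np2 Nq2 _] := starS _ _ _ E2.
    by move: (tN p2); rewrite Np2 /= Np1.
  rewrite Nk//.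
  have [kq|kq] := eqVneq k q.
    have [p2 [q2 E2]] : exists p q, star (z.1, ~~ z.2) = Some (p, q).
      by have [? ?] := starP _ _ _ E1; apply: star_ex.
    have [Np2 Nq2 _] := starS _ _ _ E2.
    have [_ Npz Nkz _ _] := Esome _ _ _ E2.
    have p2q : p2 = q.
      by apply: (@Ninj z.1); rewrite Np2 Nq1 /=; case: (z.2).
    exists (z.1, ~~ z.2); rewrite kq; split.
      move=> j jq; have [jp|jp] := eqVneq j p.
        by exists p2; rewrite jp Np Npz.
      by rewrite Nk//; exists j; rewrite Nkz// p2q.
    move=> l; have [lp2|lp2] := eqVneq l p2.
      by rewrite lp2 Npz => /esym; exact: wnew.
    by rewrite Nkz//= => /Ninj/eqP; rewrite -p2q (negbTE lp2).
  have [t [tk tN]] := adj z.1 k.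
  exists (t, z.2); split; last by apply: oldN => //; exact: wnew.
  move=> j jk; have [jp|jp] := eqVneq j p.
    rewrite jp Np.
    have tpE : exists l, N t l = N z.1 p by apply: tk; rewrite eq_sym.
    have tqE : exists l, N t l = N z.1 q by apply: tk; rewrite eq_sym.
    have [p2 [q2 E2]] : exists p q, star (t, z.2) = Some (p, q).
      apply: star_ex; by move: tpE tqE; rewrite Np1 Nq1; case: (z.2).
    by have [_ Npz _ _ _] := Esome _ _ _ E2; exists p2.
  rewrite Nk//; apply: old; last exact: tk.
  by rewrite -Np1 => /Ninj /eqP; rewrite (negbTE jp).
exists v', N', E'; split.
  split => //.
  - by rewrite card_prod card_bool muln_gt0 I0.
  - move=> z i j; case E1 : (star z) => [[p q]|]; last by have [_ -> ->] := Enone _ E1.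
    have [_ Np Nk Eq Ek] := Esome _ _ _ E1.
    have [_ _ pq] := starS _ _ _ E1.
    have [->|ip] := eqVneq i p; last first.
      rewrite Nk//; have [->|jq] := eqVneq j q; last by rewrite Ek.
      by rewrite Eq zdotBr !dual (negbTE ip) subr0.
    rewrite Np (starw _ _ _ E1) zdotDl; have [->|jq] := eqVneq j q.
      by rewrite Eq !zdotBr !dual !eqxx (negbTE pq) eq_sym (negbTE pq) /= !subr0 sub0r addNr.
    by rewrite Ek// !dual [q == j]eq_sym (negbTE jq) addr0.
  - by move=> s t i; have [] := main s t i.
  - by move=> s t i; have [] := main s t i.
move=> z; exists z.1; case E1 : (star z) => [[p q]|]; last first.
  have [_ -> _] := Enone _ E1; split => [k|]; first by left; exists k.
  by move=> [ui uj]; have [p [q]] := star_ex z ui uj; rewrite E1.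
have [_ Np Nk _ _] := Esome _ _ _ E1; split => [k|].
  have [->|kp] := eqVneq k p; last by left; exists k; rewrite Nk.
  by right; have [] := starP _ _ _ E1.
have [Np1 Nq1 _] := starS _ _ _ E1.
have nop l : N' z l <> N z.1 p.
  have [->|lp] := eqVneq l p; first by rewrite Np => /esym; exact: wnew.
  by rewrite Nk// => /Ninj/eqP; rewrite (negbTE lp).
by move=> [[i Ni] [j Nj]]; move: (nop i) (nop j); rewrite Ni Nj Np1; case: (z.2).
Qed.

(** Bounds the spread of the values of [a] on pairs of rays that witness that the
    hyperplane of [a] cuts a cone; the spread is the termination measure of the
    resolution. *)
Definition gap_le (a : 'rV[int]_n) (m : int) (I : finType) (N : I -> 'I_n -> 'rV[int]_n) :=
  forall s i j, 0 < zdot a (N s i) -> zdot a (N s j) < 0 ->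
    zdot a (N s i) - zdot a (N s j) <= m.

(** Subdividing at [u + u'], where [u] and [u'] have values of opposite signs and
    maximal spread, removes this pair, and every new pair has a smaller spread since
    the value of [a] at [u + u'] lies strictly between those at [u] and [u']. So the
    pairs of maximal spread [m + 1], which the list [L] contains, disappear one by
    one. Hyperplanes that are already resolved remain so, as each new ray is a sum of
    two rays of a common cone. *)
Lemma fan_gap_step (a : 'rV[int]_n) (m : int) (L : seq ('rV[int]_n * 'rV[int]_n))
    (I : finType) v N E :
  @fan_polytope I v N E -> gap_le a (m + 1) N ->
  (forall s i j, 0 < zdot a (N s i) -> zdot a (N s j) < 0 ->
    zdot a (N s i) - zdot a (N s j) = m + 1 -> (N s i, N s j) \in L) ->
  exists (I' : finType) v' N' E', [/\ @fan_polytope I' v' N' E', gap_le a m N' &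
    forall a', resolved N a' -> resolved N' a'].
Proof.
elim: L I v N E => [|[u u'] L IH] I v N E FP gapN NL.
  exists I, v, N, E; split => // s i j Ni Nj.
  have := gapN s i j Ni Nj; rewrite le_eqVlt => /orP[/eqP/(NL _ _ _ Ni Nj)//|].
  by rewrite ltzD1.
have [[s0 [i0 [j0 [Ni0 Nj0 u0 u'0]]]]|noP] := pselect (exists s i j,
    [/\ N s i = u, N s j = u', 0 < zdot a u & zdot a u' < 0]); last first.
  apply: IH FP gapN _ => s i j Ni Nj Nij.
  have := NL _ _ _ Ni Nj Nij; rewrite inE => /orP[/eqP[Nu Nu']|//].
  by case: noP; exists s, i, j; split => //; rewrite -?Nu -?Nu'.
have ij0 : i0 != j0.
  by apply/eqP => ij; move: u'0; rewrite -Nj0 -ij Ni0 ltNge (ltW u0).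
have [v' [N' [E' [FP' sub]]]] := fan_blow_up s0 FP ij0.
rewrite Ni0 Nj0 in sub.
have [I' [v'' [N'' [E'' [FP'' gap'' res'']]]]] : exists (I' : finType) v'' N'' E'',
    [/\ @fan_polytope I' v'' N'' E'', gap_le a m N'' &
      forall a', resolved N' a' -> resolved N'' a'].
  have key s i j : 0 < zdot a (N' s i) -> zdot a (N' s j) < 0 ->
      zdot a (N' s i) - zdot a (N' s j) <= m \/
      exists t k l, [/\ N' s i = N t k, N' s j = N t l &
        ~ (N' s i = u /\ N' s j = u')].
    move=> pos neg; have [t [tP tN]] := sub s.
    have [[k Nk]|[Nw [k Nk] [k' Nk']]] := tP i; have [[l Nl]|[Nw' [l Nl] [l' Nl']]] := tP j.
    - right; exists t, k, l; split => // -[Niu Nju]; apply: tN; split; by [exists i|exists j].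
    - left; move: neg; rewrite Nw' !zdotDr => neg.
      move: (pos); rewrite Nk => posk; move: (u'0); rewrite -Nl' => negl.
      have := gapN t k l' posk negl; rewrite Nl'; move: u0; lia.
    - left; move: pos; rewrite Nw !zdotDr => pos.
      move: (neg); rewrite Nl => negl; move: (u0); rewrite -Nk => posk.
      have := gapN t k l posk negl; rewrite Nk; move: u'0; lia.
    - by move: pos neg; rewrite Nw Nw' => /ltW; rewrite leNgt => /negbTE ->.
  apply: IH FP' _ _ => [s i j pos neg|s i j pos neg eqm].
    have [/le_trans->//|[t [k [l [Nk Nl _]]]]] := key s i j pos neg.
      by rewrite lerDl.
    by rewrite Nk Nl gapN// -?Nk -?Nl.
  have [|[t [k [l [Nk Nl nuu']]]]] := key s i j pos neg.
    by rewrite eqm gerDl.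
  rewrite Nk Nl in pos neg eqm *.
  have := NL _ _ _ pos neg eqm; rewrite inE => /orP[/eqP[Nu Nu']|//].
  by case: nuu'; rewrite Nk Nl.
exists I', v'', N'', E''; split => // a' resN; apply: res'' => s.
have [t [tP _]] := sub s; have [res|res] := resN t; [left|right] => i.
  have [[k ->]|[-> [k <-] [l <-]]] := tP i; first exact: res.
  by rewrite zdotDr addr_ge0.
have [[k ->]|[-> [k <-] [l <-]]] := tP i; first exact: res.
by rewrite zdotDr -oppr_ge0 opprD addr_ge0// oppr_ge0.
Qed.

Lemma fan_gap (a : 'rV[int]_n) (m : nat) (I : finType) v N E :
  @fan_polytope I v N E -> gap_le a m%:Z N ->
  exists (I' : finType) v' N' E', [/\ @fan_polytope I' v' N' E', resolved N' a &
    forall a', resolved N a' -> resolved N' a'].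
Proof.
elim: m I v N E => [|m IH] I v N E FP gapN.
  exists I, v, N, E; split => // s.
  have [[i Ni]|noi] := pselect (exists i, 0 < zdot a (N s i)); last first.
    by right => i; rewrite leNgt; apply/negP => Ni; apply: noi; exists i.
  left => j; rewrite leNgt; apply/negP => Nj.
  by have := gapN s i j Ni Nj; move: Ni Nj; lia.
rewrite -addn1 PoszD in gapN.
pose L := [seq (N z.1.1 z.1.2, N z.1.1 z.2) | z <- enum {: I * 'I_n * 'I_n}].
have NL s i j : 0 < zdot a (N s i) -> zdot a (N s j) < 0 ->
    zdot a (N s i) - zdot a (N s j) = m%:Z + 1 -> (N s i, N s j) \in L.
  by move=> _ _ _; apply/mapP; exists (s, i, j); rewrite ?mem_enum.
have [I1 [v1 [N1 [E1 [FP1 gap1 res1]]]]] := fan_gap_step FP gapN NL.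
have [I2 [v2 [N2 [E2 [FP2 res2 res2']]]]] := IH _ _ _ _ FP1 gap1.
by exists I2, v2, N2, E2; split => // a' /res1; exact: res2'.
Qed.

(** Any finite arrangement of rational hyperplanes is refined by a smooth fan carried
    by a polytope (De Concini and Procesi). Only sums of two rays are used, so
    smoothness is automatic. *)
Theorem fan_resolution (A : seq 'rV[int]_n) : exists (I : finType) v N E,
  @fan_polytope I v N E /\ forall a, a \in A -> resolved N a.
Proof.
elim: A => [|a A [I [v [N [E [FP res]]]]]].
  have [N [E FP]] := cube_fan_polytope.
  by exists {ffun 'I_n -> bool}, (fun s : {ffun 'I_n -> bool} => \row_k (s k)%:R), N, E.
pose m := (\sum_s \sum_i `|zdot a (N s i)|)%N.
have Nm s i : (`|zdot a (N s i)| <= m)%N.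
  rewrite /m (bigD1 s)//= (bigD1 i)//= -addnA leq_addr//.
have gapN : gap_le a (m + m)%:Z N.
  move=> s i j Ni Nj; have := Nm s i; have := Nm s j; move: Ni Nj; lia.
have [I' [v' [N' [E' [FP' res1 res2]]]]] := fan_gap FP gapN.
exists I', v', N', E'; split => // a'; rewrite inE => /orP[/eqP ->//|/res].
exact: res2.
Qed.

End fans.

(** * Convex hulls of finite families *)

Section hulls.
Context {R : realType} {n : nat}.
Implicit Types (x y c : 'rV[R]_n) (A : set 'rV[R]_n).

Lemma convex_setP A : convex_set A <->
  forall x y (t : R), 0 <= t -> t <= 1 -> A x -> A y -> A (t *: x + (1 - t) *: y).
Proof.
split=> [cA x y t t0 t1 Ax Ay|cA x y t].
  have := cA x y (Itv01 t0 t1); rewrite !inE => /(_ Ax Ay).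
  by congr A.
rewrite !inE => Ax Ay; exact: cA.
Qed.

Definition hull (I : finType) (p : I -> 'rV[R]_n) : set 'rV[R]_n :=
  [set x | exists a : I -> R,
    [/\ forall i, 0 <= a i, \sum_i a i = 1 & x = \sum_i a i *: p i]].

Lemma hull_pt (I : finType) (p : I -> 'rV[R]_n) i : hull p (p i).
Proof.
exists (fun j => (j == i)%:R); split.
- by move=> j; case: (_ == _).
- by rewrite (bigD1 i)//= eqxx big1 ?addr0// => j /negbTE ->.
- rewrite (bigD1 i)//= eqxx scale1r big1 ?addr0// => j /negbTE ->.
  by rewrite scale0r.
Qed.

Lemma convex_hull (I : finType) (p : I -> 'rV[R]_n) : convex_set (hull p).
Proof.
apply/convex_setP => x y t t0 t1 [a [a0 a1 ->]] [b [b0 b1 ->]].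
exists (fun i => t * a i + (1 - t) * b i); split.
- by move=> i; rewrite addr_ge0// mulr_ge0// subr_ge0.
- by rewrite big_split/= -!mulr_sumr a1 b1 !mulr1 addrC subrK.
- rewrite !scaler_sumr -big_split/=; apply: eq_bigr => i _.
  by rewrite !scalerA -scalerDl.
Qed.

(** Convexity gives two-point combinations only; the sum over a list is normalised by
    its weight, and a list of weight zero contributes nothing. *)
Lemma convex_sum (I : finType) (p : I -> 'rV[R]_n) (a : I -> R) A : convex_set A ->
  (forall i, A (p i)) -> (forall i, 0 <= a i) -> \sum_i a i = 1 ->
  A (\sum_i a i *: p i).
Proof.
move=> /convex_setP cA Ap a0 a1.
have key (r : seq I) : 0 < \sum_(i <- r) a i ->
    A ((\sum_(i <- r) a i)^-1 *: \sum_(i <- r) a i *: p i).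
  elim: r => [|i r IH]; first by rewrite big_nil ltxx.
  rewrite !big_cons; set S := \sum_(j <- r) a j in IH *.
  have [S0|S0] := eqVneq S 0.
    have -> : \sum_(j <- r) a j *: p j = 0.
      rewrite big1_seq// => j /andP[_ jr].
      have : a j = 0.
        move/eqP: S0; rewrite /S big_seq psumr_eq0// => /allP/(_ j jr).
        by rewrite jr /= => /eqP.
      by move=> ->; rewrite scale0r.
    rewrite S0 !addr0 => ai; rewrite scalerA mulVf ?gt_eqF// scale1r; exact: Ap.
  have S1 : 0 < S by rewrite lt_neqAle eq_sym S0 sumr_ge0.
  move=> aS; have := cA (p i) _ (a i / (a i + S)) _ _ (Ap i) (IH S1).
  rewrite divr_ge0 ?(ltW aS)// ler_pdivrMr// mul1r lerDl (ltW S1) => /(_ isT isT).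
  congr A; rewrite scalerDr !scalerA mulrC; congr (_ + _ *: _).
  by field; rewrite !gt_eqF.
have := key (index_enum I); rewrite a1 invr1 scale1r; apply; exact: ltr01.
Qed.

Lemma hull_sub (I : finType) (p : I -> 'rV[R]_n) A : convex_set A ->
  (forall i, A (p i)) -> hull p `<=` A.
Proof. by move=> cA Ap x [a [a0 a1 ->]]; exact: convex_sum. Qed.

Lemma hull_ge (I : finType) (p : I -> 'rV[R]_n) c (m : R) :
  (forall i, m <= dot c (p i)) -> forall x, hull p x -> m <= dot c x.
Proof.
move=> mp x [a [a0 a1 ->]]; rewrite dot_sumr -[m]mul1r -a1 mulr_suml.
by apply: ler_sum => i _; rewrite dotZr ler_wpM2l.
Qed.

Lemma hull_le (I : finType) (p : I -> 'rV[R]_n) c (m : R) :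
  (forall i, dot c (p i) <= m) -> forall x, hull p x -> dot c x <= m.
Proof.
move=> mp x px; rewrite -lerN2 -dotN; apply: hull_ge px => i.
by rewrite dotN lerN2.
Qed.

Lemma hull_polytope (I : finType) (p : I -> 'rV[R]_n) : polytope (hull p).
Proof.
exists #|I|, (fun i => p (enum_val i)); apply/seteqP; split=> x [a [a0 a1 ->]].
  exists (fun i => a (enum_val i)); split => //.
    by rewrite -a1 [RHS](reindex_onto enum_val enum_rank)//= => [|i _];
      [under [RHS]eq_bigl do rewrite enum_valK eqxx|rewrite enum_rankK].
  rewrite (reindex_onto enum_val enum_rank)//= => [|i _]; last by rewrite enum_rankK.
  by under eq_bigl do rewrite enum_valK eqxx.
exists (fun i => a (enum_rank i)); split => //.
  by rewrite -a1 [RHS](reindex_onto enum_rank enum_val)//= => [|i _];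
    [under [RHS]eq_bigl do rewrite enum_rankK eqxx|rewrite enum_valK].
rewrite (reindex_onto enum_rank enum_val)//= => [|i _]; last by rewrite enum_valK.
by under eq_bigl do rewrite enum_rankK eqxx; apply: eq_bigr => i _; rewrite enum_rankK.
Qed.

Lemma polytope_hull A : polytope A -> exists m (p : 'I_m -> 'rV[R]_n), A = hull p.
Proof. by move=> [m [p ->]]; exists m, p. Qed.

(** The hull is the image of the standard simplex, compact as a closed part of a cube. *)
Lemma compact_hull (I : finType) (p : I -> 'rV[R]_n) : compact (hull p).
Proof.
pose F (a : 'rV[R]_#|I|) : 'rV[R]_n := \sum_i a ord0 (enum_rank i) *: p i.
pose G (a : 'rV[R]_#|I|) : R := \sum_i a ord0 (enum_rank i).
have cF : continuous F.
  apply: continuous_big => [|i _]; first exact: add_continuous.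
  move=> a.
  exact: (@cvgZ R 'rV[R]_n _ (nbhs a) (nbhs_filter a) _ _ _ _ (@coord_continuous R _ _ _ _ a) (cvg_cst _)).
have cG : continuous G.
  apply: continuous_big => [|i _]; first exact: add_continuous.
  exact: (@coord_continuous R).
pose B := [set a : 'rV[R]_#|I| | forall i, `[0, 1]%classic (a ord0 i)].
pose S := B `&` G @^-1` [set 1].
have cS : compact S.
  apply: compact_closedI; first by apply: (@rV_compact R _ (fun=> `[0, 1]%classic)) => i; exact: segment_compact.
  apply: closed_comp => [a _|]; first exact: cG.
  exact: closed_eq.
suff -> : hull p = F @` S.
  apply: continuous_compact => //; exact: continuous_subspaceT.
apply/seteqP; split => x.
  move=> [a [a0 a1 ->]]; exists (\row_k a (enum_val k)); last first.
    by apply: eq_bigr => i _; rewrite mxE enum_rankK.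
  split=> [k|]; last by rewrite /G /= -a1; apply: eq_bigr => i _; rewrite mxE enum_rankK.
  rewrite /= in_itv/= mxE a0 /= -a1 (bigD1 (enum_val k))//= lerDl.
  exact: sumr_ge0.
move=> [a [aB aG] <-]; exists (fun i => a ord0 (enum_rank i)); split => // i.
by have := aB (enum_rank i); rewrite /= in_itv/= => /andP[].
Qed.

(** Farkas lemma, by induction on the number of generators (the proof of Bartl). If the
    last generator [g m] matters, some [x1] is nonpositive on the other generators,
    positive on [b] and equal to 1 on [g m]; projecting along [g m] onto the
    hyperplane where [x1] vanishes reduces to [m] generators. *)
Lemma farkas (m : nat) (g : nat -> 'rV[R]_n) (b : 'rV[R]_n) :
  (forall c, (forall i, (i < m)%N -> 0 <= dot c (g i)) -> 0 <= dot c b) ->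
  exists2 a : nat -> R, forall i, 0 <= a i & b = \sum_(i < m) a i *: g i.
Proof.
elim: m g b => [|m IH] g b gb.
  exists (fun=> 0) => //; rewrite big_ord0; apply: dot_eq0; apply/eqP.
  by rewrite eq_le dot_ge0 andbT -oppr_ge0 -dotN gb.
have [/IH[a a0 bE]|] := pselect (forall c,
    (forall i, (i < m)%N -> 0 <= dot c (g i)) -> 0 <= dot c b).
  exists (fun i => if (i < m)%N then a i else 0); first by move=> i; case: ifP.
  rewrite big_ord_recr /= ltnn scale0r addr0 bE.
  by apply: eq_bigr => i _; rewrite ltn_ord.
move=> /existsNP[x0 /not_implyP[x0g /negP]]; rewrite -ltNge => x0b.
have x0m : dot x0 (g m) < 0.
  rewrite ltNge; apply/negP => x0m; have : 0 <= dot x0 b.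
    by apply: gb => i; rewrite ltnS leq_eqVlt => /orP[/eqP ->//|]; exact: x0g.
  by rewrite leNgt x0b.
pose x1 := (dot x0 (g m))^-1 *: x0.
have x1m : dot x1 (g m) = 1 by rewrite dotZ mulVf ?lt_eqF.
have x1g i : (i < m)%N -> dot x1 (g i) <= 0.
  by move=> im; rewrite dotZ nmulr_rle0 ?invr_lt0// x0g.
have x1b : 0 < dot x1 b by rewrite dotZ nmulr_rgt0 ?invr_lt0.
have [c cg|a a0 bE] := IH (fun i => g i - dot x1 (g i) *: g m) (b - dot x1 b *: g m).
  have gE z : dot (c - dot c (g m) *: x1) z = dot c (z - dot x1 z *: g m).
    by rewrite dotBl dotZ dotBr dotZr mulrC.
  rewrite -gE; apply: gb => i; rewrite ltnS leq_eqVlt => /orP[/eqP ->|/cg].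
    by rewrite gE x1m scale1r subrr dot0r.
  by rewrite gE.
exists (fun i => if (i < m)%N then a i else dot x1 b - \sum_(j < m) a j * dot x1 (g j)).
  move=> i; case: ifP => // _; rewrite subr_ge0 (le_trans _ (ltW x1b))//.
  by apply: sumr_le0 => j _; rewrite mulr_ge0_le0// x1g.
rewrite big_ord_recr /= ltnn -[LHS](subrK (dot x1 b *: g m)) bE.
rewrite scalerBl [(\sum_(j < m) _) *: g m]scaler_suml addrA [RHS]addrAC -sumrB; congr (_ + _).
apply: eq_bigr => i _.
by rewrite ltn_ord scalerBr scalerA.
Qed.

End hulls.

Section separation.
Context {R : realType} {n : nat}.

(** The Farkas lemma for the cone over the hull, placed at height one in one more
    dimension. *)
Lemma hull_separation (I : finType) (p : I -> 'rV[R]_n) x : ~ hull p x ->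
  exists c, forall i, dot c x < dot c (p i).
Proof.
move=> px; apply: contrapT => noc; apply: px.
have dot_row (a b : R) (c d : 'rV[R]_n) :
    dot (row_mx a%:M c : 'rV[R]_(1 + n)) (row_mx b%:M d) = a * b + dot c d.
  rewrite /dot big_split_ord/= big_ord1 !row_mxEl !mxE eqxx !mulr1n; congr +%R.
  by apply: eq_bigr => i _; rewrite !row_mxEr.
pose g k : 'rV[R]_(1 + n) := if insub k is Some i then row_mx 1%:M (p (@enum_val I I i)) else 0.
have gE (i : 'I_#|I|) : g i = row_mx 1%:M (p (enum_val i)) by rewrite /g valK.
have [c cg|a a0 xE] := @farkas R (1 + n) #|I| g (row_mx 1%:M x).
  have cE : c = row_mx (c ord0 ord0)%:M (rsubmx c).
    rewrite -[LHS]hsubmxK; congr row_mx; apply/rowP => i; rewrite ord1 !mxE.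
    by rewrite eqxx mulr1n; congr (c _ _); apply/val_inj.
  set c0 := c ord0 ord0 in cE; set c1 := rsubmx c in cE.
  rewrite cE dot_row mulr1 leNgt; apply/negP => cx.
  apply: noc; exists c1 => i.
  have := cg (enum_rank i) (ltn_ord _); rewrite gE enum_rankK cE dot_row; lra.
have xE' : row_mx 1%:M x = \sum_i a (enum_rank i) *: row_mx 1%:M (p i) :> 'rV[R]_(1 + n).
  rewrite xE [RHS](reindex_onto enum_val enum_rank)//= => [|i _]; last by rewrite enum_rankK.
  under [RHS]eq_bigl do rewrite enum_valK eqxx.
  by apply: eq_bigr => i _; rewrite gE enum_valK.
exists (fun i => a (enum_rank i)); split => //.
  have /rowP/(_ (lshift n ord0)) := xE'; rewrite row_mxEl mxE eqxx mulr1n summxE => ->.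
  by apply: eq_bigr => i _; rewrite mxE row_mxEl mxE eqxx mulr1n mulr1.
apply/rowP => k; have /rowP/(_ (rshift 1 k)) := xE'; rewrite row_mxEr => ->.
by rewrite !summxE; apply: eq_bigr => i _; rewrite mxE [RHS]mxE row_mxEr.
Qed.

Lemma hull_max (I : finType) (p : I -> 'rV[R]_n) c (s0 : I) :
  exists s, forall x, hull p x -> dot c x <= dot c (p s).
Proof.
have [s _ smax] := @arg_maxP _ _ _ s0 xpredT (fun s => dot c (p s)) isT.
by exists s => x; apply: hull_le => i; exact: smax.
Qed.

End separation.

Section interior.
Context {R : realType} {n : nat}.

(** A one-sided inverse of a square matrix is two-sided. *)
Lemma dual_basis (f g : 'I_n -> 'rV[R]_n) :
  (forall i j, dot (f i) (g j) = (i == j)%:R) ->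
  forall x, x = \sum_i dot (f i) x *: g i.
Proof.
move=> fg x; pose F := \matrix_(i, j) f i ord0 j; pose G := \matrix_(i, j) g i ord0 j.
have FG : F *m G^T = 1%:M.
  apply/matrixP => i j; rewrite !mxE -fg; apply: eq_bigr => k _; by rewrite !mxE.
have /(congr1 trmx) := mulmx1C FG; rewrite trmx_mul trmxK trmx1 => GF.
rewrite -[LHS]mulmx1 -GF mulmxA; apply/rowP => k; rewrite mxE summxE.
apply: eq_bigr => i _; rewrite !mxE; congr (_ * _).
by apply: eq_bigr => j _; rewrite !mxE mulrC.
Qed.

Lemma continuous_dot (f : 'rV[R]_n) : continuous (dot f).
Proof.
apply: continuous_big => [|i _]; first exact: add_continuous.
move=> x; apply: (@cvgM R _ (nbhs x) (nbhs_filter x)); first exact: cvg_cst.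
exact: (@coord_continuous R).
Qed.

(** The set contains the simplex with vertices [x0] and [x0 + g i]; in the coordinates
    [f i] it is cut out by finitely many inequalities, which are strict at a
    barycentric point. *)
Lemma convex_interior (A : set 'rV[R]_n) x0 (f g : 'I_n -> 'rV[R]_n) :
  convex_set A -> A x0 -> (forall i, A (x0 + g i)) ->
  (forall i j, dot (f i) (g j) = (i == j)%:R) -> A° !=set0.
Proof.
move=> cA Ax0 Ag fg; pose e : R := (n.+1%:R)^-1.
have e0 : 0 < e by rewrite invr_gt0.
pose h := \sum_i f i.
pose x1 := x0 + e *: \sum_i g i.
have fx1 i : dot (f i) x1 = dot (f i) x0 + e.
  rewrite dotDr dotZr dot_sumr (bigD1 i)//= fg eqxx big1 ?addr0 ?mulr1// => j ji.
  by rewrite fg eq_sym (negbTE ji).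
have hx1 : dot h x1 < dot h x0 + 1.
  rewrite dot_suml (eq_bigr _ (fun i _ => fx1 i)) big_split/= -dot_suml ltrD2l.
  rewrite sumr_const card_ord -mulr_natr mulrC ltr_pdivrMr// mul1r.
  by rewrite ltr_nat.
exists x1; rewrite /interior.
have : \forall y \near x1, (forall i, dot (f i) x0 < dot (f i) y) /\ dot h y < dot h x0 + 1.
  apply: filterI; last first.
    exact: (cvgr_lt _ (@continuous_dot h x1)).
  apply: (@filter_forall _ _ (fun i y => dot (f i) x0 < dot (f i) y) _ (nbhs_filter x1)) => i.
  by apply: (cvgr_gt _ (@continuous_dot (f i) x1)); rewrite fx1 ltrDl.
apply: filterS => y [fy hy].
pose a (o : option 'I_n) := if o is Some i then dot (f i) (y - x0) else 1 - dot h (y - x0).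
pose p (o : option 'I_n) := if o is Some i then x0 + g i else x0.
have sumO (V : nmodType) (F : option 'I_n -> V) : \sum_o F o = F None + \sum_i F (Some i).
  rewrite (bigD1 None)//=; congr (_ + _).
  rewrite (reindex_omap Some id)//=; last by case.
  by apply: eq_bigl => i; rewrite eqxx.
have -> : y = \sum_o a o *: p o.
  rewrite sumO /= (eq_bigr (fun i => dot (f i) (y - x0) *: x0 + dot (f i) (y - x0) *: g i)).
    rewrite big_split /= -(dual_basis fg) -scaler_suml -dot_suml -/h addrA -scalerDl.
    by rewrite subrK scale1r addrC subrK.
  by move=> i _; rewrite scalerDr.
apply: convex_sum => //.
- by case.
- case => [i|] /=; first by rewrite dotBr subr_ge0 ltW.
  rewrite dotBr; move: hy; lra.
- by rewrite sumO /= -dot_suml -/h subrK.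
Qed.

End interior.

Lemma int_vect_inj {R : realType} {n : nat} : injective (@int_vect R n).
Proof.
move=> u w /rowP uw; apply/rowP => i; have := uw i; rewrite !mxE.
exact: intr_inj.
Qed.

(** * A criterion for Delzant polytopes *)

Section segments.
Context {R : realType} {n : nat}.
Implicit Types (x y z : 'rV[R]_n).

Lemma segmentP x y z : segment x y z <->
  exists t : R, [/\ 0 <= t, t <= 1 & z = x + t *: (y - x)].
Proof.
have E t : (1 - t) *: x + t *: y = x + t *: (y - x).
  by rewrite scalerBl scale1r scalerBr addrAC addrA.
split=> [[t /= + <-]|[t [t0 t1 ->]]].
  by rewrite in_itv/= => /andP[t0 t1]; exists t; rewrite E.
by exists t => //=; rewrite in_itv/= t0 t1.
Qed.

Lemma segment_l x y : segment x y x.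
Proof. by apply/segmentP; exists 0; rewrite lexx ler01 scale0r addr0. Qed.

Lemma segment_r x y : segment x y y.
Proof. by apply/segmentP; exists 1; rewrite lexx ler01 scale1r addrC subrK. Qed.

Lemma convex_segment (A : set 'rV[R]_n) x y :
  convex_set A -> A x -> A y -> segment x y `<=` A.
Proof.
move=> /convex_setP cA Ax Ay _ [t /= + <-]; rewrite in_itv/= => /andP[t0 t1].
by rewrite addrC; exact: cA.
Qed.

End segments.

(** Each direction of the dual basis at a vertex leads to another vertex: the neighbour
    across the wall opposite to the ray [N s i] shares all the other rays, so only
    the coordinate along [E s i] changes, and it increases. *)
Lemma fan_edge_end {R : realType} {n : nat} (I : finType) (v : I -> 'rV[R]_n) N E :
  fan_polytope v N E -> forall s i, exists t (r : R),
  0 < r /\ v t = v s + r *: int_vect (E s i).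
Proof.
move=> FP s i; have [t [tk tN]] := fan_adj FP s i.
have vt0 j : j != i -> dot (int_vect (N s j)) (v t - v s) = 0.
  move=> /tk[k Nk]; apply/eqP; rewrite dotBr subr_eq0 eq_le -{1 2}Nk.
  by rewrite (fan_min FP t s k) (fan_min FP s t j).
exists t, (dot (int_vect (N s i)) (v t - v s)); split.
  rewrite lt_neqAle dotBr subr_ge0 (fan_min FP) andbT eq_sym subr_eq0; apply/eqP.
  by move=> /(fan_eq FP)[k Nk]; exact: (tN k).
rewrite -[LHS](subrK (v s)) [LHS]addrC; congr (_ + _).
rewrite [LHS](dual_basis (fan_dual_real FP s)) (bigD1 i)//= [X in _ + X]big1 ?addr0//.
by move=> j /vt0 ->; rewrite scale0r.
Qed.

Section delzant_criterion.
Context {R : realType} {n : nat} (I : finType).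
Local Notation iv u := (@int_vect R n u).
Variables (v : I -> 'rV[R]_n) (N E : I -> 'I_n -> 'rV[int]_n).
Hypothesis FP : fan_polytope v N E.

Let co s x i := dot (iv (N s i)) (x - v s).

Let co_ge0 s x i : hull v x -> 0 <= co s x i.
Proof.
move=> vx; rewrite /co dotBr subr_ge0; apply: hull_ge vx => t.
exact: (fan_min FP).
Qed.

Let dotNE := fan_dual_real FP.

Let coE s x : x = v s + \sum_i co s x i *: iv (E s i).
Proof. by rewrite /co -(dual_basis (dotNE s)) addrC subrK. Qed.

Let co_ray s r i j : co s (v s + r *: iv (E s i)) j = r * (j == i)%:R.
Proof. by rewrite /co addrC addKr dotZr dotNE. Qed.

Let ray s i x : (forall j, j != i -> co s x j = 0) -> x = v s + co s x i *: iv (E s i).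
Proof.
move=> x0; rewrite [LHS](coE s) (bigD1 i)//= big1 ?addr0// => j /x0 ->.
by rewrite scale0r.
Qed.

Let E_neq0 s i : iv (E s i) != 0.
Proof. 
by apply/eqP => E0; have := dotNE s i i; rewrite E0 dot0r eqxx => /eqP; rewrite eq_sym oner_eq0.
Qed.

Let neighbour s i : exists t r, [/\ 0 < r, v t = v s + r *: iv (E s i) &
  forall x, hull v x -> (forall j, j != i -> co s x j = 0) -> co s x i <= r].
Proof.
have [t [r [r0 vtE]]] := fan_edge_end FP s i.
exists t, r; split => // x vx x0.
rewrite leNgt; apply/negP => rx.
have d0 k : dot (iv (N t k)) (iv (E s i)) = 0.
  apply/eqP; rewrite eq_le; apply/andP; split.
    have := co_ge0 t k (hull_pt v s).
    by rewrite /co {1}vtE opprD addNKr dotNr dotZr oppr_ge0 pmulr_rle0.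
  have := co_ge0 t k vx; rewrite {1}/co {1}(ray x0) {1}vtE opprD addrACA subrr add0r.
  by rewrite -scalerBl dotZr pmulr_rge0// subr_gt0.
have := E_neq0 s i; rewrite (dual_basis (dotNE t) (iv (E s i))) big1 ?eqxx// => k _.
by rewrite d0 scale0r.
Qed.

Let eset s i := [set x | hull v x /\ forall j, j != i -> co s x j = 0].

Let esetE s i : exists r : R, [/\ 0 < r, hull v (v s + r *: iv (E s i)) &
  eset s i = segment (v s) (v s + r *: iv (E s i))].
Proof.
have [t [r [r0 vt rmax]]] := neighbour s i; exists r; split => //.
  by rewrite -vt; exact: hull_pt.
apply/seteqP; split=> x.
  move=> [vx x0]; apply/segmentP; exists (co s x i / r); split.
  - by rewrite divr_ge0 ?co_ge0// ltW.
  - by rewrite ler_pdivrMr// mul1r rmax.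
  - by rewrite addrAC subrr add0r scalerA divfK ?gt_eqF//; exact: ray.
move=> xs; split.
  by move: xs; apply: convex_segment; [exact: convex_hull|exact: hull_pt|rewrite -vt; exact: hull_pt].
move: xs => /segmentP[k [_ _ ->]] j ji.
by rewrite addrAC subrr add0r scalerA co_ray (negbTE ji) mulr0.
Qed.

Let eset_edge s i : edge (hull v) (eset s i).
Proof.
have [r [r0 vr vE]] := esetE s i; split; last first.
  exists (v s), (v s + r *: iv (E s i)); split=> //.
  by rewrite -subr_eq0 opprD addNKr oppr_eq0 scaler_eq0 negb_or gt_eqF// E_neq0.
split; first by exists (v s); rewrite vE; exact: segment_l.
exists (- \sum_(j | j != i) iv (N s j)).
have cE x : dot (- \sum_(j | j != i) iv (N s j)) x =
    dot (- \sum_(j | j != i) iv (N s j)) (v s) - \sum_(j | j != i) co s x j.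
  apply/eqP; rewrite -subr_eq0 opprD addrA -dotBr opprK addrC dotN dot_suml addrN //.
apply/seteqP; split=> x /=.
  move=> [vx x0]; split => // y vy.
  rewrite (cE y) (cE x) lerD2l lerN2 [leLHS]big1//; apply: sumr_ge0 => j _; exact: co_ge0.
move=> [vx xmax]; split => // j ji.
have := xmax _ (hull_pt v s); rewrite (cE x) lerDl oppr_ge0 => sle.
have s0 : \sum_(j | j != i) co s x j == 0.
  by rewrite eq_le sle sumr_ge0// => k _; exact: co_ge0.
by move: s0; rewrite psumr_eq0 => [/allP/(_ j (mem_index_enum _))|k _]; [rewrite ji => /eqP|exact: co_ge0].
Qed.

Let edge_at s F : edge (hull v) F -> F (v s) -> exists i, F = eset s i.
Proof.
move=> [[_ [c FE]] [p [q [pq Fpq]]]] Fs.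
have cmax x : hull v x -> dot c x <= dot c (v s) by move: Fs; rewrite FE => -[_]; apply.
have Fin x : F x <-> hull v x /\ dot c x = dot c (v s).
  rewrite FE; split=> [[vx xmax]|[vx xE]]; last by split => // y; rewrite xE; exact: cmax.
  by split => //; apply/eqP; rewrite eq_le cmax//= xmax//; exact: hull_pt.
have cE i : dot c (iv (E s i)) <= 0.
  have [r [r0 vr _]] := esetE s i; have := cmax _ vr.
  by rewrite dotDr dotZr gerDl pmulr_rle0.
have cx x : dot c x = dot c (v s) + \sum_i co s x i * dot c (iv (E s i)).
  by rewrite {1}(coE s x) dotDr dot_sumr; under eq_bigr do rewrite dotZr.
have F0 x i : F x -> dot c (iv (E s i)) < 0 -> co s x i = 0.
  move=> /Fin[vx /eqP]; rewrite cx -subr_eq0 addrAC subrr add0r -oppr_eq0 -sumrN.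
  rewrite psumr_eq0 => [/allP/(_ i (mem_index_enum _))|k _]; last first.
    by rewrite oppr_ge0 mulr_ge0_le0// co_ge0.
  by rewrite oppr_eq0 mulf_eq0 => /orP[/eqP//|/eqP ->]; rewrite ltxx.
have [i ci] : exists i, dot c (iv (E s i)) = 0.
  apply: contrapT => noi.
  have Fv x : F x -> x = v s.
    move=> Fx; rewrite (coE s x) big1 ?addr0// => i _; rewrite (F0 _ i Fx) ?scale0r//.
    by rewrite lt_neqAle cE andbT; apply/eqP => ci; apply: noi; exists i.
  have Fp : F p by rewrite Fpq; exact: segment_l.
  have Fq : F q by rewrite Fpq; exact: segment_r.
  by move: pq; rewrite (Fv _ Fp) (Fv _ Fq) eqxx.
have uniq j : j != i -> dot c (iv (E s j)) < 0.
  move=> ji; rewrite lt_neqAle cE andbT; apply/eqP => cj.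
  have [r1 [r10 vr1 _]] := esetE s i; have [r2 [r20 vr2 _]] := esetE s j.
  have F1 : F (v s + r1 *: iv (E s i)) by apply/Fin; split => //; rewrite dotDr dotZr ci mulr0 addr0.
  have F2 : F (v s + r2 *: iv (E s j)) by apply/Fin; split => //; rewrite dotDr dotZr cj mulr0 addr0.
  move: Fs F1 F2; rewrite Fpq => /segmentP[t0 [_ _ E0]] /segmentP[t1 [_ _ E1]] /segmentP[t2 [_ _ E2]].
  have E1' : r1 *: iv (E s i) = (t1 - t0) *: (q - p).
    by apply: (addrI (v s)); rewrite E1 {1}E0 -addrA -scalerDl [t0 + _]addrC subrK.
  have E2' : r2 *: iv (E s j) = (t2 - t0) *: (q - p).
    by apply: (addrI (v s)); rewrite E2 {1}E0 -addrA -scalerDl [t0 + _]addrC subrK.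
  have := congr1 (dot (iv (N s i))) E1'; have := congr1 (dot (iv (N s j))) E1'.
  have := congr1 (dot (iv (N s j))) E2'; rewrite !dotZr !dotNE !eqxx (negbTE ji) mulr0 !mulr1.
  move=> r2E /esym/eqP; rewrite mulf_eq0 => /orP[/eqP -> | /eqP d0].
    by rewrite mul0r => r1E; rewrite r1E ltxx in r10.
  by rewrite r2E d0 mulr0 ltxx in r20.
exists i; apply/seteqP; split=> x.
  by move=> Fx; split=> [|j /uniq]; [have [] := (Fin x).1 Fx|exact: F0].
move=> [vx x0]; apply/Fin; split => //; rewrite cx (bigD1 i)//= ci mulr0 add0r.
by rewrite big1 ?addr0// => j /x0 ->; rewrite mul0r.
Qed.

Let face_pt F : face (hull v) F -> exists s, F (v s).
Proof.
move=> [[x Fx] [c FE]]; have /card_gt0P[s0 _] := fan_nonempty FP.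
have [s smax] := hull_max v c s0; exists s; rewrite FE; split => //.
exact: hull_pt.
Qed.

Let eset_inj s : injective (eset s).
Proof.
move=> i j ij; apply/eqP; apply: contrapT => /negP nij.
have [r [r0 vr vE]] := esetE s i.
have : eset s i (v s + r *: iv (E s i)) by rewrite vE; exact: segment_r.
rewrite ij => -[_ /(_ i nij)]; rewrite co_ray eqxx mulr1 => rE.
by rewrite rE ltxx in r0.
Qed.

(** At the vertex [v s] the hull lies in the cone with apex [v s] spanned by the basis
    [E s], and contains an initial segment of each generator. Hence a face that is a
    segment and contains [v s] lies on exactly one of the [n] rays, each ray carries
    one edge, and the primitive edge vectors are the rows of a unimodular matrix.
    Every face contains a vertex, so there are no other vertices or edges. *)
Lemma fan_delzant : delzant (hull v).
Proof.
have /card_gt0P[s0 _] := fan_nonempty FP.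
split.
- exact: hull_polytope.
- have /choice[r rP] i := esetE s0 i.
  apply: (@convex_interior _ _ _ (v s0) (fun i => (r i)^-1 *: iv (N s0 i))
    (fun i => r i *: iv (E s0 i))).
  + exact: convex_hull.
  + exact: hull_pt.
  + by move=> i; have [] := rP i.
  + move=> i j; have [ri _ _] := rP i; rewrite dotZ dotZr dotNE.
    by have [<-|_] /= := eqVneq i j; rewrite ?mulr0 ?mulr0// mulr1 mulVf// gt_eqF.
- move=> x /face_pt[s /= <-].
  have -> : [set F | edge (hull v) F /\ F (v s)] = eset s @` setT.
    apply/seteqP; split=> F /=.
      by move=> [eF Fs]; have [i ->] := edge_at eF Fs; exists i.
    move=> [i _ <-]; split; first exact: eset_edge.
    by have [r [_ _ ->]] := esetE s i; exact: segment_l.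
  apply: (card_eq_trans (inj_card_eq _)); first by move=> i j _ _; exact: eset_inj.
  have -> : `I_n = (@nat_of_ord n) @` setT.
    apply/seteqP; split=> k /=; first by move=> kn; exists (Ordinal kn).
    by move=> [i _ <-].
  by rewrite card_eq_sym; apply: inj_card_eq => i j _ _; exact: val_inj.
- move=> F eF; have [s Fs] := face_pt eF.1; have [i FE] := edge_at eF Fs.
  exists (E s i).
    by apply/eqP => E0; have := E_neq0 s i; rewrite E0 /int_vect map_mx0 eqxx.
  rewrite FE => x y [_ /ray xE] [_ /ray yE]; exists (co s y i - co s x i).
  by rewrite {1}xE {1}yE opprD addrACA subrr add0r -scalerBl.
- move=> x /face_pt[s /= <-]; exists (\matrix_i E s i).
    move=> z; exists (\row_i zdot (N s i) z).
    have zE (c : 'rV[int]_n) : c *m (\matrix_i E s i) = \sum_i c ord0 i *: E s i.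
      by rewrite mulmx_sum_row; under eq_bigr do rewrite rowK.
    split.
      rewrite zE; apply: (@int_vect_inj R).
      rewrite [LHS](dual_basis (dotNE s)) [RHS]raddf_sum; apply: eq_bigr => i _.
      by rewrite mxE dot_int -int_vectZ.
    move=> c ->; apply/rowP => i; rewrite mxE zE /zdot.
    under eq_bigr do rewrite summxE mulr_sumr.
    rewrite exchange_big /= (bigD1 i)//= [X in _ + X]big1 ?addr0 => [|j /negbTE ji].
      under eq_bigr do rewrite mxE mulrCA.
      by rewrite -mulr_sumr -/(zdot _ _) (fan_dual FP) eqxx mulr1.
    under eq_bigr do rewrite mxE mulrCA.
    by rewrite -mulr_sumr -/(zdot _ _) (fan_dual FP) eq_sym ji mulr0.
  apply/seteqP; split=> u /=.
    move=> [pu [t t0 eu]].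
    have [i uE] := edge_at eu (segment_l _ _).
    have [r [r0 vr eE]] := esetE s i.
    have : eset s i (v s + t *: iv u) by rewrite -uE; exact: segment_r.
    move=> [/(co_ge0 s i) tge /ray]; move: tge; rewrite {1 2}/co addrC addKr dotZr dot_int.
    set m := zdot _ _ => m0 /(congr1 (fun x => x - v s)).
    rewrite addrAC subrr add0r addrAC subrr add0r -scalerA => /(scalerI (lt0r_neq0 t0)).
    rewrite -int_vectZ => /(@int_vect_inj R) uE'.
    have m1 : m = 1.
      have : (`|m| %| \big[gcdn/0]_(k < n) `|u ord0 k|)%N.
        by apply/dvdn_biggcdP => k _; rewrite uE' mxE abszM dvdn_mulr.
      rewrite pu dvdn1 => /eqP; have : 0 <= m by move: m0; rewrite pmulr_rge0// ler0z.
      by case: (m) => // k _ /= ->.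
    by exists i => //; rewrite rowK uE' m1 scale1r.
  move=> [i _ <-]; rewrite rowK; split.
    apply/eqP; rewrite -dvdn1; set d := (\big[gcdn/0]_(_ < _) _)%N.
    have dE k : (d %| `|E s i ord0 k|)%N by rewrite /d (biggcdn_inf k).
    have := fan_dual FP s i i; rewrite eqxx => /(congr1 absz) /= <-.
    have : (d%:Z %| zdot (N s i) (E s i))%Z.
      by rewrite /zdot; apply: rpred_sum => k _; apply: dvdz_mull; exact: dE.
    by [].
  by have [r [r0 vr vE]] := esetE s i; exists r => //; rewrite -vE; exact: eset_edge.
Qed.

End delzant_criterion.

(** * Fans adapted to a given Delzant polytope *)

Section exposed_vertices.
Context {R : realType} {n : nat}.
Implicit Types (c d x y : 'rV[R]_n).

(** Among the points minimising [c], one of maximal norm is strictly exposed: by the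
    Cauchy-Schwarz inequality it is the only maximiser, on that set, of the functional
    it represents, and a small multiple of this functional perturbs [- c]. *)
Lemma exposed_min (I : finType) (p : I -> 'rV[R]_n) c (s0 : I) : exists k C,
  (forall j, dot c (p k) <= dot c (p j)) /\
  (forall j, p j != p k -> dot C (p j) < dot C (p k)).
Proof.
have [i0 _ i0min] := @arg_minP _ _ _ s0 xpredT (fun s => dot c (p s)) isT.
have [k /eqP kc kmax] := @arg_maxP _ _ _ i0 (fun s => dot c (p s) == dot c (p i0))
  (fun s => dot (p s) (p s)) (eqxx _).
have kmin j : dot c (p k) <= dot c (p j) by rewrite kc i0min.
have [e e0 eP] := small_perturbation (fun j => dot c (p j - p k)) (fun j => - dot (p k) (p j - p k)).
exists k, (e *: p k - c); split => // j jk.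
rewrite !dotBl !dotZ.
have := kmin j; rewrite le_eqVlt => /orP[/eqP ckj|ckj]; last first.
  have := eP j; rewrite !dotBr subr_gt0 => /(_ ckj); lra.
rewrite -ckj ltrD2r ltr_pM2l//.
have kj : dot (p j) (p j) <= dot (p k) (p k) by apply: kmax; rewrite -ckj kc.
have : 0 < dot (p j - p k) (p j - p k).
  rewrite lt_neqAle dot_ge0 andbT eq_sym; apply/eqP => /dot_eq0/eqP.
  by rewrite subr_eq0 (negbTE jk).
rewrite dotBl (dotBr (p j)) (dotBr (p k)) (dotC (p j) (p k)); move: kj; lra.
Qed.

Lemma hull_face (I : finType) (p : I -> 'rV[R]_n) c (m : R) x :
  (forall j, dot c (p j) <= m) -> hull p x -> dot c x = m ->
  exists a : I -> R, [/\ forall i, 0 <= a i, \sum_i a i = 1, x = \sum_i a i *: p i &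
    forall i, a i != 0 -> dot c (p i) = m].
Proof.
move=> pm [a [a0 a1 xE]] cx; exists a; split => // i ai.
have : \sum_j a j * (m - dot c (p j)) == 0.
  under eq_bigr do rewrite mulrBr; rewrite sumrB -mulr_suml a1 mul1r -cx xE dot_sumr.
  by under [X in _ - X]eq_bigr do rewrite -dotZr; rewrite subrr.
rewrite psumr_eq0 => [/allP/(_ i (mem_index_enum _))|j _]; last first.
  by rewrite mulr_ge0// subr_ge0.
by rewrite mulf_eq0 (negbTE ai) /= subr_eq0 => /eqP.
Qed.

Lemma exposed_vertex (I : finType) (p : I -> 'rV[R]_n) k C :
  (forall j, p j != p k -> dot C (p j) < dot C (p k)) -> vertex (hull p) (p k).
Proof.
move=> kC; have Cmax j : dot C (p j) <= dot C (p k).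
  by have [->//|/kC/ltW] := eqVneq (p j) (p k).
split; first by exists (p k).
exists C; apply/seteqP; split=> x /=.
  by move=> ->; split; [exact: hull_pt|move=> y; apply: hull_le].
move=> [px xmax]; have [|a [a0 a1 -> aC]] := hull_face Cmax px.
  by apply/eqP; rewrite eq_le (hull_le Cmax px) xmax//; exact: hull_pt.
rewrite -[RHS]scale1r -a1 scaler_suml; apply: eq_bigr => i _.
have [->|/aC Ci] := eqVneq (a i) 0; first by rewrite !scale0r.
by have [->//|/kC] := eqVneq (p i) (p k); rewrite Ci ltxx.
Qed.

Lemma primitive_part (u : 'rV[int]_n) : u != 0 ->
  exists (g : nat) (u0 : 'rV[int]_n), [/\ (0 < g)%N, primitive u0 & u = g%:Z *: u0].
Proof.
move=> u0; set g := (\big[gcdn/0]_(i < n) `|u ord0 i|)%N.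
have gu i : (g%:Z %| u ord0 i)%Z by rewrite dvdzE /= /g (biggcdn_inf i).
have g0 : (0 < g)%N.
  rewrite lt0n; apply: contra u0 => /eqP g0; apply/eqP/rowP => i.
  by have := gu i; rewrite g0 dvd0z mxE => /eqP.
have uE : u = g%:Z *: \row_i (u ord0 i %/ g%:Z)%Z.
  by apply/rowP => i; rewrite !mxE mulrC divzK.
exists g, (\row_i (u ord0 i %/ g%:Z)%Z); split => //.
apply/eqP; set d := (\big[gcdn/0]_(_ < _) _)%N; rewrite -dvdn1 -(dvdn_pmul2l g0) muln1.
rewrite {2}/g; apply/dvdn_biggcdP => i _.
by rewrite {1}uE mxE abszM dvdn_pmul2l// /d (biggcdn_inf i).
Qed.

Lemma primitiveN (u : 'rV[int]_n) : primitive u -> primitive (- u).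
Proof. by rewrite /primitive; under [in X in _ -> X]eq_bigr do rewrite mxE abszN. Qed.

(** A functional that does not decrease along the edges at a vertex is minimal there.
    Otherwise consider the vertex figure, that is the points [h j] where the rays from
    [p k] towards the other [p j] meet the hyperplane [C = - 1]. An exposed point of it
    that minimises [d] spans an exposed ray, hence an edge of the hull, along which
    [d] decreases. *)
Lemma edges_minimum (I : finType) (p : I -> 'rV[R]_n) k C d :
  (forall j, p j != p k -> dot C (p j) < dot C (p k)) ->
  (forall F, edge (hull p) F -> rational_direction F) ->
  (forall u, primitive_edge_vector (hull p) (p k) u -> 0 <= dot d (int_vect u)) ->
  forall j, dot d (p k) <= dot d (p j).
Proof.
move=> kC rat dpos j0; rewrite leNgt; apply/negP => dj0.
have j0k : p j0 != p k by apply/eqP => jk; rewrite jk ltxx in dj0.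
pose f j := if p j == p k then j0 else j.
have fk j : p (f j) != p k by rewrite /f; case: ifPn.
pose s j := dot C (p k - p (f j)).
have s0 j : 0 < s j by rewrite /s dotBr subr_gt0 kC.
pose h j := (s j)^-1 *: (p (f j) - p k).
have hE j : p (f j) = p k + s j *: h j.
  by rewrite /h scalerA divff ?gt_eqF// scale1r addrC subrK.
have Ch j : dot C (h j) = -1.
  by rewrite dotZr -opprB dotNr mulrN mulVf ?gt_eqF.
have [k1 [C1 [k1min k1C]]] := exposed_min h d j0.
have dh : dot d (h k1) < 0.
  apply: le_lt_trans (k1min j0) _; rewrite dotZr pmulr_rlt0 ?invr_gt0// dotBr.
  by rewrite subr_lt0 /f (negbTE j0k).
(* As C is - 1 at all h j, adding this multiple of C to C1 makes the maximum of
   C1 over the h j equal to 0, so that D attains its maximum over the hull on the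
   whole ray of h k1. *)
pose D := C1 + dot C1 (h k1) *: C.
have Dh j : dot D (h j) = dot C1 (h j) - dot C1 (h k1) by rewrite dotD dotZ Ch mulrN1.
have Dle j : dot D (h j) <= 0.
  by rewrite Dh subr_le0; have [->//|/k1C/ltW] := eqVneq (h j) (h k1).
have Dmax j : dot D (p j) <= dot D (p k).
  have [->//|jk] := eqVneq (p j) (p k).
  have -> : p j = p (f j) by rewrite /f (negbTE jk).
  by rewrite hE dotDr dotZr gerDl pmulr_rle0.
pose S0 j := if (p j != p k) && (h j == h k1) then s j else 0.
have [j1 _ j1max] := @arg_maxP _ _ _ (f k1) xpredT S0 isT.
have hk1 : h (f k1) = h k1.
  by rewrite /h /s; have -> : f (f k1) = f k1 by rewrite {1}/f (negbTE (fk k1)).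
have S1 : 0 < S0 j1.
  apply: lt_le_trans (j1max (f k1) isT).
  by rewrite /S0 fk hk1 eqxx s0.
have pE j : dot D (p j) = dot D (p k) -> p j = p k + S0 j *: h k1.
  have [jk|jk] := eqVneq (p j) (p k); first by rewrite /S0 jk eqxx scale0r addr0.
  have jf : f j = j by rewrite /f (negbTE jk).
  rewrite -jf hE dotDr dotZr /S0 !jf jk /=.
  have [->//|/k1C lt1] := eqVneq (h j) (h k1).
  move=> /eqP; rewrite -subr_eq0 addrAC subrr add0r mulf_eq0 gt_eqF//= Dh subr_eq0.
  by move=> /eqP eq1; rewrite eq1 ltxx in lt1.
have p1E : p j1 = p k + S0 j1 *: h k1.
  move: S1; rewrite {1}/S0; case: ifP => [/andP[jk /eqP hj] _|]; last by rewrite ltxx.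
  by rewrite /S0 jk hj eqxx -hj -hE /f (negbTE jk).
have p1B : p j1 - p k = S0 j1 *: h k1 by rewrite p1E addrC addKr.
pose F := segment (p k) (p j1).
have eF : edge (hull p) F.
  split; last first.
    exists (p k), (p j1); split => //; rewrite p1E -subr_eq0 opprD addNKr oppr_eq0 scaler_eq0.
    rewrite negb_or gt_eqF//=; apply/eqP => h0; move: (Ch k1); rewrite h0 dot0r => /eqP.
    by rewrite eq_sym oppr_eq0 oner_eq0.
  split; first by exists (p k); exact: segment_l.
  have Dk1 : dot D (h k1) = 0 by rewrite Dh subrr.
  exists D; apply/seteqP; split=> x.
    move=> Fx; split; first by move: x Fx; apply: convex_segment;
      [exact: convex_hull|exact: hull_pt|exact: hull_pt].
    move: Fx => /segmentP[t [_ _ ->]] y py.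
    rewrite p1B dotDr (dotZr t D) (dotZr _ D) Dk1 !mulr0 addr0.
    exact: hull_le py.
  move=> [px xmax]; have [|a [a0 a1 xE aD]] := hull_face Dmax px.
    by apply/eqP; rewrite eq_le (hull_le Dmax px) xmax//; exact: hull_pt.
  have xE' : x = p k + (\sum_i a i * S0 i) *: h k1.
    rewrite xE -[X in X + _]scale1r -a1 !scaler_suml -big_split; apply: eq_bigr => i _ /=.
    have [->|/aD/pE {1}->] := eqVneq (a i) 0; first by rewrite mul0r !scale0r addr0.
    by rewrite scalerDr scalerA.
  have S00 i : 0 <= S0 i by rewrite /S0; case: ifP => // _; exact: ltW.
  apply/segmentP; exists ((\sum_i a i * S0 i) / S0 j1); split.
  - by rewrite divr_ge0// ?sumr_ge0// => i _; rewrite mulr_ge0.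
  - rewrite ler_pdivrMr// -a1 mulr_suml; apply: ler_sum => i _.
    by rewrite ler_wpM2l//; exact: j1max.
  - by rewrite p1B scalerA divfK ?gt_eqF.
have [u u0 uE] := rat F eF.
have [t tE] := uE _ _ (segment_l _ _) (segment_r _ _).
have Sh : S0 j1 *: h k1 = t *: int_vect u by rewrite -tE p1B.
have [g [w [g0 pw uw]]] := primitive_part u0.
have dt : t * (g%:R * dot d (int_vect w)) < 0.
  have := congr1 (dot d) Sh; rewrite uw int_vectZ (dotZr (S0 j1)) (dotZr t) (dotZr _%:~R) => <-.
  by rewrite pmulr_rlt0.
have tpos (w' : 'rV[int]_n) (t' : R) : primitive w' -> 0 < t' ->
   S0 j1 *: h k1 = t' *: int_vect w' -> False.
  move=> pw' t'0 Sh'; have : 0 <= dot d (int_vect w').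
    by apply: dpos; split => //; exists t' => //; rewrite -Sh' -p1E.
  have := congr1 (dot d) Sh'; rewrite (dotZr (S0 j1)) (dotZr t') => Sd.
  rewrite leNgt => /negP; apply; rewrite -(pmulr_rlt0 _ t'0) -Sd pmulr_rlt0//.
have gR : 0 < g%:R :> R by rewrite ltr0n.
have [t0|t0|t0] := ltrgtP t 0.
- apply: (tpos (- w) (- t * g%:R)); [exact: primitiveN|by rewrite mulr_gt0// oppr_gt0|].
  by rewrite Sh uw int_vectZ int_vectN scalerN mulNr scaleNr opprK scalerA.
- apply: (tpos w (t * g%:R)) => //; first by rewrite mulr_gt0.
  by rewrite Sh uw int_vectZ scalerA.
- by rewrite t0 mul0r ltxx in dt.
Qed.

(** If a point of [X] were outside the hull, a functional [c] would separate them. The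
    vertex [v s] minimising [c] has a normal cone containing [c], so [c] is a
    nonnegative combination of the rays [N s i], and [q s] is not above [X]. *)
Lemma adapted_hull (I : finType) (v : I -> 'rV[R]_n) N E (X : set 'rV[R]_n) (q : I -> 'rV[R]_n) :
  fan_polytope v N E ->
  (forall s i x, X x -> dot (int_vect (N s i)) (q s) <= dot (int_vect (N s i)) x) ->
  X `<=` hull q.
Proof.
move=> FP qX x Xx; apply: contrapT => /hull_separation[c cq].
have /card_gt0P[s0 _] := fan_nonempty FP.
have [s _ smin] := @arg_minP _ _ _ s0 xpredT (fun s => dot c (v s)) isT.
have cE i : 0 <= dot c (int_vect (E s i)).
  have [t [r [r0 vtE]]] := fan_edge_end FP s i.
  by have := smin t isT; rewrite vtE dotDr dotZr lerDl pmulr_rge0.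
have := cq s; rewrite -subr_gt0 -dotBr => qx.
have : 0 <= dot c (x - q s).
  rewrite (dual_basis (fan_dual_real FP s) (x - q s)) dot_sumr; apply: sumr_ge0 => i _.
  by rewrite dotZr mulr_ge0// dotBr subr_ge0 qX.
by move: qx; rewrite !dotBr; lra.
Qed.

(** On a resolved cone all terms have the same sign; if their sum is nonnegative, each
    of them is. *)
Lemma resolved_ge0 (I : finType) (N : I -> 'I_n -> 'rV[int]_n) a s :
  resolved N a -> 0 <= \sum_i zdot a (N s i) -> forall i, 0 <= zdot a (N s i).
Proof.
move=> res asum i; have [//|aneg] := res s.
have : \sum_j - zdot a (N s j) == 0.
  by rewrite sumrN oppr_eq0 eq_le asum andbT sumr_le0.
rewrite psumr_eq0 => [/allP/(_ i (mem_index_enum _))|j _]; last by rewrite oppr_ge0.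
by rewrite oppr_eq0 => /eqP ->.
Qed.

(** It suffices that the fan resolves all edge directions of [P]. Given a cone, take a
    vertex of [P] minimising the sum of the rays of the cone: this sum is nonnegative on the
    edges at this vertex, hence so is each ray as the cone is resolved, and each
    ray is minimal at the vertex because the edges generate the tangent cone. *)
Lemma delzant_adapted (P : set 'rV[R]_n) : delzant P ->
  exists A : seq 'rV[int]_n, forall (I : finType) v N E,
    @fan_polytope R n I v N E -> (forall a, a \in A -> resolved N a) ->
    exists2 p : I -> 'rV[R]_n, adapted N p & P = hull p.
Proof.
move=> [/polytope_hull[m [p ->]] [x0 /interior_subset x0P] _ rat bas].
have /choice[M MP] (k : 'I_m) : exists M : 'M[int]_n, vertex (hull p) (p k) ->
    [set u | primitive_edge_vector (hull p) (p k) u] = [set row i M | i in setT].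
  have [/bas[M _ MP]|nv] := pselect (vertex (hull p) (p k)); first by exists M.
  by exists 0.
exists [seq row z.2 (M z.1) | z <- enum {: 'I_m * 'I_n}] => I v N E FP res.
have [k0 _] : exists k : 'I_m, True.
  case: x0P => a [_ a1 _]; apply: contrapT => nok.
  have /eqP := a1; rewrite big1 ?(eq_sym 0) ?oner_eq0// => k.
  by case: nok; exists k.
have /choice[f fP] s : exists k, forall i j,
    dot (int_vect (N s i)) (p k) <= dot (int_vect (N s i)) (p j).
  have [k [C [kmin kC]]] := exposed_min p (\sum_i int_vect (N s i)) k0.
  exists k => i; apply: (edges_minimum kC rat) => u.
  have vk := exposed_vertex kC.
  move=> pu; have : [set u | primitive_edge_vector (hull p) (p k) u] u by [].
  rewrite (MP _ vk) => -[l _ ul].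
  have ru : resolved N u.
    by apply: res; apply/mapP; exists (k, l) => //; rewrite mem_enum.
  have [_ [t t0 [[_ [c cF]] _]]] := pu.
  have : hull p (p k + t *: int_vect u).
    by have := segment_r (p k) (p k + t *: int_vect u); rewrite cF => -[].
  move/(hull_ge kmin); rewrite dotDr dotZr lerDl pmulr_rge0// dot_suml.
  have NuE j : dot (int_vect (N s j)) (int_vect u) = (zdot u (N s j))%:~R :> R.
    by rewrite dot_int zdotC.
  rewrite (eq_bigr _ (fun j _ => NuE j)) -rmorph_sum ler0z NuE ler0z => usum.
  exact: (resolved_ge0 ru).
exists (fun s => p (f s)); first by move=> s t i; exact: fP.
apply/seteqP; split.
  apply: (adapted_hull FP) => s i; apply: hull_ge; exact: fP.
by apply: hull_sub => [|s]; [exact: convex_hull|exact: hull_pt].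
Qed.

End exposed_vertices.

(** * Lebesgue measure and affine maps *)

Section affine_volume.
Context {R : realType}.
Local Notation mR := (measurableTypeR R).
Local Open Scope ereal_scope.

Lemma pushforward_measure d d' (T1 : measurableType d) (T2 : measurableType d')
    (m : {measure set T1 -> \bar R}) (f : T1 -> T2) : measurable_fun setT f ->
  exists m' : {measure set T2 -> \bar R}, forall A, m' A = m (f @^-1` A).
Proof.
move=> mf.
by exists (@measure_function_pushforward__canonical__measure_function_Measure _ _ _ _ _ m f mf).
Qed.

Lemma lebesgue_measure_affine (c b : R) (A : set mR) : (0 < c)%R -> measurable A ->
  lebesgue_measure A = c%:E * lebesgue_measure ((fun x => c * x + b)%R @^-1` A).
Proof.
move=> c0 mA.
have mf : measurable_fun [set: mR] (fun x : mR => c * x + b : mR)%R.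
  apply: continuous_measurable_fun => x.
  by apply: cvgD; [apply: cvgM; [exact: cvg_cst|exact: cvg_id]|exact: cvg_cst].
have [m mE] := pushforward_measure lebesgue_measure mf.
pose m2 : {measure set mR -> \bar R} := mscale (NngNum (ltW c0)) m.
have m2E B : m2 B = c%:E * lebesgue_measure ((fun x => c * x + b)%R @^-1` B) by rewrite -mE.
apply: etrans (m2E A); apply: lebesgue_measure_unique mA.
move=> X /ocitvP[->|[[u v] /= uv ->]]; first by rewrite !measure0.
apply: etrans (esym (m2E _)).
have -> : (fun x : mR => c * x + b)%R @^-1` `]u, v] = `]((u - b) / c)%R, ((v - b) / c)%R]%classic.
  by apply/seteqP; split => x /=; rewrite !in_itv/= ltr_pdivrMr// ler_pdivlMr//
    ltrBlDr lerBrDr (mulrC x).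
rewrite !lebesgue_measure_itv/= !lte_fin ltr_pM2r ?invr_gt0// ltrD2r uv.
rewrite -!EFinB -EFinM; congr EFin.
by field; rewrite gt_eqF.
Qed.

(** The boxes form a generating system closed under intersection, and the cubes centred
    at the origin exhaust space. *)
Lemma lebesgue_tuple_unique n (m : {measure set (n.-tuple mR) -> \bar R}) :
  (forall A : 'I_n -> set mR, (forall i, measurable (A i)) ->
    m [set t | forall i, A i (tnth t i)] = \prod_(i < n) lebesgue_measure (A i)) ->
  forall A, measurable A -> lebesgue_tuple A = m A.
Proof.
move=> mbox.
pose G := [set B : set (n.-tuple mR) | exists2 A : 'I_n -> set mR,
  (forall i, measurable (A i)) & B = [set t | forall i, A i (tnth t i)]].
pose g (k : nat) : set (n.-tuple mR) := [set t | forall i, (`[(- k%:R)%R, k%:R%R]%classic : set mR) (tnth t i)].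
have GE : (measurable : set (set (n.-tuple mR))) = <<s G >>.
  apply/seteqP; split; last first.
    apply: smallest_sub; first exact: sigma_algebra_measurable.
    by move=> _ [A mA ->]; exact: measurable_box.
  rewrite {1}/measurable/= /g_sigma_preimage; apply: smallest_sub; first exact: smallest_sigma_algebra.
  elim/big_ind : _ => [//|X Y XG YG B [/XG|/YG]//|i _ _ [B mB <-]].
  apply: sub_gen_smallest; exists (fun j => if j == i then B else setT).
    by move=> j; case: ifP.
  apply/seteqP; split => t /=; first by move=> [_ Bt] j; case: ifP => // /eqP ->.
  by move=> /(_ i); rewrite eqxx.
move=> A mA; apply: (measure_unique G g) => //.
- move=> _ _ [A1 mA1 ->] [A2 mA2 ->]; exists (fun i => A1 i `&` A2 i).
    by move=> i; exact: measurableI.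
  apply/seteqP; split => t /=; first by move=> [t1 t2] i; split.
  by move=> t12; split => i; have [] := t12 i.
- by move=> k; exists (fun=> `[(- k%:R)%R, k%:R%R]%classic : set mR) => // i; exact: measurable_itv.
- apply/seteqP; split => // t _; pose M := (\sum_i `|tnth t i : R|)%R.
  have [k kM] : exists k : nat, (M <= k%:R)%R.
    exists (Num.truncn M).+1; apply/ltW; exact: truncnS_gt.
  exists k => // i /=; rewrite in_itv/= -ler_norml; apply: le_trans kM.
  rewrite /M (bigD1 i)//= lerDl; exact: sumr_ge0.
- by move=> _ [B mB ->]; apply: (etrans (lebesgue_tuple_box mB)); rewrite mbox.
- move=> k; suff : lebesgue_tuple (g k) < +oo by [].
  rewrite /g (@lebesgue_tuple_box R n (fun=> `[(- k%:R)%R, k%:R%R]%classic)) => [|i]; last exact: measurable_itv.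
  rewrite -ge0_fin_numE; last by apply: prode_ge0 => i _; exact: measure_ge0.
  by apply: prode_fin_num => i _; rewrite lebesgue_measure_itv/=; case: ifP.
Qed.

Lemma measurable_affine n (c : R) (b : 'rV[R]_n) : measurable_fun setT
  (fun t : n.-tuple mR => [tuple (c * tnth t i + b ord0 i : mR)%R | i < n]).
Proof.
apply/measurable_fun_tnthP => i; rewrite (_ : _ \o _ = (fun t => c * tnth t i + b ord0 i)%R); last first.
  by apply/funext => t /=; rewrite tnth_mktuple.
have mg : measurable_fun [set: mR] (fun x : mR => c * x + b ord0 i : mR)%R.
  apply: continuous_measurable_fun => x.
  by apply: cvgD; [apply: cvgM; [exact: cvg_cst|exact: cvg_id]|exact: cvg_cst].
exact: (measurableT_comp mg (measurable_tnth i)).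
Qed.

(** Both sides are measures of [A]; they agree on boxes by the one-dimensional case. *)
Lemma vol_affine n (A : set 'rV[R]_n) (c : R) (b : 'rV[R]_n) : (0 < c)%R ->
  measurable [set t : n.-tuple mR | A (\row_i tnth t i)] ->
  vol A = (c ^+ n)%:E * vol [set x | A (c *: x + b)%R].
Proof.
move=> c0 mA.
pose f (t : n.-tuple mR) : n.-tuple mR := [tuple (c * tnth t i + b ord0 i : mR)%R | i < n].
have mf : measurable_fun setT f := @measurable_affine n c b.
have [m mE] := pushforward_measure (@lebesgue_tuple R n) mf.
have cn0 : (0 <= c ^+ n)%R by rewrite exprn_ge0// ltW.
pose m2 : {measure set (n.-tuple mR) -> \bar R} := mscale (NngNum cn0) m.
have m2E B : m2 B = (c ^+ n)%:E * lebesgue_tuple (f @^-1` B) by rewrite -mE.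
rewrite /vol; apply: etrans (lebesgue_tuple_unique _ mA) _; last first.
  apply: (etrans (m2E _)); congr (_ * lebesgue_tuple _).
  apply/seteqP; split => t /=; congr A; apply/rowP => i; by rewrite !mxE tnth_mktuple.
move=> B mB; apply: (etrans (m2E _)).
rewrite (eq_bigr _ (fun i _ => lebesgue_measure_affine (b ord0 i) c0 (mB i))).
rewrite big_split/= prodEFin prodr_const card_ord -lebesgue_tuple_box.
  congr (_ * lebesgue_tuple _); apply/seteqP; split => t /= tB i.
    by have := tB i; rewrite tnth_mktuple.
  by rewrite tnth_mktuple; exact: tB.
move=> i.
rewrite -[X in measurable X]setTI.
have mg : measurable_fun [set: mR] (fun x : mR => c * x + b ord0 i : mR)%R.
  apply: continuous_measurable_fun => x.
  by apply: cvgD; [apply: cvgM; [exact: cvg_cst|exact: cvg_id]|exact: cvg_cst].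
exact: mg.
Qed.
End affine_volume.

(** * Hausdorff distance and volume of convex bodies *)

Section norms.
Context {R : realType} {n : nat}.
Implicit Types (x y z : 'rV[R]_n) (A B P Q : set 'rV[R]_n).

Lemma norm_le_enorm x : `|x| <= enorm x.
Proof.
rewrite [leLHS]/Num.Def.normr/= mx_normrE; apply/bigmax_leP; split; first exact: enorm_ge0.
by move=> [i j] _ /=; rewrite ord1 coord_le_enorm.
Qed.

Lemma coord_le_norm x i : `|x ord0 i| <= `|x|.
Proof.
by rewrite [leRHS]/Num.Def.normr /= mx_normrE; apply/bigmax_geP; right => /=; exists (ord0, i).
Qed.

Lemma enormZ (a : R) x : enorm (a *: x) = `|a| * enorm x.
Proof.
rewrite /enorm dotZ dotC dotZ mulrA -expr2 sqrtrM ?sqr_ge0// sqrtr_sqr //.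
Qed.

Lemma enorm_sum (I : finType) (f : I -> 'rV[R]_n) :
  enorm (\sum_i f i) <= \sum_i enorm (f i).
Proof.
elim/big_rec2: _ => [|i y1 y2 _ IH]; first by rewrite enorm0.
by rewrite (le_trans (ler_enormD _ _))// lerD2l.
Qed.

Lemma enorm_le_norm x : enorm x <= n%:R * `|x|.
Proof.
rewrite {1}[x]row_sum_delta (le_trans (enorm_sum _))//.
apply: (@le_trans _ _ (\sum_(i < n) `|x|)); last by rewrite sumr_const card_ord mulr_natl.
apply: ler_sum => i _; rewrite enormZ -[leRHS]mulr1 ler_pM ?enorm_ge0//.
  exact: coord_le_norm.
rewrite /enorm -[leRHS]sqrtr1 ler_sqrt//; rewrite /dot (bigD1 i)//= big1 ?addr0.
  by rewrite mxE !eqxx mulr1.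
by move=> j /negbTE ji; rewrite mxE ji andbF mulr0.
Qed.

Lemma ball_norm x (e : R) y : ball x e y <-> `|x - y| < e.
Proof. by rewrite mx_norm_ball. Qed.

Lemma hausdorff_pt P Q (e : R) x : convex_body P -> convex_body Q ->
  hausdorff_dist P Q < e -> P x -> exists2 y, Q y & enorm (x - y) < e.
Proof.
move=> bP bQ PQe Px; have := le_lt_trans (edist_hausdorff bP bQ Px) PQe.
have [[y0 Qy0] _] := bQ.
have inf0 : has_inf [set enorm (x - y) | y in Q].
  split; first by exists (enorm (x - y0)), y0.
  by exists 0 => _ [y _ <-]; exact: enorm_ge0.
by move=> /(inf_lt inf0.1)[_ [y Qy <-] xy]; exists y.
Qed.

Lemma hausdorff_le P Q (r : R) : P !=set0 -> Q !=set0 ->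
  (forall x, P x -> exists2 y, Q y & enorm (x - y) <= r) ->
  (forall y, Q y -> exists2 x, P x & enorm (y - x) <= r) -> hausdorff_dist P Q <= r.
Proof.
move=> P0 Q0 PQ QP; apply: hausdorff_dist_le => // x.
  by move=> /PQ[y Qy]; apply: le_trans; exact: edist_le.
by move=> /QP[y Py]; apply: le_trans; exact: edist_le.
Qed.

Lemma hull_body (I : finType) (p : I -> 'rV[R]_n) (i : I) : convex_body (hull p).
Proof.
by split; [exists (p i); exact: hull_pt|split; [exact: compact_hull|exact: convex_hull]].
Qed.

Lemma convex_comb_close (I : finType) (p : I -> 'rV[R]_n) A (r : R) x : convex_set A ->
  (forall i, exists2 y, A y & enorm (p i - y) <= r) -> hull p x ->
  exists2 y, A y & enorm (x - y) <= r.
Proof.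
move=> cA pr [a [a0 a1 ->]].
have /choice[q qP] i : exists y, A y /\ enorm (p i - y) <= r.
  by have [y Ay yr] := pr i; exists y.
exists (\sum_i a i *: q i).
  by apply: convex_sum => // i; have [] := qP i.
rewrite -sumrB (le_trans (enorm_sum _))// -[r]mul1r -a1 mulr_suml.
apply: ler_sum => i _; rewrite -scalerBr enormZ ger0_norm// ler_wpM2l//.
by have [] := qP i.
Qed.

Lemma hull_hausdorff (I : finType) (p q : I -> 'rV[R]_n) (i0 : I) (r : R) :
  (forall i, enorm (p i - q i) <= r) -> hausdorff_dist (hull p) (hull q) <= r.
Proof.
move=> pq; apply: hausdorff_le.
- by exists (p i0); exact: hull_pt.
- by exists (q i0); exact: hull_pt.
- move=> x; apply: convex_comb_close; first exact: convex_hull.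
  by move=> i; exists (q i) => //; exact: hull_pt.
- move=> x; apply: convex_comb_close; first exact: convex_hull.
  by move=> i; exists (p i); [exact: hull_pt|rewrite enormB].
Qed.

(** A family of points close to the corners of a cube still has a slightly smaller cube
    in its hull: a functional separating a point [y] from the hull would be violated
    at the corner selected by the signs of its coefficients. *)
Lemma cube_hull (l : {ffun 'I_n -> bool} -> 'rV[R]_n) x0 (r d : R) :
  (forall (s : {ffun 'I_n -> bool}) i,
    `|l s ord0 i - (x0 ord0 i + (if s i then - r else r))| <= d) ->
  forall y, (forall i, `|y ord0 i - x0 ord0 i| <= r - d) -> hull l y.
Proof.
move=> ld y yr; apply: contrapT => /hull_separation[c cl].
have := cl [ffun i => 0 <= c ord0 i]; rewrite ltNge => /negP; apply.
apply: ler_sum => i _; have := ld [ffun i => 0 <= c ord0 i] i; rewrite ffunE.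
have := yr i; rewrite !ler_norml => /andP[y1 y2]; case: ifPn => [c0|].
  by move=> /andP[l1 l2]; rewrite ler_wpM2l//; lra.
by rewrite -ltNge => c0 /andP[l1 l2]; rewrite ler_wnM2l// ?(ltW c0)//; lra.
Qed.

(** A point [y] within [lam * rho] of a convex set containing the ball of radius [rho]
    around [x0] lies in the dilation of the set with ratio [1 + lam] and centre [x0]:
    the contraction of [y] is a convex combination of [a] and of a point of the ball. *)
Lemma convex_expand A x0 (rho lam : R) a y : convex_set A ->
  (forall z, `|x0 - z| < rho -> A z) -> 0 < lam -> A a -> `|y - a| < lam * rho ->
  A ((1 + lam)^-1 *: y + (x0 - (1 + lam)^-1 *: x0)).
Proof.
move=> /convex_setP cA Ab l0 Aa ya.
have l1 : 0 < 1 + lam by rewrite addr_gt0.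
have -> : (1 + lam)^-1 *: y + (x0 - (1 + lam)^-1 *: x0) =
    (1 + lam)^-1 *: a + (1 - (1 + lam)^-1) *: (x0 + lam^-1 *: (y - a)).
  apply/rowP => i; rewrite !mxE; field; rewrite !gt_eqF//.
apply: cA => //; first by rewrite invr_ge0 ltW.
  by rewrite invf_le1// lerDl ltW.
by apply: Ab; rewrite opprD addNKr normrN normrZ gtr0_norm ?invr_gt0// ltr_pdivrMl.
Qed.

End norms.

Section volumes.
Context {R : realType} {n : nat}.
Local Notation mR := (measurableTypeR R).
Implicit Types (x y z : 'rV[R]_n) (A B P Q K L : set 'rV[R]_n).

(** Measurability for the measure underlying [vol], which lives on tuples. *)
Definition vmeasurable A := measurable [set t : n.-tuple mR | A (\row_i tnth t i)].

Lemma vol_ge0 A : (0 <= vol A)%E. Proof. exact: measure_ge0. Qed.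

Lemma le_vol A B : vmeasurable A -> vmeasurable B -> A `<=` B -> (vol A <= vol B)%E.
Proof. by move=> mA mB AB; apply: le_measure; rewrite ?inE// => t /AB. Qed.

Lemma vmeasurableD A B : vmeasurable A -> vmeasurable B -> vmeasurable (A `\` B).
Proof. exact: measurableD. Qed.

Lemma volD_fin A B : compact A -> compact B -> vol (A `\` B) \is a fin_num.
Proof.
move=> cA cB; have mA := measurable_compact cA; have mB := measurable_compact cB.
rewrite ge0_fin_numE ?vol_ge0//; apply: (@le_lt_trans _ _ (vol A)).
  by apply: le_vol => //; exact: vmeasurableD.
by rewrite ltey_eq compact_vol_fin.
Qed.

Lemma volU A B : vmeasurable A -> vmeasurable B -> A `&` B = set0 ->
  vol (A `|` B) = (vol A + vol B)%E.
Proof.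
move=> mA mB AB; rewrite /vol [X in lebesgue_tuple X](_ : _ =
  [set t : n.-tuple mR | A (\row_i tnth t i)] `|` [set t | B (\row_i tnth t i)])//.
apply: measureU => //; apply/seteqP; split => // t [At Bt].
by suff : set0 (\row_i tnth t i : 'rV[R]_n) by []; rewrite -AB.
Qed.

Lemma volD A B : vmeasurable A -> vmeasurable B -> A `<=` B ->
  vol B = (vol A + vol (B `\` A))%E.
Proof.
move=> mA mB AB; rewrite -volU//; [|exact: vmeasurableD|by rewrite setIDA setIC -setIDA setDv setI0].
by rewrite setDUK.
Qed.

Lemma vol_expand A x0 (lam : R) : 0 < lam -> vmeasurable A ->
  vol [set y | A ((1 + lam)^-1 *: y + (x0 - (1 + lam)^-1 *: x0))] =
  (((1 + lam) ^+ n)%:E * vol A)%E.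
Proof.
move=> l0 mA; have l1 : 0 < 1 + lam by rewrite addr_gt0.
rewrite (vol_affine (x0 - (1 + lam)^-1 *: x0) _ mA (c := (1 + lam)^-1)) ?invr_gt0//.
by rewrite muleA -EFinM -exprMn divff ?gt_eqF// expr1n mul1e.
Qed.

Lemma compact_expand A x0 (lam : R) : 0 < lam -> compact A ->
  compact [set y | A ((1 + lam)^-1 *: y + (x0 - (1 + lam)^-1 *: x0))].
Proof.
move=> l0 cA; have l1 : 1 + lam != 0 by rewrite gt_eqF// addr_gt0.
pose f (z : 'rV[R]_n) := (1 + lam) *: z - lam *: x0.
rewrite (_ : [set y | _] = f @` A).
  apply: continuous_compact => //; apply: continuous_subspaceT => z.
  apply: (@cvgB R 'rV[R]_n _ (nbhs z) (nbhs_filter z)); last exact: cvg_cst.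
  apply: (@cvgZ R 'rV[R]_n _ (nbhs z) (nbhs_filter z)); [exact: cvg_cst|exact: cvg_id].
apply/seteqP; split => y /=.
  move=> Ay; exists ((1 + lam)^-1 *: y + (x0 - (1 + lam)^-1 *: x0)) => //.
  by apply/rowP => i; rewrite !mxE; field.
move=> [z Az <-]; suff -> : (1 + lam)^-1 *: f z + (x0 - (1 + lam)^-1 *: x0) = z by [].
by apply/rowP => i; rewrite !mxE; field.
Qed.

Lemma pow_near1 (m : nat) (e : R) : 0 < e -> exists2 l : R, 0 < l <= 1 & (1 + l) ^+ m <= 1 + e.
Proof.
elim: m e => [|m IH] e e0.
  by exists 1; rewrite ?ltr01 ?lexx// expr0 lerDl ltW.
pose a := Num.min (e / 3) 1.
have a0 : 0 < a by rewrite lt_min divr_gt0//=.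
have ae : a <= e / 3 by rewrite ge_min lexx.
have a1 : a <= 1 by rewrite ge_min lexx orbT.
have [l /andP[l0 l1] lm] := IH a a0.
have min0 : 0 < Num.min l a by rewrite lt_min l0.
exists (Num.min l a); first by rewrite min0 ge_min l1.
rewrite exprS; apply: (@le_trans _ _ ((1 + a) * (1 + a))).
  apply: ler_pM; [by rewrite addr_ge0// ltW|by rewrite exprn_ge0// addr_ge0// ltW| |].
    by rewrite lerD2l ge_min lexx orbT.
  apply: le_trans lm; apply: lerXn2r; rewrite ?nnegrE ?addr_ge0 ?(ltW l0) ?(ltW min0)//.
  by rewrite lerD2l ge_min lexx.
have : a * a <= a by rewrite ler_piMr// ltW.
by rewrite mulrDl mul1r mulrDr mulr1; lra.
Qed.

(** The part of [L] outside [K] lies in a dilation of [K] with ratio [1 + lam]. *)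
Lemma vol_neighbourhood_setD K L x0 (rho lam : R) : compact K -> compact L -> convex_set K ->
  (forall z, `|x0 - z| < rho -> K z) -> 0 < lam ->
  (forall y, L y -> exists2 a, K a & `|y - a| < lam * rho) ->
  (vol (L `\` K) <= ((1 + lam) ^+ n - 1)%:E * vol K)%E.
Proof.
move=> cK cL vK Kb l0 LK.
set B := [set y | K ((1 + lam)^-1 *: y + (x0 - (1 + lam)^-1 *: x0))].
have LB : L `<=` B by move=> y /LK[a Ka ya]; exact: (convex_expand vK Kb l0 Ka ya).
have [->|/set0P[y0 Ly0]] := eqVneq L set0.
  rewrite set0D [X in (X <= _)%E](_ : _ = 0%E); last exact: measure0.
  by rewrite mule_ge0 ?vol_ge0// lee_fin subr_ge0 exprn_ege1// lerDl ltW.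
have lr0 : 0 < lam * rho by have [a _ ya] := LK _ Ly0; exact: le_lt_trans ya.
have KB : K `<=` B.
  by move=> y Ky; apply: (convex_expand vK Kb l0 Ky); rewrite subrr normr0.
have mK := measurable_compact cK; have mL := measurable_compact cL.
have mB : vmeasurable B := measurable_compact (@compact_expand K x0 lam l0 cK).
have := @vol_expand K x0 lam l0 mK; rewrite -/B (volD mK mB KB) => BE.
have fK := compact_vol_fin cK.
apply: (@le_trans _ _ (vol (B `\` K))).
  by apply: le_vol; [exact: vmeasurableD|exact: vmeasurableD|exact: setSD].
rewrite EFinB muleBl// mul1e -BE addeAC subee// add0e//.
Qed.

(** Near a proper body the Hausdorff distance controls the symmetric difference
    distance. A body [L] close to [K] contains a ball of about the same size as [K]
    does, as it comes close to the corners of a cube inside [K]; then each of the two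
    bodies lies in a small dilation of the other. *)
Lemma symm_diff_dist_close K (e : R) : proper_convex_body K -> 0 < e ->
  exists2 d : R, 0 < d & forall L, convex_body L -> hausdorff_dist K L < d ->
    proper_convex_body L /\ symm_diff_dist K L < e.
Proof.
move=> [bK [x0 /nbhs_ballP[r/= r0 rK]]] e0.
have [_ [cK vK]] := bK.
pose V := fine (vol K); have V0 : 0 <= V by rewrite fine_ge0// vol_ge0.
(* The two volume differences will be at most e' V and 2 e' V. *)
pose e' := Num.min 1 (e / (3 * (V + 1))).
have e'0 : 0 < e' by rewrite lt_min ltr01 divr_gt0// mulr_gt0// ltr_wpDl.
have [lam /andP[l0 l1] lamn] := pow_near1 n e'0.
pose rho := r / 4; have rho0 : 0 < rho by rewrite divr_gt0.
exists (lam * rho); first by rewrite mulr_gt0.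
move=> L bL KL; have [_ [cL vL]] := bL.
have KLn x : K x -> exists2 y, L y & `|x - y| < lam * rho.
  move=> /(hausdorff_pt bK bL KL)[y Ly xy]; exists y => //.
  exact: le_lt_trans (norm_le_enorm _) xy.
have LKn x : L x -> exists2 y, K y & `|x - y| < lam * rho.
  rewrite hausdorff_distC in KL.
  move=> /(hausdorff_pt bL bK KL)[y Ly xy]; exists y => //.
  exact: le_lt_trans (norm_le_enorm _) xy.
have Kb z : `|x0 - z| < rho -> K z.
  move=> xz; apply: rK; apply/ball_norm; apply: lt_le_trans xz _.
  by rewrite ler_pdivrMr// ler_peMr ?(ltW r0)//; lra.
have Lb z : `|x0 - z| < rho -> L z.
  move=> xz; pose q (s : {ffun 'I_n -> bool}) : 'rV[R]_n :=
    x0 + \row_i (if s i then - (r / 2) else r / 2).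
  have Kq s : K (q s).
    apply: rK; split => // i j; rewrite ord1 /ball/= /q !mxE opprD addNKr normrN.
    have -> : `|if s j then - (r / 2) else r / 2| = r / 2.
      by case: (s j); rewrite ?normrN ger0_norm// divr_ge0// ltW.
    by rewrite ltr_pdivrMr// ltr_pMr//; lra.
  have /choice[l lP] s : exists y, L y /\ `|q s - y| < lam * rho.
    by have [y Ly qy] := KLn _ (Kq s); exists y.
  have : hull l z.
    apply: (@cube_hull _ _ _ x0 (r / 2) rho).
      move=> s i; have [_ /ltW] := lP s => ql.
      have qE : q s ord0 i = x0 ord0 i + (if s i then - (r / 2) else r / 2) by rewrite !mxE.
      rewrite -qE (le_trans _ (le_trans ql _))//; last by rewrite ler_piMl// ltW.
      by rewrite distrC; have := coord_le_norm (q s - l s) i; rewrite !mxE.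
    move=> i; rewrite distrC; apply: (@le_trans _ _ `|x0 - z|).
      by have := coord_le_norm (x0 - z) i; rewrite !mxE.
    by rewrite (le_trans (ltW xz))// /rho; lra.
  by apply: hull_sub => // s; have [] := lP s.
have pL : proper_convex_body L.
  split => //; exists x0; apply/nbhs_ballP; exists rho => //= z /ball_norm; exact: Lb.
split => //.
have LK := vol_neighbourhood_setD cK cL vK Kb l0 LKn.
have KL' := vol_neighbourhood_setD cL cK vL Lb l0 KLn.
have fK := compact_vol_fin cK; have fL := compact_vol_fin cL.
have mK := measurable_compact cK; have mL := measurable_compact cL.
have fLK := volD_fin cL cK; have fKL := volD_fin cK cL.
have LV : (vol L <= vol K + vol (L `\` K))%E.
  rewrite -volU//; [|exact: vmeasurableD|by rewrite setIDA setIC -setIDA setDv setI0].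
  apply: le_vol => //; first by apply: measurableU => //; exact: vmeasurableD.
  by move=> y Ly; have [Ky|Ky] := pselect (K y); [left|right].
rewrite /symm_diff_dist fineD//.
move: LK KL' LV; rewrite -(fineK fK) -(fineK fL) -(fineK fLK) -(fineK fKL) -!EFinM -EFinD !lee_fin /= -/V.
set a := fine (vol (L `\` K)); set b := fine (vol (K `\` L)); set W := fine (vol L) => LK KL' LV.
have u1 : (1 + lam) ^+ n - 1 <= e' by rewrite lerBlDl.
have e'1 : e' <= 1 by rewrite ge_min lexx.
have W0 : 0 <= W by rewrite fine_ge0// vol_ge0.
have LK2 : a <= e' * V by apply: (le_trans LK); rewrite ler_wpM2r.
have KL2 : b <= e' * W by apply: (le_trans KL'); rewrite ler_wpM2r.
have V2 : e' * V <= V by rewrite ler_piMl.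
have W2 : e' * W <= 2 * (e' * V).
  by rewrite mulrCA ler_wpM2l ?(ltW e'0)//; lra.
apply: (@le_lt_trans _ _ (3 * (e' * V))); first by move: (e' * W) (e' * V) W2 LK2 KL2 => p q; lra.
have V10 : 0 < V + 1 by rewrite ltr_wpDl.
apply: (@le_lt_trans _ _ (3 * ((e / (3 * (V + 1))) * V))).
  by rewrite ler_pM2l// ler_wpM2r// ge_min lexx orbT.
have -> : 3 * (e / (3 * (V + 1)) * V) = e * (V / (V + 1)) by field; rewrite gt_eqF.
by rewrite gtr_pMr// ltr_pdivrMr// mul1r ltrDl.
Qed.
End volumes.

(** * Completeness for the Hausdorff distance *)

Section fast_sequences.
Context {R : realType}.

Lemma pow2_split (k : nat) : (2 : R) ^- k = 2 ^- k.+1 + 2 ^- k.+1.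
Proof. by rewrite exprS; field; rewrite expf_neq0. Qed.

Lemma pow2_gt0 (k : nat) : (0 : R) < 2 ^- k.
Proof. by rewrite invr_gt0 exprn_gt0. Qed.

Lemma pow2_le (k m : nat) : (k <= m)%N -> (2 : R) ^- m <= 2 ^- k.
Proof. by move=> km; rewrite lef_pV2 ?posrE ?exprn_gt0// ler_weXn2l// ler1n. Qed.

Lemma pow2_small (e : R) : 0 < e -> exists k : nat, 2 ^- k < e.
Proof.
move=> e0; have [k ke] : exists k : nat, k.+1%:R^-1 < e.
  near \oo => k; exists k; near: k.
  exact: (near_infty_natSinv_lt (PosNum e0)).
exists k; apply: le_lt_trans ke; rewrite lef_pV2 ?posrE ?exprn_gt0// -natrX ler_nat.
exact: ltn_expl.
Unshelve. all: by end_near. Qed.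

(** Stated for a bare function [d] so as to apply to distances between sets. *)
Lemma fast_dist (d : nat -> nat -> R) :
  (forall i, d i i = 0) -> (forall i, d i i.+1 <= 2 ^- i) ->
  (forall i j k, d i k <= d i j + d j k) ->
  forall k j, d k (k + j)%N < 2 ^- k + 2 ^- k.
Proof.
move=> d0 d1 dt k j; suff : d k (k + j)%N <= 2 ^- k + 2 ^- k - 2 ^- (k + j) * 2.
  by move/le_lt_trans; apply; rewrite gtrBl mulr_gt0// pow2_gt0.
elim: j => [|j IH]; first by rewrite addn0 d0 mulr_natr mulr2n subrr.
rewrite (le_trans (dt _ (k + j)%N _))// addnS; move: (d1 (k + j)%N) IH.
rewrite (pow2_split (k + j)); lra.
Qed.

(** A Cauchy filter is driven by a sequence of centres of balls of radius [2 ^- k.+1]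
    that belong to it, and two such balls meet. *)
Lemma complete_fast (T : metricType R) :
  (forall u : nat -> T, (forall k, mdist (u k) (u k.+1) <= 2 ^- k) ->
    exists x, forall e, 0 < e -> exists k0, forall k, (k0 <= k)%N -> mdist (u k) x < e) ->
  complete_space T.
Proof.
move=> fast F FF /cauchyP Fc.
have /choice[u uF] k : exists x, F (ball x (2 ^- k.+1 : R)) by apply: Fc; exact: pow2_gt0.
have [|x ux] := fast u.
  move=> k; have [y [/=]] := @filter_ex _ _ FF _ (filterI (uF k) (uF k.+1)).
  rewrite !ballEmdist /= => uy u1y; rewrite (le_trans (metric_triangle _ y _))//.
  rewrite pow2_split lerD ?ltW// metric_sym (lt_trans u1y)//.
  by rewrite (pow2_split k.+1) ltrDl pow2_gt0.
exists x => A /nbhs_ballP[e/= e0 eA].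
have e20 : 0 < e / 2 by rewrite divr_gt0.
have [k1 k1e] := pow2_small e20; have [k0 k0x] := ux _ e20.
apply: filterS (uF (maxn k0 k1)) => y; rewrite ballEmdist/= => uy; apply: eA.
rewrite ballEmdist/= (le_lt_trans (metric_triangle _ (u (maxn k0 k1)) _))//.
rewrite (splitr e) ltrD//; first by rewrite metric_sym k0x// leq_maxl.
apply: (lt_le_trans uy); apply: le_trans (ltW k1e).
apply: pow2_le; rewrite (leq_trans (leq_maxr k0 k1))//.
Qed.

End fast_sequences.

Section hausdorff_complete.
Context {R : realType} {n : nat}.
Implicit Types (x y z : 'rV[R]_n) (A B P Q K L : set 'rV[R]_n).

Definition thicken A (r : R) := [set x | exists2 y, A y & enorm (x - y) <= r].

Lemma convex_thicken A r : convex_set A -> convex_set (thicken A r).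
Proof.
move=> /convex_setP cA; apply/convex_setP => x1 x2 t t0 t1 [y1 Ay1 xy1] [y2 Ay2 xy2].
exists (t *: y1 + (1 - t) *: y2); first exact: cA.
have -> : t *: x1 + (1 - t) *: x2 - (t *: y1 + (1 - t) *: y2) =
  t *: (x1 - y1) + (1 - t) *: (x2 - y2) by rewrite opprD addrACA !scalerBr.
have t1' : 0 <= 1 - t by rewrite subr_ge0.
rewrite (le_trans (ler_enormD _ _))// !enormZ !ger0_norm//.
have -> : r = t * r + (1 - t) * r by rewrite -mulrDl addrC subrK mul1r.
by rewrite lerD// ler_wpM2l.
Qed.

Lemma continuous_enorm : continuous (@enorm R n).
Proof.
move=> x; apply/(@cvgrPdist_lt _ _ _ (nbhs x) (nbhs_filter x)) => e e0.
have d0 : 0 < n.+1%:R^-1 * e :> R by rewrite mulr_gt0// invr_gt0.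
apply: filterS (nbhsx_ballx x _ d0) => y /ball_norm; rewrite ltr_pdivlMl// => xy.
have : enorm (x - y) < e.
  apply: (le_lt_trans (enorm_le_norm _)); apply: le_lt_trans xy.
  by rewrite ler_wpM2r// ler_nat.
apply: le_lt_trans; rewrite ler_norml; apply/andP; split.
  by have := ler_enormD (y - x) x; rewrite subrK (enormB y); lra.
by have := ler_enormD (x - y) y; rewrite subrK; lra.
Qed.

(** The thickening is the Minkowski sum with a closed Euclidean ball. *)
Lemma compact_thicken A r : compact A -> compact (thicken A r).
Proof.
move=> cA; pose B := [set z : 'rV[R]_n | enorm z <= r].
have cB : compact B.
  apply: bounded_closed_compact.
    exists r; split; first exact: num_real.
    by move=> x rx z Bz; apply: (le_trans (norm_le_enorm z)); exact: le_trans Bz (ltW rx).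
  rewrite (_ : B = (@enorm R n) @^-1` [set y | y <= r])//.
  by apply: closed_comp; [move=> x _; exact: continuous_enorm|exact: closed_le].
rewrite (_ : thicken A r = (fun z : 'rV[R]_n * 'rV[R]_n => z.1 + z.2) @` (A `*` B)).
  apply: continuous_compact; last exact: compact_setX.
  by apply: continuous_subspaceT => z; exact: add_continuous.
apply/seteqP; split => x.
  by move=> [y Ay xy]; exists (y, x - y) => //=; rewrite addrC subrK.
by move=> [[y z] [/= Ay Bz] <-]; exists y => //; rewrite addrAC subrr add0r.
Qed.

(** The limit consists of the points that belong to all thickenings of the [u k] by the
    tails of the geometric series. These are compact, so a sequence of points of the
    [u j] that stays near a point [y] of [u k] has a cluster point, which lies in the
    limit. *)
Lemma hausdorff_fast_limit (u : nat -> set 'rV[R]_n) : (forall k, convex_body (u k)) ->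
  (forall k, hausdorff_dist (u k) (u k.+1) <= 2 ^- k) ->
  exists2 K, convex_body K & forall k, hausdorff_dist (u k) K <= 2 ^- k + 2 ^- k.
Proof.
move=> bu u1; pose r k : R := 2 ^- k + 2 ^- k.
have du k j : hausdorff_dist (u k) (u (k + j)%N) < r k.
  apply: (fast_dist (d := fun i j => hausdorff_dist (u i) (u j))).
  - by move=> i; exact: hausdorff_distxx.
  - exact: u1.
  - by move=> a b c; exact: hausdorff_dist_triangle.
pose K := [set x | forall k, thicken (u k) (r k) x].
have Kc k : K `<=` thicken (u k) (r k) by move=> x; exact.
have cu k : compact (thicken (u k) (r k)) by apply: compact_thicken; have [_ []] := bu k.
have near_limit k y : u k y -> exists2 x, K x & enorm (y - x) <= r k.
  move=> uy.
  have /choice[v vP] j : exists v, u (k + j)%N v /\ enorm (y - v) < r k.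
    by have [v uv yv] := hausdorff_pt (bu k) (bu (k + j)%N) (du k j) uy; exists v.
  have [x [xk clx]] : thicken [set y] (r k) `&` cluster (v @ \oo) !=set0.
    apply: (@compact_thicken [set y] (r k) (@compact_set1 _ y)).
    exists 0%N => // j _; exists y => //; rewrite enormB.
    by have [_ /ltW] := vP j.
  exists x; last by move: xk => [z /= ->]; rewrite enormB.
  move=> m; apply: (compact_closed_rV (cu m)).
  move=> B xB; apply: clx => //.
  exists m => // j /= mj; have [uv _] := vP j.
  have [t tm] : exists t, (k + j)%N = (m + t)%N.
    by exists (k + j - m)%N; rewrite subnKC// (leq_trans mj)// leq_addl.
  have := du m t; rewrite hausdorff_distC -tm => dm.
  have [z uz vz] := hausdorff_pt (bu _) (bu m) dm uv.
  by exists z => //; exact: ltW.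
have K0 : K !=set0.
  by have [[y uy] _] := bu 0%N; have [x Kx _] := near_limit _ _ uy; exists x.
exists K.
  split => //; split.
    apply: (subclosed_compact _ (cu 0%N) (Kc 0%N)).
    rewrite (_ : K = \bigcap_k thicken (u k) (r k)).
      by apply: closed_bigI => k _; exact: compact_closed_rV.
    by apply/seteqP; split => x Kx k; [move=> _; exact: Kx|exact: Kx].
  apply/convex_setP => x y t t0 t1 Kx Ky k.
  have /convex_setP : convex_set (thicken (u k) (r k)).
    by apply: convex_thicken; have [_ []] := bu k.
  by apply.
move=> k; apply: hausdorff_le => //; [by case: (bu k)|exact: near_limit|].
by move=> y /(Kc k)[x ux yx]; exists x.
Qed.

Lemma bodies_complete : complete_space (bodies R n).
Proof.
apply: complete_fast => u u1.
have bu k : convex_body (\val (u k)) by exact: set_valP.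
have [K bK Ku] := hausdorff_fast_limit bu u1.
have [b bE] : exists b : bodies R n, \val b = K.
  by exists (SigSub (mem_set bK)).
exists b => e e0; have [k0 k0e] := pow2_small (divr_gt0 e0 (ltr0Sn R 1)).
exists k0 => k k0k; rewrite bodies_mdistE bE (le_lt_trans (Ku k))//.
rewrite (splitr e) ltrD// (le_lt_trans (pow2_le k0k))//.
Qed.

End hausdorff_complete.

(** * Convex sets of positive volume *)

Section packing.
Context {R : realType} {n : nat}.
Local Notation mR := (measurableTypeR R).
Implicit Types (x y z w : 'rV[R]_n) (A B C P Q K L : set 'rV[R]_n).

Lemma vol0 : vol (set0 : set 'rV[R]_n) = 0%E.
Proof. exact: measure0. Qed.

Lemma vmeasurableU A B : vmeasurable A -> vmeasurable B -> vmeasurable (A `|` B).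
Proof. exact: measurableU. Qed.

Lemma vmeasurable_affine A (c : R) b : vmeasurable A ->
  vmeasurable [set x | A (c *: x + b)].
Proof.
move=> mA; have := measurable_affine c b measurableT mA; rewrite setTI.
by congr measurable; apply/seteqP; split => t /=; congr A; apply/rowP => i;
  rewrite !mxE tnth_mktuple.
Qed.

Lemma vmeasurable_shift A b : vmeasurable A -> vmeasurable [set x | A (x + b)].
Proof.
by move=> /(@vmeasurable_affine A 1 b); congr vmeasurable; apply/seteqP; split => x /=; rewrite scale1r.
Qed.

Lemma vol_shift A b : vmeasurable A -> vol [set x | A (x + b)] = vol A.
Proof.
move=> mA; rewrite (vol_affine b ltr01 mA) expr1n mul1e; congr vol.
by apply/seteqP; split => x /=; rewrite scale1r.
Qed.

(** After a shift, disjointness of two translates by multiples of [w] becomes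
    disjointness of [A] and one translate of it. *)
Lemma vol_disjoint_translates A C w (N : nat) : vmeasurable A -> vmeasurable C ->
  (forall a i, A a -> (i < N)%N -> C (a + i%:R *: w)) ->
  (forall a a' k, A a -> A a' -> (0 < k < N)%N -> a + k%:R *: w <> a') ->
  ((N%:R)%:E * vol A <= vol C)%E.
Proof.
move=> mA mC AC disj.
pose B i := [set x | A (x - i%:R *: w)].
have mB i : vmeasurable (B i) := vmeasurable_shift (- (i%:R *: w)) mA.
pose F k := [set x | exists2 i, (i < k)%N & B i x].
have FS k : F k.+1 = F k `|` B k.
  apply/seteqP; split => x.
    by move=> [i]; rewrite ltnS leq_eqVlt => /orP[/eqP ->|ik]; [right|left; exists i].
  by move=> [[i ik Bx]|Bx]; [exists i => //; rewrite ltnS ltnW|exists k].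
have [mF FE] : vmeasurable (F N) /\ vol (F N) = ((N%:R)%:E * vol A)%E.
  have : (N <= N)%N by [].
  elim: {-2}N => [|k IH] kN.
    have -> : F 0%N = set0 by apply/seteqP; split => // x [].
    by split; [exact: measurable0|rewrite mul0e; exact: measure0].
  have [mF FE] := IH (ltnW kN); rewrite FS; split; first exact: vmeasurableU.
  rewrite volU//; first by rewrite FE vol_shift// -addn1 natrD EFinD ge0_muleDl// mul1e.
  apply/seteqP; split => // x [[i ik Bx] Bkx].
  apply: (disj _ _ (k - i)%N Bkx Bx).
    by rewrite subn_gt0 ik (leq_ltn_trans (leq_subr _ _)).
  by rewrite natrB ?(ltnW ik)// scalerBl addrA subrK.
rewrite -FE; apply: le_vol => // x [i iN Bx].
by have := AC _ _ Bx iN; rewrite subrK.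
Qed.

(** Arbitrarily many disjoint translates of [A] fit in a set of finite volume. *)
Lemma vol0_of_translates A C w : vmeasurable A -> vmeasurable C -> vol C \is a fin_num ->
  (forall N i a, A a -> (i < N)%N -> C (a + (i%:R / N%:R) *: w)) ->
  (forall t a a', A a -> A a' -> 0 < t -> a + t *: w <> a') -> vol A = 0%E.
Proof.
move=> mA mC fC AC disj.
have translatesN N : (N%:R%:E * vol A <= vol C)%E.
  apply: (@vol_disjoint_translates _ _ (N%:R^-1 *: w)) => // [a i Aa iN|a a' k Aa Aa' /andP[k0 kN]].
    by rewrite scalerA; exact: AC.
  rewrite scalerA; apply: disj => //.
  by rewrite divr_gt0// ltr0n//; exact: leq_trans k0 (ltnW kN).
have fA : vol A \is a fin_num.
  have := translatesN 1%N; rewrite mul1e ge0_fin_numE ?vol_ge0// => /le_lt_trans; apply.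
  by rewrite ltey_eq fC.
apply/eqP; rewrite eq_le vol_ge0 andbT -(fineK fA) lee_fin leNgt; apply/negP => A0.
pose N := (Num.truncn (fine (vol C) / fine (vol A))).+1.
have := translatesN N; rewrite -(fineK fA) -(fineK fC) -EFinM lee_fin leNgt => /negP; apply.
by rewrite -ltr_pdivrMr//; exact: truncnS_gt.
Qed.

(** Linearly independent vectors [x - x0] are chosen one after the other, each outside
    the hyperplane of a vector orthogonal to the previous ones, until there are [n] of
    them and they span a simplex. *)
Lemma convex_interior_or_flat K x0 : convex_set K -> K x0 ->
  K° !=set0 \/ exists2 c, c != 0 & forall x, K x -> dot c (x - x0) = 0.
Proof.
move=> cK Kx0.
have [flat|noflat] := pselect (exists2 c, c != 0 & forall x, K x -> dot c (x - x0) = 0).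
  by right.
left.
have ex k : (k <= n)%N -> exists2 A : 'M[R]_(k, n), row_free A & forall i, K (x0 + row i A).
  elim: k => [|k IH] kn; first by exists 0; [rewrite /row_free mxrank0|case].
  have [A fA KA] := IH (ltnW kn).
  have : kermx A^T != 0.
    rewrite -mxrank_eq0 mxrank_ker mxrank_tr -lt0n subn_gt0.
    by rewrite (leq_ltn_trans (rank_leq_row A)).
  move=> /rowV0Pn[c /sub_kermxP cA c0].
  have [x [Kx cx]] : exists x, K x /\ dot c (x - x0) <> 0.
    apply: contrapT => nox; apply: noflat; exists c => // x Kx.
    by apply: contrapT => cx; apply: nox; exists x.
  rewrite -addn1; exists (col_mx A (x - x0)).
    rewrite -kermx_eq0; apply/eqP/row_matrixP => i; rewrite row0.
    set y := row i _; have : y *m col_mx A (x - x0) = 0.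
      by rewrite /y -row_mul mulmx_ker row0.
    rewrite -[y]hsubmxK mul_row_col => yA.
    have y2 : rsubmx y = 0.
      have := congr1 (mulmx^~ c^T) yA; rewrite mulmxDl mul0mx -!mulmxA.
      have -> : A *m c^T = 0 by rewrite -[A]trmxK -trmx_mul cA trmx0.
      have -> : (x - x0) *m c^T = (dot c (x - x0))%:M.
        apply/matrixP => a b; rewrite !ord1 !mxE eqxx mulr1n; apply: eq_bigr => j _.
        by rewrite !mxE mulrC.
      rewrite mulmx0 add0r mul_mx_scalar => /eqP; rewrite scaler_eq0 => /orP[/eqP//|/eqP //].
    move: yA; rewrite y2 mul0mx addr0 => /eqP; rewrite mulmx_free_eq0// => /eqP ->.
    by rewrite row_mx0.
  move=> i; rewrite -[i]splitK; case: (fintype.split i) => j /=.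
    by rewrite rowKu.
  by rewrite rowKd row_id// addrC subrK.
have [A fA KA] := ex n (leqnn n).
have uA : A \in unitmx by rewrite -row_free_unit.
apply: (@convex_interior _ _ K x0 (fun i => row i (invmx A)^T) (fun i => row i A)) => //.
move=> i j; have := mulmxV uA => /matrixP/(_ j i); rewrite !mxE eq_sym => <-.
by apply: eq_bigr => k _; rewrite !mxE mulrC.
Qed.

(** A flat set has infinitely many disjoint translates in its normal direction. *)
Lemma vol_interior K : compact K -> convex_set K -> (0 < vol K)%E -> K° !=set0.
Proof.
move=> cK vK K0.
have [x0 Kx0] : K !=set0.
  by apply/set0P/eqP => Ke; move: K0; rewrite Ke vol0 ltxx.
have [//|[c c0 cflat]] := convex_interior_or_flat vK Kx0.
have cc : 0 < dot c c.
  by rewrite lt_neqAle dot_ge0 andbT eq_sym; apply: contra c0 => /eqP /dot_eq0 ->.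
suff K00 : vol K = 0%E by rewrite K00 ltxx in K0.
have cC := compact_thicken (r := enorm c) cK.
apply: (@vol0_of_translates K (thicken K (enorm c)) c).
- exact: measurable_compact.
- exact: measurable_compact.
- exact: compact_vol_fin.
- move=> N i a Ka iN; exists a => //; rewrite addrC addKr enormZ ler_piMl ?enorm_ge0//.
  rewrite ger0_norm ?divr_ge0// ler_pdivrMr ?mul1r ?ler_nat 1?ltnW//.
  by rewrite ltr0n; exact: leq_ltn_trans iN.
- move=> t a a' Ka Ka' t0 aa'.
  have := cflat _ Ka'; rewrite -aa' addrAC dotDr (cflat _ Ka) add0r dotZr => /eqP.
  by rewrite mulf_eq0 !gt_eqF.
Qed.

End packing.

(** * Completeness for the symmetric difference distance *)

Section volume_complete.
Context {R : realType} {n : nat}.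
Local Notation mR := (measurableTypeR R).
Implicit Types (x y z w : 'rV[R]_n) (A B C P Q K L : set 'rV[R]_n).

(** A far point of the set would leave room, inside the set, for many disjoint
    translates of a half-size ball along the first half of the segment towards it. *)
Lemma convex_bounded L x0 (rho : R) : convex_set L -> vmeasurable L ->
  vol L \is a fin_num -> 0 < rho -> (forall z, `|x0 - z| < rho -> L z) ->
  exists T : R, forall y, L y -> `|x0 - y| <= T.
Proof.
move=> /convex_setP cL mL fL r0 bL.
(* Half of the radius, since a translate at parameter s <= 1/2 must fit in the
   ball of radius (1 - s) rho. *)
pose A := ball x0 (rho / 2); have r20 : 0 < rho / 2 by rewrite divr_gt0.
have mA : vmeasurable A by apply: measurable_rV_open; exact: ball_open.
have AL : A `<=` L.
  by move=> z /ball_norm xz; apply: bL; rewrite (lt_trans xz)// ltr_pdivrMr// ltr_pMr//; lra.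
have A0 : (0 < vol A)%E by apply: (@ball_vol_gt0 _ _ x0 _ A r20).
have fA : vol A \is a fin_num.
  rewrite ge0_fin_numE ?vol_ge0//; apply: (@le_lt_trans _ _ (vol L)); first exact: le_vol.
  by rewrite ltey_eq fL.
have fA0 : 0 < fine (vol A) by rewrite fine_gt0// A0 ltey_eq fA.
pose N := (Num.truncn (fine (vol L) / fine (vol A))).+1.
exists (2 * N%:R * rho) => y Ly; rewrite leNgt; apply/negP => yT.
have N0 : 0 < 2 * N%:R :> R by rewrite mulr_gt0.
pose w := (2 * N%:R)^-1 *: (y - x0).
have rw : rho < `|w|.
  by rewrite normrZ gtr0_norm ?invr_gt0// ltr_pdivlMl// distrC.
have := @vol_disjoint_translates _ _ A L w N mA mL.
have AL_shift : forall a i, A a -> (i < N)%N -> L (a + i%:R *: w).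
  move=> a i /ball_norm Aa iN; pose s : R := i%:R / (2 * N%:R).
  have s0 : 0 <= s by rewrite divr_ge0// ltW.
  have s1 : s <= 1 / 2.
    rewrite /s ler_pdivrMr//; have -> : 1 / 2 * (2 * N%:R) = N%:R :> R by field.
    by rewrite ler_nat ltnW.
  have s2 : 0 < 1 - s by lra.
  have -> : a + i%:R *: w = s *: y + (1 - s) *: (x0 + (1 - s)^-1 *: (a - x0)).
    rewrite /w scalerA -/s; apply/rowP => k; rewrite !mxE; field.
    by rewrite gt_eqF.
  apply: cL => //; first lra.
  apply: bL; rewrite opprD addNKr normrN normrZ gtr0_norm ?invr_gt0// ltr_pdivrMl//.
  rewrite distrC (lt_le_trans Aa)// mulrC ler_pM2r//; lra.
have disj : forall a a' k, A a -> A a' -> (0 < k < N)%N -> a + k%:R *: w <> a'.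
  move=> a a' k /ball_norm Aa /ball_norm Aa' /andP[k0 _] aa'.
  have : `|k%:R *: w| < rho.
    have -> : k%:R *: w = (x0 - a) - (x0 - a').
      by rewrite -aa' !opprD !opprK addrACA subrr add0r addKr.
    by rewrite (le_lt_trans (ler_normB _ _))// (splitr rho) ltrD.
  rewrite normrZ normr_nat ltNge => /negP; apply.
  rewrite (le_trans (ltW rw))// ler_peMl//.
  by rewrite ler1n.
move=> /(_ AL_shift disj); rewrite -(fineK fA) -(fineK fL) -EFinM lee_fin leNgt => /negP; apply.
by rewrite -ltr_pdivrMr//; exact: truncnS_gt.
Qed.

Lemma volU_le A B : vmeasurable A -> vmeasurable B -> (vol (A `|` B) <= vol A + vol B)%E.
Proof. by move=> mA mB; apply: measureU2. Qed.

Lemma closure_norm L y : closure L y <-> forall e : R, 0 < e -> exists2 a, L a & `|y - a| < e.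
Proof.
split=> [Ly e e0|Ly B /nbhs_ballP[e/= e0 eB]].
  by have [a [La /ball_norm ya]] := Ly _ (nbhsx_ballx y e e0); exists a.
by have [a La ya] := Ly e e0; exists a; split => //; apply/eB/ball_norm.
Qed.

Lemma convex_closure L : convex_set L -> convex_set (closure L).
Proof.
move=> /convex_setP cL; apply/convex_setP => x y t t0 t1 /closure_norm Lx /closure_norm Ly.
apply/closure_norm => e e0; have [a La xa] := Lx _ e0; have [b Lb yb] := Ly _ e0.
exists (t *: a + (1 - t) *: b); first exact: cL.
have -> : t *: x + (1 - t) *: y - (t *: a + (1 - t) *: b) =
  t *: (x - a) + (1 - t) *: (y - b) by rewrite opprD addrACA !scalerBr.
have t1' : 0 <= 1 - t by rewrite subr_ge0.
rewrite (le_lt_trans (ler_normD _ _))// !normrZ !ger0_norm//.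
have [t00|tn0] := eqVneq t 0; first by rewrite t00 mul0r add0r subr0 mul1r.
have tp : 0 < t by rewrite lt_neqAle eq_sym tn0.
have -> : e = t * e + (1 - t) * e by rewrite -mulrDl addrC subrK mul1r.
by rewrite ltr_leD// ?ltr_pM2l// ler_wpM2l// ltW.
Qed.

Lemma compact_closure L x0 (T : R) : (forall y, L y -> `|x0 - y| <= T) -> compact (closure L).
Proof.
move=> bL; apply: bounded_closed_compact; last exact: closed_closure.
exists (`|x0| + T + 1); split; first exact: num_real.
move=> M MT y /closure_norm/(_ 1 ltr01)[a La ya].
apply: (le_trans _ (ltW MT)).
have -> : y = (y - a) - (x0 - a) + x0 by rewrite opprB addrA subrK subrK.
have := bL _ La; have := ler_normD (y - a - (x0 - a)) x0; have := ler_normB (y - a) (x0 - a).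
by move: ya; lra.
Qed.

(** The closure lies in all dilations of the set with ratio greater than one, centred
    at an interior point. *)
Lemma vol_closure L x0 (rho : R) : convex_set L -> vmeasurable L -> vol L \is a fin_num ->
  0 < rho -> (forall z, `|x0 - z| < rho -> L z) -> compact (closure L) ->
  vol (closure L `\` L) = 0%E.
Proof.
move=> cL mL fL r0 bL cK; set K := closure L.
have mK : vmeasurable K := measurable_compact cK.
have LK : L `<=` K by exact: subset_closure.
have KL : (vol K <= vol L)%E.
  apply/lee_addgt0Pr => e e0.
  have V0 : 0 < fine (vol L) + 1 by rewrite ltr_wpDl// fine_ge0 ?vol_ge0.
  have [lam /andP[l0 _] lamn] := pow_near1 n (divr_gt0 e0 V0).
  apply: (@le_trans _ _ (((1 + lam) ^+ n)%:E * vol L)%E).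
    rewrite -(vol_expand x0 l0 mL); apply: le_vol => //; first exact: vmeasurable_affine.
    move=> y /closure_norm/(_ (lam * rho)); rewrite mulr_gt0// => /(_ isT)[a La ya].
    exact: (convex_expand cL bL l0 La ya).
  rewrite -(fineK fL) -EFinM -EFinD lee_fin.
  apply: (@le_trans _ _ ((1 + e / (fine (vol L) + 1)) * fine (vol L))).
    by rewrite ler_wpM2r// fine_ge0 ?vol_ge0.
  rewrite mulrDl mul1r lerD2l mulrAC -mulrA ler_piMr ?(ltW e0)//.
  by rewrite ler_pdivrMr// mul1r lerDl.
move: KL; rewrite (volD mL mK LK) -[X in (_ <= X)%E]adde0 leeD2lE// => KL0.
by apply/eqP; rewrite eq_le KL0 vol_ge0.
Qed.

Lemma vol_bigcup_le (F : nat -> set 'rV[R]_n) (c : \bar R) : (forall k, vmeasurable (F k)) ->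
  (forall k, F k `<=` F k.+1) -> (forall k, (vol (F k) <= c)%E) ->
  vmeasurable (\bigcup_k F k) /\ (vol (\bigcup_k F k) <= c)%E.
Proof.
move=> mF ndF Fc; pose G k := [set t : n.-tuple mR | F k (\row_i tnth t i)].
have GE : [set t : n.-tuple mR | (\bigcup_k F k) (\row_i tnth t i)] = \bigcup_k G k.
  by apply/seteqP; split => t [k _ Fk]; exists k.
have mG : measurable (\bigcup_k G k) by apply: bigcup_measurable => k _; exact: mF.
split; first by rewrite /vmeasurable GE.
rewrite /vol GE; have ndG : nondecreasing_seq G.
  by apply/nondecreasing_seqP => k; apply/subsetPset => t; exact: ndF.
have cvgG := nondecreasing_cvg_mu (mu := @lebesgue_tuple R n) mF mG ndG.
rewrite -(cvg_lim _ cvgG)//; apply: lime_le; first by apply/cvg_ex; eexists; exact: cvgG.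
by apply: nearW => k; exact: Fc.
Qed.

Lemma vol_symm_diff P Q : compact P -> compact Q ->
  (vol (P `\` Q) <= (symm_diff_dist P Q)%:E)%E.
Proof.
move=> cP cQ; rewrite /symm_diff_dist fineK ?fin_numD ?volD_fin//.
by rewrite leeDl// vol_ge0.
Qed.

Lemma symm_diff_dist_bound P Q (a b : R) : compact P -> compact Q ->
  (vol (P `\` Q) <= a%:E)%E -> (vol (Q `\` P) <= b%:E)%E -> symm_diff_dist P Q <= a + b.
Proof.
move=> cP cQ Pa Qb.
have fin A (x : R) : (vol A <= x%:E)%E -> vol A \is a fin_num.
  by move=> Ax; rewrite ge0_fin_numE ?vol_ge0// (le_lt_trans Ax) ?ltry.
have f1 := fin _ _ Pa; have f2 := fin _ _ Qb.
rewrite /symm_diff_dist fineD// lerD//; rewrite -lee_fin fineK//.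
Qed.

(** The increasing sets [L m], intersections of the tails of the sequence, differ from
    [c m] by little volume. If they are all null, the volumes of the [c m] tend to
    zero. Otherwise their union is convex with an interior point and finite volume,
    hence bounded, and its closure has the same volume: this is the limit. *)
Lemma volume_fast_limit (c : nat -> set 'rV[R]_n) :
  (forall k, compact (c k)) -> (forall k, convex_set (c k)) ->
  (forall k, symm_diff_dist (c k) (c k.+1) <= 2 ^- k) ->
  (forall k, fine (vol (c k)) <= 2 ^- k + 2 ^- k) \/
  exists2 K, proper_convex_body K &
    forall k, symm_diff_dist (c k) K <= (2 ^- k + 2 ^- k) + (2 ^- k + 2 ^- k).
Proof.
move=> cc vc c1; pose r k : R := 2 ^- k + 2 ^- k.
have mc k : vmeasurable (c k) := measurable_compact (cc k).
have dc k j : symm_diff_dist (c k) (c (k + j)%N) < r k.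
  apply: (fast_dist (d := fun i j => symm_diff_dist (c i) (c j))).
  - by move=> i; exact: symm_diff_distxx.
  - exact: c1.
  - by move=> i j' k'; exact: symm_diff_dist_triangle.
pose L m := [set x | forall k, (m <= k)%N -> c k x].
have Lc m : L m `<=` c m by move=> x; apply.
have LS m : L m `<=` L m.+1 by move=> x Lx k mk; apply: Lx; exact: ltnW.
have Lmono i j : (i <= j)%N -> L i `<=` L j.
  by move=> ij x Lx k jk; apply: Lx; exact: leq_trans jk.
have cL m : compact (L m).
  apply: (subclosed_compact _ (cc m) (Lc m)).
  rewrite (_ : L m = \bigcap_(k in [set k | (m <= k)%N]) c k)//.
  by apply: closed_bigI => k _; exact: compact_closed_rV.
have vL m : convex_set (L m).
  apply/convex_setP => x y t t0 t1 Lx Ly k mk.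
  by have /convex_setP := vc k; apply; [exact: t0|exact: t1|exact: Lx|exact: Ly].
have mL m : vmeasurable (L m) := measurable_compact (cL m).
have cLm m : (vol (c m `\` L m) <= (r m)%:E)%E.
  pose D k := c (m + k)%N `\` c (m + k).+1.
  have mD k : vmeasurable (D k) by exact: vmeasurableD.
  pose F N := [set x | exists2 k, (k < N)%N & D k x].
  have FS N : F N.+1 = F N `|` D N.
    apply/seteqP; split => x.
      by move=> [i]; rewrite ltnS leq_eqVlt => /orP[/eqP ->|ik]; [right|left; exists i].
    by move=> [[i ik Bx]|Bx]; [exists i => //; rewrite ltnS ltnW|exists N].
  have FP N : vmeasurable (F N) /\ (vol (F N) <= (r m - 2 ^- (m + N) * 2)%:E)%E.
    elim: N => [|N [mF FN]].
      have -> : F 0%N = set0 by apply/seteqP; split => // x [].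
      split; first exact: measurable0.
      by rewrite vol0 addn0 /r mulr_natr mulr2n subrr.
    rewrite FS; split; first exact: vmeasurableU.
    apply: (@le_trans _ _ (vol (F N) + vol (D N))%E).
      exact: volU_le.
    apply: (@le_trans _ _ ((r m - 2 ^- (m + N) * 2)%:E + (2 ^- (m + N))%:E)%E).
      rewrite leeD//; apply: (le_trans (vol_symm_diff _ _)) => //.
      by rewrite lee_fin; exact: c1.
    by rewrite -EFinD lee_fin addnS (pow2_split (m + N)); lra.
  have [mU Ur] : vmeasurable (\bigcup_k F k) /\ (vol (\bigcup_k F k) <= (r m)%:E)%E.
    apply: vol_bigcup_le => k.
    - by have [] := FP k.
    - by rewrite FS; left.
    - have [_ /le_trans] := FP k; apply; rewrite lee_fin gerBl mulr_ge0// ltW// pow2_gt0.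
  apply: le_trans Ur; apply: le_vol => //; first exact: vmeasurableD.
  move=> x [cx Lx]; apply: contrapT => Fx; apply: Lx.
  have cm j : c (m + j)%N x.
    elim: j => [|j IH]; first by rewrite addn0.
    rewrite addnS; apply: contrapT => ncx; apply: Fx; exists j.+1 => //; exists j => //.
  by move=> k mk; rewrite -(subnKC mk).
have [K0|] := pselect (forall m, vol (L m) = 0%E).
  left => k; rewrite -lee_fin fineK; last exact: compact_vol_fin.
  by rewrite (volD (mL k) (mc k) (Lc k)) K0 add0e.
move=> /existsNP[m0 /eqP Lm0].
have {}Lm0 : (0 < vol (L m0))%E by rewrite lt_neqAle eq_sym Lm0 vol_ge0.
have [x0 /nbhs_ballP[rho/= rho0 Lrho]] := vol_interior (cL m0) (vL m0) Lm0.
right; pose LL := \bigcup_m L m.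
have bLL z : `|x0 - z| < rho -> LL z.
  by move=> /ball_norm/Lrho Lz; exists m0.
have vLL : convex_set LL.
  apply/convex_setP => x y t t0 t1 [i _ Lx] [j _ Ly]; exists (maxn i j) => //.
  have /convex_setP := vL (maxn i j); apply => //.
    by apply: Lmono Lx; exact: leq_maxl.
  by apply: Lmono Ly; exact: leq_maxr.
have mLL : vmeasurable LL.
  by have [] := @vol_bigcup_le L +oo%E mL LS (fun k => leey _).
have LLc m : (vol (LL `\` c m) <= (r m)%:E)%E.
  have -> : LL `\` c m = \bigcup_j (L j `\` c m) by rewrite setD_bigcupl.
  suff [] : vmeasurable (\bigcup_j (L j `\` c m)) /\ (vol (\bigcup_j (L j `\` c m)) <= (r m)%:E)%E by [].
  apply: vol_bigcup_le => k; first exact: vmeasurableD.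
    by move=> x [Lx ncx]; split => //; exact: LS.
  have [mk|km] := leqP m k.
    apply: (@le_trans _ _ (vol (c k `\` c m))).
      by apply: le_vol; [exact: vmeasurableD|exact: vmeasurableD|move=> x [/Lc]].
    apply: (le_trans (vol_symm_diff _ _)) => //; rewrite lee_fin symm_diff_distC.
    by rewrite -(subnKC mk) ltW.
  rewrite [X in vol X](_ : _ = set0) ?vol0 ?lee_fin ?addr_ge0 ?(ltW (pow2_gt0 _))//.
  by apply/seteqP; split => // x [Lx]; apply; apply: Lx; exact: ltnW.
have fLL : vol LL \is a fin_num.
  rewrite ge0_fin_numE ?vol_ge0//; apply: (@le_lt_trans _ _ (vol (c 0%N) + vol (LL `\` c 0%N))%E).
    apply: (@le_trans _ _ (vol (c 0%N `|` (LL `\` c 0%N)))).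
      apply: le_vol => //; first by apply: vmeasurableU => //; exact: vmeasurableD.
      by move=> x LLx; have [cx|cx] := pselect (c 0%N x); [left|right].
    by apply: volU_le => //; exact: vmeasurableD.
  by rewrite lte_add_pinfty ?(le_lt_trans (LLc 0%N)) ?ltry// ltey_eq compact_vol_fin.
have [T LT] := convex_bounded vLL mLL fLL rho0 bLL.
have cK := compact_closure LT.
have mK := measurable_compact cK.
have K0 := vol_closure vLL mLL fLL rho0 bLL cK.
exists (closure LL).
  split; last first.
    exists x0; apply/nbhs_ballP; exists rho => // z /ball_norm zr.
    by apply: subset_closure; exact: bLL.
  split; last by split; [exact: cK|exact: convex_closure].
  by exists x0; apply: subset_closure; apply: bLL; rewrite subrr normr0.
move=> k; apply: symm_diff_dist_bound => //.
  apply: le_trans (cLm k); apply: le_vol; [exact: vmeasurableD|exact: vmeasurableD|].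
  move=> x [cx Kx]; split => // Lx; apply: Kx; apply: subset_closure; by exists k.
apply: (@le_trans _ _ (vol ((closure LL `\` LL) `|` (LL `\` c k)))).
  apply: le_vol; [exact: vmeasurableD|by apply: vmeasurableU; exact: vmeasurableD|].
  by move=> x [Kx cx]; have [Lx|Lx] := pselect (LL x); [right|left].
apply: (@le_trans _ _ (vol (closure LL `\` LL) + vol (LL `\` c k))%E).
  by apply: volU_le; exact: vmeasurableD.
by rewrite K0 add0e.
Qed.

(** The point [None] is represented by the empty set, which turns the distance of
    [proper_bodies0] into a symmetric difference in all cases. *)
Definition carrier (p : proper_bodies0 R n) : set 'rV[R]_n :=
  if p is Some P then \val P else set0.

Lemma proper_bodies0_carrier p q :
  mdist p q = symm_diff_dist (carrier p) (carrier q).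
Proof.
rewrite proper_bodies0_mdistE; case: p q => [P|] [Q|] //=.
- by rewrite symm_diff_dist0.
- by rewrite symm_diff_distC symm_diff_dist0.
- by rewrite symm_diff_distxx.
Qed.

Lemma proper_bodies0_complete : complete_space (proper_bodies0 R n).
Proof.
apply: complete_fast => u u1.
have cu k : compact (carrier (u k)).
  by case: (u k) => [P|] /=; [have [[_ []]] := set_valP P|exact: compact0].
have vu k : convex_set (carrier (u k)).
  case: (u k) => [P|] /=; first by have [[_ []]] := set_valP P.
  by apply/convex_setP.
have du k : symm_diff_dist (carrier (u k)) (carrier (u k.+1)) <= 2 ^- k.
  by rewrite -proper_bodies0_carrier.
have [small|[K bK Ku]] := volume_fast_limit cu vu du.
  exists None => e e0; have [k0 k0e] := pow2_small (divr_gt0 e0 (ltr0Sn R 1)).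
  exists k0 => k k0k; rewrite proper_bodies0_carrier /= symm_diff_dist0 (le_lt_trans (small k))//.
  by rewrite (splitr e) ltrD// (le_lt_trans (pow2_le k0k)).
exists (Some (SigSub (mem_set bK))) => e e0.
have [k0 k0e] := pow2_small (divr_gt0 e0 (ltr0Sn R 3)).
exists k0 => k k0k; rewrite proper_bodies0_carrier /= (le_lt_trans (Ku k))//.
by have := le_lt_trans (pow2_le k0k) k0e; lra.
Qed.

End volume_complete.

(** * Approximation and deformation by Delzant polytopes *)

Section density.
Context {R : realType} {n : nat}.
Implicit Types (x y z w : 'rV[R]_n) (A B C P Q K L : set 'rV[R]_n).

Lemma delzant_proper P : delzant P -> proper_convex_body P.
Proof.
move=> [/polytope_hull[m [p ->]] i0 _ _ _]; split => //.
have [x /interior_subset px] := i0.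
by split; [exists x|split; [exact: compact_hull|exact: convex_hull]].
Qed.

Lemma norm_bound x (e : R) : 0 <= e -> (forall i, `|x ord0 i| <= e) -> `|x| <= e.
Proof.
move=> e0 xe; rewrite [leLHS]/Num.Def.normr/= mx_normrE; apply/bigmax_leP; split=> //.
by move=> [i j] _ /=; rewrite ord1.
Qed.

(** The points of the grid with mesh [1 / m.+1] lying close to [K], with every other
    grid point of a large cube replaced by one of them, so that the index type is
    finite and all points are good. *)
Lemma grid_net K (e : R) : convex_body K -> 0 < e ->
  exists (m : nat) (G : finType) (z : G -> 'rV[int]_n) (_ : G),
  let p g := m.+1%:R^-1 *: int_vect (z g) : 'rV[R]_n in
  (forall g, exists2 x, K x & enorm (x - p g) <= e) /\
  (forall x, K x -> exists g, enorm (x - p g) <= e).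
Proof.
move=> [[x0 Kx0] [cK _]] e0.
pose m := Num.truncn (n%:R / e); set N : R := m.+1%:R.
have N0 : 0 < N by rewrite ltr0n.
have Ne : n%:R * N^-1 <= e.
  by rewrite ler_pdivrMr// mulrC -ler_pdivrMr// ltW// truncnS_gt.
have [M KM] : exists M : nat, forall x, K x -> forall i, `|x ord0 i| <= M%:R.
  have [M0 [M0r KM0]] := compact_bounded cK.
  exists (Num.truncn (M0 + 1)).+1 => x Kx i.
  rewrite (le_trans (coord_le_norm x i))//.
  have := KM0 (M0 + 1) _ x Kx; rewrite ltrDl ltr01 => /(_ isT) /le_trans; apply.
  by rewrite ltW// truncnS_gt.
pose G := {ffun 'I_n -> 'I_(2 * M * m.+1).+1}.
pose z0 (g : G) : 'rV[int]_n := \row_i ((g i : nat)%:Z - (M * m.+1)%N%:Z).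
pose p0 (g : G) : 'rV[R]_n := N^-1 *: int_vect (z0 g).
have net x : K x -> exists g, enorm (x - p0 g) <= e.
  move=> Kx; pose y i : R := N * (x ord0 i + M%:R).
  have y0 i : 0 <= y i.
    rewrite mulr_ge0 ?(ltW N0)//; have := KM x Kx i; rewrite ler_norml => /andP[]; lra.
  have yM i : y i <= (2 * M * m.+1)%:R.
    rewrite natrM natrM /y mulrC ler_pM2r//; have := KM x Kx i; rewrite ler_norml => /andP[]; lra.
  have kM i : (Num.truncn (y i) < (2 * M * m.+1).+1)%N.
    by rewrite ltnS -(ler_nat R) (le_trans _ (yM i))// truncn_le.
  exists [ffun i => Ordinal (kM i)].
  rewrite (le_trans (enorm_le_norm _))// (le_trans _ Ne)// ler_wpM2l//.
  apply: norm_bound => [|i]; first by rewrite invr_ge0 ltW.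
  rewrite !mxE ffunE /=.
  have -> : x ord0 i - N^-1 * ((Num.truncn (y i))%:Z - (M * m.+1)%N%:Z)%:~R =
      N^-1 * (y i - (Num.truncn (y i))%:R).
    by rewrite rmorphB /= -!pmulrn natrM -/N /y; field; rewrite gt_eqF.
  rewrite normrM ger0_norm ?invr_ge0 ?(ltW N0)// ler_piMr ?invr_ge0 ?(ltW N0)//.
  rewrite ger0_norm ?subr_ge0 ?truncn_le// lerBlDr addrC natr1 ltW// truncnS_gt//.
have [g0 g0e] := net _ Kx0.
pose f g := if `[< exists2 x, K x & enorm (x - p0 g) <= e >] then g else g0.
exists m, G, (fun g => z0 (f g)), g0; split => [g|x Kx].
  by rewrite /f; case: asboolP => // _; exists x0.
have [g ge] := net _ Kx; exists g; rewrite /f; case: asboolP => // ng.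
by case: ng; exists x.
Qed.

(** Approximate the body by the hull of finitely many rational points, resolve the
    hyperplanes orthogonal to their differences, and add a small multiple of the
    polytope that carries the fan. On each cone the order of the points is fixed, so
    one of them minimises all the rays of the cone. *)
Lemma delzant_dense K (e : R) : convex_body K -> 0 < e ->
  exists2 P, delzant P & hausdorff_dist K P < e.
Proof.
move=> bK e0; have e30 : 0 < e / 3 by rewrite divr_gt0.
have [m [G [z [g0 /= [pK Kp]]]]] := grid_net bK e30.
pose p g : 'rV[R]_n := m.+1%:R^-1 *: int_vect (z g).
have m0 : 0 < m.+1%:R^-1 :> R by rewrite invr_gt0.
have [I [v [N [E [FP res]]]]] :=
  @fan_resolution R n [seq z u.1 - z u.2 | u <- enum {: G * G}].
have /choice[f fP] s : exists g, forall i h,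
    dot (int_vect (N s i)) (p g) <= dot (int_vect (N s i)) (p h).
  have [g _ gmin] := @arg_minP _ _ _ g0 xpredT (fun g => \sum_i zdot (z g) (N s i)) isT.
  exists g => i h; rewrite !dotZr ler_pM2l// -subr_ge0 -dotBr -int_vectB dot_int ler0z zdotC.
  apply: resolved_ge0; first by apply: res; apply/mapP; exists (h, g); rewrite ?mem_enum.
  under eq_bigr do rewrite zdotDl zdotNl.
  by rewrite sumrB subr_ge0; exact: gmin.
pose q s := p (f s).
have qN : adapted N q by move=> s t i; exact: fP.
have /card_gt0P[s0 _] := fan_nonempty FP.
have bq := hull_body q s0.
have Kq : hausdorff_dist K (hull q) <= e / 3.
  have [K0 [_ cK]] := bK.
  apply: hausdorff_le => //; [by exists (q s0); exact: hull_pt| |].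
    move=> x Kx; have [g xg] := Kp _ Kx; exists (p g) => //.
    by apply: (adapted_hull FP (X := range p)) => [s i _ [h _ <-]|]; [exact: fP|exists g].
  move=> y; apply: convex_comb_close => // s.
  by have [x Kx xs] := pK (f s); exists x => //; rewrite enormB.
pose B := \sum_s enorm (v s); have B0 : 0 <= B by apply: sumr_ge0 => s _; exact: enorm_ge0.
have B1 : 0 < B + 1 by rewrite ltr_wpDl.
pose d := e / 3 / (B + 1); have d0 : 0 < d by rewrite divr_gt0.
have FPd := fan_polytopeD (fan_polytopeZ d0 FP) qN.
exists (hull (fun s => d *: v s + q s)); first exact: (fan_delzant FPd).
have qd : hausdorff_dist (hull q) (hull (fun s => d *: v s + q s)) <= e / 3.
  apply: (hull_hausdorff s0) => s; rewrite opprD addrCA subrr addr0 enormN enormZ gtr0_norm//.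
  rewrite /d mulrAC ler_pdivrMr// ler_pM2l// (le_trans (_ : _ <= B))//; last by rewrite lerDl.
  by rewrite /B (bigD1 s)//= lerDl sumr_ge0// => t _; exact: enorm_ge0.
rewrite (le_lt_trans (hausdorff_dist_triangle bK bq (hull_body _ s0)))//.
by move: Kq qd e0; lra.
Qed.

(** A fan that resolves the edge directions of both polytopes is adapted to both. Then
    [(1 - t) P + t Q + t (1 - t) D], where [D] carries the fan, is Delzant for
    [0 < t < 1], and it is [P] and [Q] at the ends. *)
Lemma delzant_path P Q : delzant P -> delzant Q ->
  exists gamma : R -> set 'rV[R]_n, exists C : R,
  [/\ forall t, 0 <= t -> t <= 1 -> delzant (gamma t), gamma 0 = P, gamma 1 = Q &
    forall s t, 0 <= s -> s <= 1 -> 0 <= t -> t <= 1 ->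
      hausdorff_dist (gamma s) (gamma t) <= `|s - t| * C].
Proof.
move=> dP dQ; have [A AP] := delzant_adapted dP; have [B BQ] := delzant_adapted dQ.
have [I [v [N [E [FP res]]]]] := @fan_resolution R n (A ++ B).
have [p pN PE] : exists2 p : I -> 'rV[R]_n, adapted N p & P = hull p.
  by apply: AP FP _ => a aA; apply: res; rewrite mem_cat aA.
have [q qN QE] : exists2 q : I -> 'rV[R]_n, adapted N q & Q = hull q.
  by apply: BQ FP _ => a aB; apply: res; rewrite mem_cat aB orbT.
have /card_gt0P[s0 _] := fan_nonempty FP.
pose g t s := (t * (1 - t)) *: v s + ((1 - t) *: p s + t *: q s).
have g0 : g 0 = p.
  by apply/funext => s; rewrite /g mul0r !scale0r add0r subr0 scale1r addr0.
have g1 : g 1 = q.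
  by apply/funext => s; rewrite /g subrr mulr0 !scale0r !add0r scale1r.
exists (fun t => hull (g t)), (\sum_s (enorm (v s) + enorm (q s - p s))); split.
- move=> t; rewrite le_eqVlt => /orP[/eqP <- _|t0]; first by rewrite g0 -PE.
  rewrite le_eqVlt => /orP[/eqP ->|t1]; first by rewrite g1 -QE.
  apply: (fan_delzant (N := N) (E := E)); apply: fan_polytopeD.
    by apply: fan_polytopeZ FP; rewrite mulr_gt0// subr_gt0.
  by apply: adaptedD; apply: adaptedZ => //; [rewrite subr_ge0|]; exact: ltW.
- by rewrite g0 -PE.
- by rewrite g1 -QE.
- move=> s t s0' s1 t0 t1; apply: (hull_hausdorff s0) => k.
  have -> : g s k - g t k = (s - t) *: ((1 - s - t) *: v k + (q k - p k)).
    by apply/rowP => i; rewrite !mxE; ring.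
  rewrite enormZ ler_wpM2l// (le_trans (ler_enormD _ _))//.
  rewrite (bigD1 k)//= -[leLHS]addr0 lerD//; last first.
    by apply: sumr_ge0 => i _; rewrite addr_ge0// enorm_ge0.
  rewrite lerD2r enormZ ler_piMl ?enorm_ge0// ler_norml; apply/andP; split; lra.
Qed.

End density.

(** * The two spaces of Delzant polytopes *)

Section topology.
Context {R : realType}.

(** A compact neighbourhood of [x] would contain a trace of the filter of
    neighbourhoods of a nearby [y] outside [D], which has no cluster point in [D]. *)
Lemma metric_not_locally_compact (T : metricType R) (D : set T) (x : D) :
  (forall e : R, 0 < e -> exists2 y, mdist (\val x) y < e & ~ D y /\ closure D y) ->
  ~ locally_compact_space D.
Proof.
move=> nearx /(_ x Logic.I)[U xU [cU _]].
have /nbhs_ballP[e /= e0 eU] : nbhs x U.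
  by move: xU; rewrite /within /=; apply: filterS => y; apply.
have [y xy [nDy Dy]] := nearx e e0.
pose G : set_system D := [set A | exists2 d : R, 0 < d & forall z : D, mdist y (\val z) < d -> A z].
have GF : ProperFilter G.
  apply: Build_ProperFilter_ex => [A [d d0 dA]|].
    have [z [Dz]] := Dy _ (nbhsx_ballx y d d0); rewrite ballEmdist/= => yz.
    by exists (SigSub (mem_set Dz)); exact: dA.
  split; first by exists 1.
    move=> A B [a a0 aA] [b b0 bB]; exists (Num.min a b); first by rewrite lt_min a0.
    by move=> z; rewrite lt_min => /andP[/aA ? /bB].
  by move=> A B AB [a a0 aA]; exists a => // z /aA /AB.
have GU : G U.
  exists (e - mdist (\val x) y); first by rewrite subr_gt0.
  move=> z yz; apply: eU; rewrite -[ball x e z]/(ball (\val x) e (\val z)) ballEmdist /=.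
  by rewrite (le_lt_trans (metric_triangle _ y _))// addrC -ltrBrDr.
have [z [Uz clz]] := cU G GF GU.
suff zy : \val z = y by apply: nDy; rewrite -zy; exact: set_valP.
apply/eqP; apply: contrapT => /negP zy.
have d0 : 0 < mdist (\val z) y / 2 by rewrite divr_gt0// mdist_gt0.
have [t [yt zt]] : [set t : D | mdist y (\val t) < mdist (\val z) y / 2] `&` ball z (mdist (\val z) y / 2) !=set0.
  apply: clz; last exact: nbhsx_ballx.
  by exists (mdist (\val z) y / 2).
move: zt; rewrite -[ball z _ t]/(ball (\val z) _ (\val t)) ballEmdist /= => zt.
have := metric_triangle (\val z) (\val t) y; rewrite (metric_sym (\val t)) => tri.
by move: yt => /=; have := zt; move: tri; lra.
Qed.

Lemma metric_continuous (T : metricType R) (D : set T) (g : R -> D) :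
  (forall t e, 0 < e -> exists2 d : R, 0 < d &
     forall s, `|t - s| < d -> mdist (\val (g t)) (\val (g s)) < e) ->
  {within `[0, 1], continuous g}.
Proof.
move=> gc; apply: continuous_subspaceT => t A /nbhs_ballP[e /= e0 eA].
have [d d0 dg] := gc t e e0; apply/nbhs_ballP; exists d => //= s ts; apply: eA.
by rewrite -[ball _ e _]/(ball (\val (g t)) e (\val (g s))) ballEmdist /=; exact: dg.
Qed.

(** Extends a path on the unit interval to the line. *)
Definition clamp (t : R) := Num.max 0 (Num.min t 1).

Lemma clamp_ge0 t : 0 <= clamp t. Proof. by rewrite le_max lexx. Qed.

Lemma clamp_le1 t : clamp t <= 1.
Proof. by rewrite ge_max ler01 ge_min lexx orbT. Qed.

Lemma clamp_lip s t : `|clamp s - clamp t| <= `|s - t|.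
Proof.
have := ler_norm (s - t); have := ler_norm (t - s); rewrite (distrC t) /clamp.
move: `|s - t| => X; rewrite ler_norml /Num.max /Num.min.
by do !case: ifPn; rewrite -?leNgt => *; apply/andP; split; lra.
Qed.

End topology.

Section spaces.
Context {R : realType} {n : nat}.
Implicit Types (x y z w : 'rV[R]_n) (A B C P Q K L : set 'rV[R]_n).

Lemma delzant_clamped_path P Q : delzant P -> delzant Q ->
  exists gamma : R -> set 'rV[R]_n, exists2 C : R, 0 <= C &
  [/\ forall t, delzant (gamma t), gamma 0 = P, gamma 1 = Q &
    forall s t, hausdorff_dist (gamma s) (gamma t) <= `|s - t| * C].
Proof.
move=> dP dQ; have [g [C [gd g0 g1 gC]]] := delzant_path dP dQ.
exists (fun t => g (clamp t)), `|C| => //; split.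
- by move=> t; apply: gd; [exact: clamp_ge0|exact: clamp_le1].
- by rewrite /clamp min_l ?ler01// max_l.
- by rewrite /clamp min_l// max_r ?ler01.
- move=> s t; apply: le_trans (gC _ _ _ _ _ _) _; rewrite ?clamp_ge0 ?clamp_le1//.
  by apply: le_trans (ler_wpM2r _ (clamp_lip s t)) => //; rewrite ler_wpM2l// ler_norm.
Qed.

Definition body K (bK : convex_body K) : bodies R n := SigSub (mem_set bK).

Definition proper_body K (pK : proper_convex_body K) : proper_bodies0 R n :=
  Some (SigSub (mem_set pK)).

Lemma delzant_H_path_connected : path_connected R (delzant_H R n).
Proof.
move=> x y; have dx : delzant (\val (\val x)) := set_valP x.
have dy : delzant (\val (\val y)) := set_valP y.
have [k [C C0 [kd k0 k1 kC]]] := delzant_clamped_path dx dy.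
have /choice[g gk] t : exists z : delzant_H R n, \val (\val z) = k t.
  have dD : delzant_H R n (body (delzant_proper (kd t)).1) by exact: kd.
  by exists (SigSub (mem_set dD)).
exists g; split; last 2 first.
- by apply/val_inj/val_inj; rewrite gk k0.
- by apply/val_inj/val_inj; rewrite gk k1.
apply: metric_continuous => t e e0; exists (e / (C + 1)); first by rewrite divr_gt0// ltr_wpDl.
move=> s ts; rewrite bodies_mdistE !gk; apply: (le_lt_trans (kC _ _)).
apply: (@le_lt_trans _ _ (`|t - s| * (C + 1))); first by rewrite ler_wpM2l// lerDl.
by rewrite -ltr_pdivlMr// ltr_wpDl.
Qed.

Lemma delzant_V_path_connected : path_connected R (delzant_V R n).
Proof.
move=> x y; have [X dX Xx] : delzant_V R n (\val x) by exact: set_valP.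
have [Y dY Yy] : delzant_V R n (\val y) by exact: set_valP.
have [k [C C0 [kd k0 k1 kC]]] := delzant_clamped_path dX dY.
have /choice[g gk] t : exists z : delzant_V R n,
    exists2 K, \val z = Some K & \val K = k t.
  have dD : delzant_V R n (proper_body (delzant_proper (kd t))).
    by eexists; last reflexivity; exact: kd.
  by exists (SigSub (mem_set dD)); eexists; first reflexivity.
exists g; split; last 2 first.
- apply/val_inj; have [K -> K0] := gk 0; rewrite -Xx; congr Some; apply/val_inj.
  by rewrite K0 k0.
- apply/val_inj; have [K -> K1] := gk 1; rewrite -Yy; congr Some; apply/val_inj.
  by rewrite K1 k1.
apply: metric_continuous => t e e0.
have [d d0 dk] := symm_diff_dist_close (delzant_proper (kd t)) e0.
exists (d / (C + 1)); first by rewrite divr_gt0// ltr_wpDl.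
move=> s ts; have [Kt -> Ktk] := gk t; have [Ks -> Ksk] := gk s.
rewrite proper_bodies0_mdistE /= Ktk Ksk.
apply: (dk _ (delzant_proper (kd s)).1 _).2; apply: (le_lt_trans (kC _ _)).
apply: (@le_lt_trans _ _ (`|t - s| * (C + 1))); first by rewrite ler_wpM2l// lerDl.
by rewrite -ltr_pdivlMr// ltr_wpDl.
Qed.

Lemma delzant_H_dense (b : bodies R n) : closure (delzant_H R n) b.
Proof.
move=> B /nbhs_ballP[e /= e0 eB].
have [P dP Pb] := delzant_dense (set_valP b) e0.
exists (body (delzant_proper dP).1); split; first exact: dP.
by apply: eB; rewrite ballEmdist /= bodies_mdistE.
Qed.

Lemma delzant_V_dense (b : proper_bodies0 R n) : (0 < n)%N -> closure (delzant_V R n) b.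
Proof.
move=> n0 B /nbhs_ballP[e /= e0 eB].
suff [P dP Pb] : exists2 P, delzant P & symm_diff_dist (carrier b) P < e.
  exists (proper_body (delzant_proper dP)); split; first by eexists; last reflexivity.
  by apply: eB; rewrite ballEmdist /= proper_bodies0_carrier.
case: b {eB} => [K|] /=.
  have pK : proper_convex_body (\val K) by exact: set_valP.
  have [d d0 dK] := symm_diff_dist_close pK e0.
  have [P dP KP] := delzant_dense pK.1 d0.
  by exists P => //; apply: (dK _ (delzant_proper dP).1 KP).2.
pose v (s : {ffun 'I_n -> bool}) : 'rV[R]_n := \row_k (s k)%:R.
have [N [E FP]] : exists N E, fan_polytope v N E := cube_fan_polytope.
have V0 : 0 < fine (vol (hull v)) + 1 by rewrite ltr_wpDl// fine_ge0 ?vol_ge0.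
pose c := Num.min 1 (e / (fine (vol (hull v)) + 1)).
have c0 : 0 < c by rewrite lt_min ltr01 divr_gt0.
have c1 : c <= 1 by rewrite ge_min lexx.
have dc := fan_delzant (fan_polytopeZ c0 FP).
exists (hull (fun s => c *: v s)) => //.
have mc := measurable_compact (@compact_hull _ _ _ (fun s => c *: v s)).
rewrite symm_diff_distC symm_diff_dist0 (vol_affine 0 c0 mc).
have -> : [set x | hull (fun s => c *: v s) (c *: x + 0)] = hull v.
  apply/seteqP; split => x; rewrite /= addr0.
    move=> [a [a0 a1 xE]]; exists a; split => //; apply: (scalerI (lt0r_neq0 c0)).
    by rewrite xE scaler_sumr; apply: eq_bigr => s _; rewrite !scalerA mulrC.
  move=> [a [a0 a1 ->]]; exists a; split => //.
  by rewrite scaler_sumr; apply: eq_bigr => s _; rewrite !scalerA mulrC.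
rewrite fineM ?compact_vol_fin//; last exact: compact_hull.
apply: (@le_lt_trans _ _ (c * fine (vol (hull v)))).
  rewrite ler_wpM2r ?fine_ge0 ?vol_ge0//= -(prednK n0) exprS ler_piMr ?(ltW c0)//.
  by rewrite exprn_ile1// ltW.
apply: (@lt_le_trans _ _ (c * (fine (vol (hull v)) + 1))); first by rewrite ltr_pM2l// ltrDl.
by rewrite -ler_pdivlMr// ge_min lexx orbT.
Qed.

(** Multiples of the square root of two by inverses of integers, with the parity of the
    exponent of two in [2 a ^ 2 = k ^ 2 b ^ 2]. *)
Lemma irrational_small (e : R) : 0 < e ->
  exists2 t : R, 0 < t < e & forall a b : int, a != 0 -> t * a%:~R != b%:~R.
Proof.
move=> e0; have s0 : 0 < Num.sqrt 2 :> R by rewrite sqrtr_gt0.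
pose k := Num.truncn (Num.sqrt 2 / e).
exists (Num.sqrt 2 / k.+1%:R).
  rewrite divr_gt0//= ltr_pdivrMr// mulrC -ltr_pdivrMr//; exact: truncnS_gt.
move=> a b a0; apply/eqP => /(congr1 (fun r : R => (k.+1%:R * r) ^+ 2)).
have -> : k.+1%:R * (Num.sqrt 2 / k.+1%:R * a%:~R) = Num.sqrt 2 * a%:~R :> R by field.
rewrite !exprMn sqr_sqrtr// => E2.
have {E2} : 2 * a ^+ 2 = k.+1%:Z ^+ 2 * b ^+ 2.
  by apply: (@intr_inj R); rewrite (rmorphM _ 2) (rmorphM _ (k.+1%:Z ^+ 2)) !rmorphXn /=.
move=> /(congr1 absz); rewrite !abszM /= !mulnn => E2.
have a20 : (0 < `|a| ^ 2)%N by rewrite expn_gt0 absz_gt0 a0.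
have b20 : (0 < k.+1 ^ 2 * `|b| ^ 2)%N by rewrite -E2 muln_gt0.
have := congr1 (logn 2) E2; rewrite lognM// lognM//; last by move: b20; rewrite muln_gt0 => /andP[].
rewrite !lognX /= => /(congr1 odd).
by rewrite -mulnDr oddD !oddM.
Qed.

(** The edge of the cube from the origin in direction [i1] is sheared to an edge of
    direction [e_i1 + t e_i0], which is irrational. *)
Lemma sheared_cube_not_delzant (i0 i1 : 'I_n) (t : R) : i0 != i1 ->
  (forall a b : int, a != 0 -> t * a%:~R != b%:~R) ->
  ~ delzant (hull (fun s : {ffun 'I_n -> bool} =>
      \row_k (s k)%:R + (t * (s i1)%:R) *: delta_mx ord0 i0)).
Proof.
move=> i01 irr [_ _ _ rat _].
set p := (fun s : {ffun 'I_n -> bool} => _) in rat.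
pose w : 'rV[R]_n := delta_mx ord0 i1 + t *: delta_mx ord0 i0.
(* On the vertex p s the functional c counts, negatively, the coordinates of s
   other than i1. *)
pose c : 'rV[R]_n := \row_k (if k == i1 then t else -1).
have dot_delta x k : dot x (delta_mx ord0 k) = x ord0 k.
  rewrite /dot (bigD1 k)//= mxE !eqxx mulr1 big1 ?addr0// => j /negbTE jk.
  by rewrite mxE jk andbF mulr0.
have cp s : dot c (p s) = - \sum_(k | k != i1) (s k)%:R.
  rewrite /p dotDr dotZr dot_delta mxE (negbTE i01) mulrN1 /dot (bigD1 i1)//=.
  rewrite !mxE eqxx addrAC -[RHS]addr0 -[in RHS](subrr (t * (s i1)%:R)).
  rewrite subrr add0r addr0 -sumrN; apply: eq_bigr => k /negbTE k1.
  by rewrite !mxE k1 mulN1r.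
have cmax s : dot c (p s) <= 0.
  by rewrite cp oppr_le0 sumr_ge0// => k _; rewrite ler0n.
have face s : dot c (p s) = 0 -> p s = (s i1)%:R *: w.
  rewrite cp => /eqP; rewrite oppr_eq0 psumr_eq0 => [/allP s0|k _]; last by rewrite ler0n.
  rewrite /p /w scalerDr scalerA [_ * t]mulrC; congr (_ + _).
  apply/rowP => k; rewrite !mxE eqxx /=; have [->|k1] := eqVneq k i1; first by rewrite mulr1.
  by have := s0 k (mem_index_enum _); rewrite k1 mulr0 => /eqP.
pose s1 : {ffun 'I_n -> bool} := [ffun k => k == i1].
pose s0 : {ffun 'I_n -> bool} := [ffun k => false].
have p0 : p s0 = 0.
  have := face s0; rewrite cp ffunE scale0r; apply.
  by rewrite big1 ?oppr0// => k _; rewrite ffunE.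
have p1 : p s1 = w.
  have := face s1; rewrite cp ffunE eqxx scale1r; apply.
  by rewrite big1 ?oppr0// => k /negbTE k1; rewrite ffunE k1.
have wi1 : w ord0 i1 = 1 by rewrite !mxE !eqxx eq_sym (negbTE i01) mulr0 addr0.
have wi0 : w ord0 i0 = t by rewrite !mxE !eqxx (negbTE i01) mulr1 add0r.
have eE : edge (hull p) (segment 0 w).
  split; last first.
    exists 0, w; split => //; apply/eqP => w0; move: wi1; rewrite -w0 mxE => /eqP.
    by rewrite eq_sym oner_eq0.
  split; first by exists 0; exact: segment_l.
  exists c; apply/seteqP; split => x.
    move=> wx; split.
      by move: x wx; apply: convex_segment; [exact: convex_hull|rewrite -p0; exact: hull_pt|
        rewrite -p1; exact: hull_pt].
    move=> y py; apply: (le_trans (hull_le cmax py)).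
    move: wx => /segmentP[r [_ _ ->]]; rewrite add0r subr0 dotZr -p1 cp big1 ?oppr0 ?mulr0//.
    by move=> k /negbTE k1; rewrite ffunE k1.
  move=> [px xmax]; have cx0 : dot c x = 0.
    apply/eqP; rewrite eq_le (hull_le cmax px) -(dot0r c) xmax// -p0; exact: hull_pt.
  have [a [a0 a1 xE aF]] := hull_face cmax px cx0.
  have xw : x = (\sum_s a s * (s i1)%:R) *: w.
    rewrite xE scaler_suml; apply: eq_bigr => s _.
    have [->|/aF/face ->] := eqVneq (a s) 0; first by rewrite mul0r !scale0r.
    by rewrite scalerA.
  apply/segmentP; exists (\sum_s a s * (s i1)%:R); split.
  - by apply: sumr_ge0 => s _; rewrite mulr_ge0.
  - by rewrite -[leRHS]a1; apply: ler_sum => s _; rewrite ler_piMr//; case: (s i1).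
  - by rewrite subr0 add0r.
have [u u0 uP] := rat _ eE.
have [r] := uP _ _ (segment_l _ _) (segment_r _ _); rewrite subr0 => wE.
have u1 : r * (u ord0 i1)%:~R = 1 by have /rowP/(_ i1) := wE; rewrite wi1 !mxE.
have u0' : r * (u ord0 i0)%:~R = t by have /rowP/(_ i0) := wE; rewrite wi0 !mxE.
have ui1 : u ord0 i1 != 0.
  by apply/eqP => ui1; move: u1; rewrite ui1 mulr0 => /eqP; rewrite eq_sym oner_eq0.
have /eqP := irr _ (u ord0 i0) ui1; apply.
by rewrite -u0' mulrAC u1 mul1r.
Qed.

Lemma non_delzant_near : (1 < n)%N -> exists2 P, delzant P & forall e : R, 0 < e ->
  exists K, [/\ convex_body K, hausdorff_dist P K < e & ~ delzant K].
Proof.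
move=> n1; pose v (s : {ffun 'I_n -> bool}) : 'rV[R]_n := \row_k (s k)%:R.
have [N [E FP]] : exists N E, fan_polytope v N E := cube_fan_polytope.
exists (hull v); first exact: fan_delzant FP.
move=> e e0; have [t /andP[t0 te] irr] := irrational_small e0.
pose i0 : 'I_n := Ordinal (ltnW n1); pose i1 : 'I_n := Ordinal n1.
have /(sheared_cube_not_delzant) /(_ irr) := isT : i0 != i1.
set q := (fun s : {ffun 'I_n -> bool} => _) => nd.
exists (hull q); split => //; first exact: (hull_body _ [ffun=> true]).
apply: le_lt_trans te; apply: (hull_hausdorff [ffun=> true]) => s.
rewrite /q /v opprD addrA subrr add0r enormN enormZ.
rewrite (_ : enorm _ = 1) ?mulr1; last first.
  rewrite /enorm /dot (bigD1 i0)//= mxE !eqxx mulr1 big1 ?addr0 ?sqrtr1// => k /negbTE k0.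
  by rewrite mxE k0 andbF mulr0.
by case: (s i1); rewrite ?mulr1 ?mulr0 ?normr0 ?(ltW t0)// gtr0_norm.
Qed.

End spaces.

Theorem theorem3p18 (R : realType) (n : nat) (hn : (0 < n)%N) :
  (path_connected R (delzant_V R n) /\ path_connected R (delzant_H R n)) /\
  ((1 < n)%N -> ~ locally_compact_space (delzant_V R n) /\
                ~ locally_compact_space (delzant_H R n)) /\
  (proper_V R n `<=` closure (delzant_V R n) /\
   proper_H R n `<=` closure (delzant_H R n)) /\
  (is_completion_of (delzant_V R n) /\ is_completion_of (proper_V R n)) /\
  (is_completion_of (delzant_H R n) /\ is_completion_of (proper_H R n)).
Proof.
have dV_pV : delzant_V R n `<=` proper_V R n by move=> _ [P _ <-]; exists P.
have dH_pH : delzant_H R n `<=` proper_H R n by move=> P; exact: delzant_proper.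
have dense_of (T : topologicalType) (D D' : set T) : D `<=` D' ->
    (forall x, closure D x) -> dense D'.
  move=> DD' clD O [x Ox] oO.
  by have [y [/DD' Dy Oy]] := clD x O (open_nbhs_nbhs (conj oO Ox)); exists y.
split; first by split; [exact: delzant_V_path_connected|exact: delzant_H_path_connected].
split.
  move=> n1; have [P dP Pnear] := @non_delzant_near R n n1; split.
    have dP' : delzant_V R n (proper_body (delzant_proper dP)).
      by eexists; last reflexivity; exact: dP.
    apply: (@metric_not_locally_compact _ _ _ (SigSub (mem_set dP'))) => e e0.
    have [d d0 dd] := symm_diff_dist_close (delzant_proper dP) e0.
    have [K [bK PK ndK]] := Pnear d d0; have [pK PKe] := dd K bK PK.
    exists (proper_body pK); first by rewrite proper_bodies0_mdistE.
    split; last exact: delzant_V_dense.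
    by move=> [K' dK' [KK']]; apply: ndK; move: dK'; rewrite KK'.
  have dP' : delzant_H R n (body (delzant_proper dP).1) by exact: dP.
  apply: (@metric_not_locally_compact _ _ _ (SigSub (mem_set dP'))) => e e0.
  have [K [bK PK ndK]] := Pnear e e0.
  exists (body bK); first by rewrite bodies_mdistE.
  by split; [exact: ndK|exact: delzant_H_dense].
split; first by split=> b _; [exact: delzant_V_dense|exact: delzant_H_dense].
split; split; split.
- exact: proper_bodies0_complete.
- by apply: (dense_of _ _ _ (@subset_refl _ _)) => b; exact: delzant_V_dense.
- exact: proper_bodies0_complete.
- by apply: (dense_of _ _ _ dV_pV) => b; exact: delzant_V_dense.
- exact: bodies_complete.
- by apply: (dense_of _ _ _ (@subset_refl _ _)) => b; exact: delzant_H_dense.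
- exact: bodies_complete.
- by apply: (dense_of _ _ _ dH_pH) => b; exact: delzant_H_dense.
Qed.
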